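(* Let the integer $\eta\ge 0$, the expansive integer matrix $\tilde M=\begin{pmatrix}\tilde a&\tilde b\\ \tilde c&\tilde d\end{pmatrix}\in M_2(\mathbb{Z})$ and the digit set $\tilde D\subset\mathbb{Z}^2$ be obtained from an expansive integer matrix $M$ and a digit set $D$ by the construction described in the context, and let $\mu_{\tilde M,\tilde D}$ be the associated self-affine measure. If $\eta>0$, then $\mu_{\tilde M,\tilde D}$ is a spectral measure if and only if $\tilde a,\tilde d\in2\mathbb{Z}$ and $2^{\eta+1}\mid\tilde c$.
   Context: Construction. Let $M\in M_2(\mathbb{Z})$ be expansive (all eigenvalues of modulus strictly greater than one) and let $D=\{(0,0)^t,(\alpha_1,\alpha_2)^t,(\beta_1,\beta_2)^t,(-\alpha_1-\beta_1,-\alpha_2-\beta_2)^t\}\subset\mathbb{Z}^2$ with $\alpha_1\beta_2-\alpha_2\beta_1\ne0$ and $\gcd(\alpha_1,\alpha_2,\beta_1,\beta_2)=1$. Write $\alpha_1\beta_2-\alpha_2\beta_1=2^\eta\gamma$ with $\eta\ge0$ an integer and $\gamma$ odd. It is assumed that $\alpha:=\gcd(\alpha_1,\alpha_2)$ is odd. Write $\alpha_1=\alpha t_1$, $\alpha_2=\alpha t_2$ with $\gcd(t_1,t_2)=1$, choose $p,q\in\mathbb{Z}$ with $pt_1+qt_2=1$, and put $\omega=p\beta_1+q\beta_2$ and $\beta=\gamma/\alpha$ (an odd integer). Let $Q=\begin{pmatrix}p&q\\-t_2&t_1\end{pmatrix}$ (so $\det Q=1$). Define $$\tilde M=QMQ^{-1}\in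 M_2(\mathbb{Z}),\qquad \tilde D=QD=\left\{\begin{pmatrix}0\\0\end{pmatrix},\begin{pmatrix}\alpha\\0\end{pmatrix},\begin{pmatrix}\omega\\2^\eta\beta\end{pmatrix},\begin{pmatrix}-\alpha-\omega\\-2^\eta\beta\end{pmatrix}\right\}\subset\mathbb{Z}^2.$$ Self-affine measure: for expansive $M\in M_n(\mathbb{R})$ and finite $D\subset\mathbb{R}^n$, $\mu_{M,D}$ is the unique Borel probability measure with $\mu_{M,D}=\frac{1}{\#D}\sum_{d\in D}\mu_{M,D}\circ\phi_d^{-1}$, $\phi_d(x)=M^{-1}(x+d)$. A compactly supported Borel probability measure $\mu$ on $\mathbb{R}^n$ is a spectral measure if there is a countable set $\Lambda\subset\mathbb{R}^n$ such that $\{e^{2\pi i\langle\lambda,x\rangle}:\lambda\in\Lambda\}$ is an orthonormal basis of $L^2(\mu)$. *)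

(* Defs.v *)
From HB Require Import structures.
From mathcomp Require Import all_boot all_order all_algebra finmap.
From mathcomp Require Import ring complex.
From mathcomp Require Import all_classical all_reals all_analysis.

Set Implicit Arguments.
Unset Strict Implicit.
Unset Printing Implicit Defensive.
Import Order.TTheory GRing.Theory Num.Theory.
Import numFieldNormedType.Exports.

Local Open Scope classical_set_scope.
Local Open Scope ring_scope.

(** Left eigenvalues, as in [eigenvalue], are the same as right ones for a
    square matrix; in [R[i]], [1 < `|z|] compares complex numbers that are real. *)
Definition expansive (R : realType) (n : nat) (A : 'M[R]_n) : Prop :=
  forall z : R[i],
    eigenvalue (map_mx (real_complex R) A : 'M[R[i]]_n) z -> 1 < `|z|.

(** R^n with its Borel sigma-algebra. *)
Notation Rn R n := (g_sigma_algebraType (@open 'cV[R]_n)).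

Definition ifs_map (R : realType) (n : nat) (A : 'M[R]_n) (d : 'cV[R]_n)
    (x : 'cV[R]_n) : 'cV[R]_n := invmx A *m (x + d).

(** For A expansive and D nonempty, exactly one Borel probability measure
    satisfies this equation (Hutchinson). *)
Definition self_affine_measure (R : realType) (n : nat) (A : 'M[R]_n)
    (D : {fset 'cV[R]_n}) (mu : probability (Rn R n) R) : Prop :=
  forall B : set (Rn R n), measurable B ->
    mu B = (((#|` D|%:R)^-1)%:E *
            \sum_(d <- D) mu (ifs_map A d @^-1` B))%E.

Section L2.
Context (R : realType) (d : measure_display) (T : measurableType d).
Variable mu : {measure set T -> \bar R}.

Definition L2_sqnorm (f : T -> R[i]) : \bar R :=
  (\int[mu]_x ((complex.Re (f x)) ^+ 2 + (complex.Im (f x)) ^+ 2)%:E)%E.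

(** The complex-valued function f represents an element of L^2(mu). *)
Definition L2_fun (f : T -> R[i]) : Prop :=
  [/\ measurable_fun setT (fun x => complex.Re (f x)),
      measurable_fun setT (fun x => complex.Im (f x)) &
      (L2_sqnorm f < +oo)%E].

Definition L2_inner (f g : T -> R[i]) : R[i] :=
  Complex (\int[mu]_x complex.Re (f x * conjc (g x)))%R
          (\int[mu]_x complex.Im (f x * conjc (g x)))%R.

(** The family (e l), l in L, is orthonormal in L^2(mu) and its finite linear
    combinations are dense in L^2(mu). *)
Definition L2_orthonormal_basis (I : choiceType) (L : set I)
    (e : I -> T -> R[i]) : Prop :=
  [/\ forall l, L l -> L2_fun (e l),
      forall l l', L l -> L l' -> L2_inner (e l) (e l') = (l == l')%:R &
      forall f, L2_fun f -> forall eps : R, 0 < eps ->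
        exists (F : {fset I}) (c : I -> R[i]),
          [set` F] `<=` L /\
          (L2_sqnorm (fun x => f x - \sum_(l <- F) c l * e l x)%R < eps%:E)%E].

End L2.

Definition dotv (R : realType) (n : nat) (u v : 'cV[R]_n) : R :=
  \sum_(i < n) u i 0 * v i 0.

(** exp (2 pi i <l, x>) *)
Definition expchar (R : realType) (n : nat) (l : 'cV[R]_n) (x : Rn R n) : R[i] :=
  Complex (cos (2 * pi * dotv l x)) (sin (2 * pi * dotv l x)).

Definition compactly_supported (R : realType) (n : nat)
    (mu : probability (Rn R n) R) : Prop :=
  exists K : set 'cV[R]_n, compact K /\ mu (~` K) = 0%E.

Definition spectral_measure (R : realType) (n : nat)
    (mu : probability (Rn R n) R) : Prop :=
  compactly_supported mu /\
  exists L : set 'cV[R]_n,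
    countable L /\ L2_orthonormal_basis mu L (@expchar R n).

Definition vec2 (x y : int) : 'cV[int]_2 := \col_i [:: x; y]`_i.

Definition mx2 (a b c d : int) : 'M[int]_2 :=
  \matrix_(i, j) (nth [::] [:: [:: a; b]; [:: c; d]] i)`_j.

Definition int_to_realmx (R : realType) (m n : nat) (A : 'M[int]_(m, n)) : 'M[R]_(m, n) :=
  map_mx intr A.

Definition int_to_realset (R : realType) (n : nat) (D : {fset 'cV[int]_n}) :
    {fset 'cV[R]_n} := [fset int_to_realmx R d | d in D]%fset.

Definition digits (a1 a2 b1 b2 : int) : {fset 'cV[int]_2} :=
  [fset vec2 0 0; vec2 a1 a2; vec2 b1 b2; vec2 (- a1 - b1) (- a2 - b2)]%fset.

Definition mxQ (p q t1 t2 : int) : 'M[int]_2 := mx2 p q (- t2) t1.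

(** Conjugation Q M Q^-1; the inverse is taken over int, where Q is a unit
    as soon as det Q = 1. *)
Definition tildeM (Q M : 'M[int]_2) : 'M[int]_2 := Q *m M *m invmx Q.

Definition tildeD (Q : 'M[int]_2) (D : {fset 'cV[int]_2}) : {fset 'cV[int]_2} :=
  [fset Q *m d | d in D]%fset.

Lemma mxQ_mul_vec2 (p q t1 t2 x y : int) :
  mxQ p q t1 t2 *m vec2 x y = vec2 (p * x + q * y) (t1 * y - t2 * x).
Proof.
apply/matrixP => i j; rewrite !mxE !big_ord_recl big_ord0 !mxE /= addr0.
by case: i => [[|[|//]] Hi] /=; rewrite ?mulNr // addrC.
Qed.

Lemma det_mxQ (p q t1 t2 : int) :
  p * t1 + q * t2 = 1 -> \det (mxQ p q t1 t2) = 1.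
Proof.
move=> h; rewrite (expand_det_row _ ord0) !big_ord_recl big_ord0 /cofactor.
rewrite !det_mx11 !mxE /= expr0 expr1 mul1r mulN1r opprK addr0.
exact: h.
Qed.

(** Explicit form of the transformed digits, with alpha = gcd(a1, a2). *)
Lemma tildeD_digits (a1 a2 b1 b2 alpha t1 t2 p q omega gamma beta : int)
    (eta : nat) :
  alpha != 0 -> a1 = alpha * t1 -> a2 = alpha * t2 -> p * t1 + q * t2 = 1 ->
  a1 * b2 - a2 * b1 = 2 ^+ eta * gamma ->
  omega = p * b1 + q * b2 -> gamma = beta * alpha ->
  tildeD (mxQ p q t1 t2) (digits a1 a2 b1 b2) =
  [fset vec2 0 0; vec2 alpha 0; vec2 omega (2 ^+ eta * beta);
        vec2 (- alpha - omega) (- (2 ^+ eta * beta))]%fset.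
Proof.
move=> alpha0 -> -> hpq hdet -> hgamma.
have ht : t1 * b2 - t2 * b1 = 2 ^+ eta * beta.
  by apply: (mulfI alpha0); rewrite mulrBr !mulrA hdet hgamma; ring.
have hp : p * (alpha * t1) + q * (alpha * t2) = alpha.
  by rewrite !(mulrCA _ alpha) -mulrDr hpq mulr1.
rewrite /tildeD /digits !imfsetU !imfset_fset1 /= !mxQ_mul_vec2 ht hp.
have -> : p * (- (alpha * t1) - b1) + q * (- (alpha * t2) - b2) =
    - alpha - (p * b1 + q * b2) by rewrite -{3}hp; ring.
have -> : t1 * (- (alpha * t2) - b2) - t2 * (- (alpha * t1) - b1) =
    - (2 ^+ eta * beta) by rewrite -ht; ring.
have -> : t1 * (alpha * t2) - t2 * (alpha * t1) = 0 by ring.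
by rewrite !mulr0 addr0.
Qed.

(* Main.v *)
Require Import Defs.
From HB Require Import structures.
From mathcomp Require Import all_boot all_order all_algebra finmap.
From mathcomp Require Import ring lra zify complex.
From mathcomp Require Import all_classical all_reals all_analysis measurable_realfun.

Set Implicit Arguments.
Unset Strict Implicit.
Unset Printing Implicit Defensive.
Import Order.TTheory GRing.Theory Num.Theory.
Import numFieldNormedType.Exports.

Local Open Scope classical_set_scope.
Local Open Scope ring_scope.

(** Write [power mu l] for the squared modulus of the Fourier transform of [mu]
    at [l].  The inner product of two exponentials depends on the difference of
    their frequencies only, and exponentials span a dense subspace of L^2.
    Hence a countable set of frequencies [L] is a spectrum if and only if
    [power mu] vanishes at the nonzero differences of [L] and the sum of
    [power mu (k - l)] over [l] in [L] is 1 for every [k]: these sums are the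
    squared norms of the projections of the exponentials [k].  This is
    [spectral_measureP].

    Self-affinity says that applying the transposed matrix to [l] multiplies
    [power mu l] by the squared modulus of a trigonometric polynomial, the mask.
    Multiply the second coordinate of frequencies by [2 ^ eta].  The digits then
    give the mask [cube_mask (al z1) (om z1 + be z2)] with [al] and [be] odd,
    and the transposed matrix becomes [z |-> (a z1 + c z2, b z1 + d z2)] with
    [a = ta], [b = 2 ^ eta tb], [c = tc / 2 ^ eta] and [d = td].  The function
    [cube_mask] is periodic under integer translations, its values at the four
    translates of a point by half-integers add up to 1, and its zeros are
    half-integral and not integral.  As [b] is an even integer, the claim is
    that a spectrum exists if and only if [a], [c] and [d] are even integers.
    The record [mask_system] lists the properties of [power mu] in these
    coordinates from which both implications follow.

    Sufficiency ([mask_system_parseval]).  With even entries the matrix sends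
    half-integral vectors to integral ones, which are periods of the mask and of
    its composites with powers of the matrix.  The function [power] cannot
    vanish on a whole coset of the group of all such periods: otherwise a
    backward orbit of zeros with bounded denominators becomes cyclic, its
    elements are periods themselves, and [power] vanishes at 0.  By compactness
    every coset contains a point at which [power] exceeds a fixed [eps].  The
    spectrum is grown as a tree: level [n + 1] adds to each frequency of level
    [n] the images under the power [n + 1] of the matrix of the four half-shifts,
    each one corrected by such a period.  At level [n] the products of the first
    [n] masks add up to 1, and the lower bound [eps] keeps mass from escaping
    when [n] tends to infinity.

    Necessity ([mask_system_necessary]).  Let [L] be a spectrum and let [Y] be
    its preimage under the matrix.  Split [Y] into cosets of the group of points
    at which the mask has half-integral arguments, and each coset into four
    classes modulo the lattice on which the arguments are integral.  At a
    generic point the identity for [L] makes 1 a convex combination, coset by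
    coset, of the masses of the four classes; choosing the heaviest class of
    each coset gives an orthogonal set and so a total of at most 1.  Hence the
    four classes of a coset have the same mass: every class is met
    ([class_realized]), and every choice of one class per coset is again a
    spectrum ([coparseval_selection]).  Always choosing the class of vectors
    with odd denominators, if there is one, produces a chain of spectra in which
    parity can be followed.  If some power of the matrix maps all doubled
    vectors of a class to vectors that have odd denominators and are nonzero
    modulo 2, the chain contradicts itself ([no_recurrent_residue]).  This
    applies when [c] is an integer but some entry is odd, and when [c] is not an
    integer and the determinant is odd, since then a suitable power of the
    matrix is [p A + q] with [2 ^ eta] dividing [p] and [q] odd.  When the
    determinant is even and [c] is not an integer, the form of the zeros of
    [power] gives the contradiction ([residue_difference]). *)

(** * Approximation in L^2 by linear combinations *)

Section SquaredModulus.
Variable R : realType.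
Implicit Types z w : R[i].

Definition sqmod z : R := complex.Re z ^+ 2 + complex.Im z ^+ 2.

Lemma sqmod_ge0 z : 0 <= sqmod z.
Proof. by rewrite addr_ge0 ?sqr_ge0. Qed.

Lemma sqmodM z w : sqmod (z * w) = sqmod z * sqmod w.
Proof. by case: z w => [a b] [c d]; rewrite /sqmod /=; ring. Qed.

Lemma sqmodD_le z w : sqmod (z + w) <= 2 * sqmod z + 2 * sqmod w.
Proof.
case: z w => [a b] [c d]; rewrite /sqmod /=.
have := sqr_ge0 (a - c); have := sqr_ge0 (b - d); nra.
Qed.

End SquaredModulus.

Section Approximation.
Context (R : realType) (d : measure_display) (T : measurableType d).
Variable mu : probability T R.
Implicit Types f g h : T -> R[i].

Notation N2 := (L2_sqnorm mu).

Definition cmeasurable f := measurable_fun setT (fun x => complex.Re (f x)) /\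
  measurable_fun setT (fun x => complex.Im (f x)).

Lemma cmeasurableD f g : cmeasurable f -> cmeasurable g ->
  cmeasurable (fun x => f x + g x).
Proof.
move=> [f1 f2] [g1 g2]; split.
  rewrite (_ : (fun _ => _) = (fun x => complex.Re (f x) + complex.Re (g x))).
    exact: measurable_funD.
  by apply/funext => x; case: (f x) (g x) => [? ?] [].
rewrite (_ : (fun _ => _) = (fun x => complex.Im (f x) + complex.Im (g x))).
  exact: measurable_funD.
by apply/funext => x; case: (f x) (g x) => [? ?] [].
Qed.

Lemma cmeasurableM f g : cmeasurable f -> cmeasurable g ->
  cmeasurable (fun x => f x * g x).
Proof.
move=> [f1 f2] [g1 g2]; split.
  rewrite (_ : (fun _ => _) = (fun x => complex.Re (f x) * complex.Re (g x) -
     complex.Im (f x) * complex.Im (g x))).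
    by apply: measurable_funB; apply: measurable_funM.
  by apply/funext => x; case: (f x) (g x) => [? ?] [].
rewrite (_ : (fun _ => _) = (fun x => complex.Re (f x) * complex.Im (g x) +
     complex.Im (f x) * complex.Re (g x))).
  by apply: measurable_funD; apply: measurable_funM.
by apply/funext => x; case: (f x) (g x) => [? ?] [].
Qed.

Lemma cmeasurable_cst (c : R[i]) : cmeasurable (fun=> c).
Proof. by split; exact: measurable_cst. Qed.

Lemma cmeasurable_real (g : T -> R) : measurable_fun setT g ->
  cmeasurable (fun x => (g x)%:C%C).
Proof. by move=> mg; split=> //=; exact: measurable_cst. Qed.

Lemma measurable_sqmod f : cmeasurable f ->
  measurable_fun setT (fun x => sqmod (f x)).
Proof.
by move=> [f1 f2]; apply: measurable_funD; apply: measurable_funX.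
Qed.

Lemma measurable_EFin_sqmod f : cmeasurable f ->
  measurable_fun setT (fun x => (sqmod (f x))%:E).
Proof. by move=> mf; apply/measurable_EFinP; exact: measurable_sqmod. Qed.

Lemma L2_sqnormE f : N2 f = (\int[mu]_x (sqmod (f x))%:E)%E.
Proof. by []. Qed.

Lemma L2_sqnorm_ge0 f : (0 <= N2 f)%E.
Proof. by apply: integral_ge0 => x _; rewrite lee_fin sqmod_ge0. Qed.

Lemma L2_sqnorm_le f g (k : R) : 0 <= k -> cmeasurable f -> cmeasurable g ->
  (forall x, sqmod (f x) <= k * sqmod (g x)) -> (N2 f <= k%:E * N2 g)%E.
Proof.
move=> k0 mf mg fg; rewrite !L2_sqnormE -ge0_integralZl_EFin//; last 2 first.
- by move=> x _; rewrite lee_fin sqmod_ge0.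
- by apply: measurable_EFin_sqmod.
apply: ge0_le_integral => //.
- by move=> x _; rewrite lee_fin sqmod_ge0.
- by apply: measurable_EFin_sqmod.
- by apply: measurable_funeM; exact: measurable_EFin_sqmod.
- by move=> x _; rewrite -EFinM lee_fin.
Qed.

Lemma L2_sqnormZ_le f (c : R[i]) : cmeasurable f ->
  (N2 (fun x => c * f x)%R <= (sqmod c)%:E * N2 f)%E.
Proof.
move=> mf; apply: L2_sqnorm_le => //; first exact: sqmod_ge0.
  by apply: cmeasurableM => //; exact: cmeasurable_cst.
by move=> x; rewrite sqmodM.
Qed.

Lemma L2_sqnormD_le f g : cmeasurable f -> cmeasurable g ->
  (N2 (fun x => f x + g x)%R <= 2%:E * N2 f + 2%:E * N2 g)%E.
Proof.
move=> mf mg; rewrite !L2_sqnormE -!ge0_integralZl_EFin//; last 4 first.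
- by move=> x _; rewrite lee_fin sqmod_ge0.
- by apply: measurable_EFin_sqmod.
- by move=> x _; rewrite lee_fin sqmod_ge0.
- by apply: measurable_EFin_sqmod.
rewrite -ge0_integralD//; last 4 first.
- by move=> x _; rewrite -EFinM lee_fin mulr_ge0 ?sqmod_ge0.
- by apply: measurable_funeM; exact: measurable_EFin_sqmod.
- by move=> x _; rewrite -EFinM lee_fin mulr_ge0 ?sqmod_ge0.
- by apply: measurable_funeM; exact: measurable_EFin_sqmod.
apply: ge0_le_integral => //.
- by move=> x _; rewrite lee_fin sqmod_ge0.
- by apply: measurable_EFin_sqmod; exact: cmeasurableD.
- by apply: emeasurable_funD; apply: measurable_funeM; exact: measurable_EFin_sqmod.
- by move=> x _; rewrite -!EFinM -EFinD lee_fin sqmodD_le.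
Qed.

Lemma L2_funP f : L2_fun mu f <-> cmeasurable f /\ (N2 f < +oo)%E.
Proof. by split=> [[]|[[]]]. Qed.

Lemma L2_fun_bounded f (C : R) : cmeasurable f ->
  (forall x, sqmod (f x) <= C) -> L2_fun mu f.
Proof.
move=> mf fC; apply/L2_funP; split => //.
apply: (@le_lt_trans _ _ (\int[mu]_x C%:E)%E).
  apply: ge0_le_integral => //.
  - by move=> x _; rewrite lee_fin sqmod_ge0.
  - exact: measurable_EFin_sqmod.
  - by move=> x _; rewrite lee_fin; exact: fC.
rewrite integral_cst//.
rewrite [X in (_ * X)%E](_ : _ = 1%E); last exact: probability_setT.
by rewrite mule1 ltry.
Qed.

Lemma L2_funD f g : L2_fun mu f -> L2_fun mu g -> L2_fun mu (fun x => f x + g x).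
Proof.
move=> /L2_funP[mf f2] /L2_funP[mg g2]; apply/L2_funP; split.
  exact: cmeasurableD.
apply: le_lt_trans (L2_sqnormD_le mf mg) _.
by rewrite lte_add_pinfty// lte_mul_pinfty ?lee_fin// fin_numE.
Qed.

Lemma L2_funZ (c : R[i]) f : L2_fun mu f -> L2_fun mu (fun x => c * f x).
Proof.
move=> /L2_funP[mf f2]; apply/L2_funP; split.
  by apply: cmeasurableM => //; exact: cmeasurable_cst.
apply: le_lt_trans (L2_sqnormZ_le c mf) _.
by rewrite lte_mul_pinfty ?lee_fin ?sqmod_ge0// fin_numE.
Qed.

Lemma L2_funB f g : L2_fun mu f -> L2_fun mu g -> L2_fun mu (fun x => f x - g x).
Proof.
move=> hf hg; rewrite (_ : (fun _ => _) = fun x => f x + (-1) * g x).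
  by apply: L2_funD => //; exact: L2_funZ.
by apply/funext => x; rewrite mulN1r.
Qed.

Lemma L2_sqnormD_lt f g (e : R) : cmeasurable f -> cmeasurable g ->
  (N2 f < (e / 4)%:E)%E -> (N2 g < (e / 4)%:E)%E ->
  (N2 (fun x => f x + g x)%R < e%:E)%E.
Proof.
move=> mf mg fe ge; apply: le_lt_trans (L2_sqnormD_le mf mg) _.
have -> : e%:E = (2%:E * (e / 4)%:E + 2%:E * (e / 4)%:E)%E.
  by rewrite -!EFinM -EFinD; congr EFin; lra.
by rewrite lteD// lte_pmul2l.
Qed.

Lemma L2_sqnorm_trans_lt f g h (e : R) :
  L2_fun mu f -> L2_fun mu g -> L2_fun mu h ->
  (N2 (fun x => f x - g x)%R < (e / 4)%:E)%E ->
  (N2 (fun x => g x - h x)%R < (e / 4)%:E)%E ->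
  (N2 (fun x => f x - h x)%R < e%:E)%E.
Proof.
move=> hf hg hh fg gh.
have /L2_funP[m1 _] := L2_funB hf hg; have /L2_funP[m2 _] := L2_funB hg hh.
have := L2_sqnormD_lt m1 m2 fg gh.
rewrite (_ : (fun x => f x - g x + (g x - h x)) = fun x => f x - h x) //.
by apply/funext => x; rewrite addrA subrK.
Qed.

Section System.
Variables (I : choiceType) (e : I -> T -> R[i]).
Hypothesis me : forall i, cmeasurable (e i).
Hypothesis e1 : forall i x, sqmod (e i x) = 1.

Definition lincomb (s : seq (R[i] * I)) x := \sum_(p <- s) p.1 * e p.2 x.

(** The square-integrable functions in the closed linear span of the [e l] with
    [l] in [L]. *)
Definition approximable (L : set I) f := L2_fun mu f /\
  forall eps : R, 0 < eps -> exists s : seq (R[i] * I),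
    (forall p, p \in s -> L p.2) /\
    (N2 (fun x => f x - lincomb s x)%R < eps%:E)%E.

Lemma L2_fun_e i : L2_fun mu (e i).
Proof. by apply: (@L2_fun_bounded _ 1) => // x; rewrite e1. Qed.

Lemma L2_fun_lincomb s : L2_fun mu (lincomb s).
Proof.
elim: s => [|p s ih].
  rewrite (_ : lincomb _ = fun=> 0).
    apply: (@L2_fun_bounded _ 0); first exact: cmeasurable_cst.
    by move=> x; rewrite /sqmod /= expr0n addr0.
  by apply/funext => x; rewrite /lincomb big_nil.
rewrite (_ : lincomb _ = fun x => p.1 * e p.2 x + lincomb s x).
  by apply: L2_funD => //; apply: L2_funZ; exact: L2_fun_e.
by apply/funext => x; rewrite /lincomb big_cons.
Qed.

Lemma L2_sqnorm0 : N2 (fun=> 0) = 0%E.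
Proof. by apply: integral0_eq => x _ /=; rewrite expr0n addr0. Qed.

Lemma approximable_lincomb L s : (forall p, p \in s -> L p.2) ->
  approximable L (lincomb s).
Proof.
move=> sL; split; first exact: L2_fun_lincomb.
move=> eps eps0; exists s; split=> //.
rewrite (_ : (fun _ => _) = fun=> 0); first by rewrite L2_sqnorm0 lte_fin.
by apply/funext => x; rewrite subrr.
Qed.

Lemma approximable_e (L : set I) i : L i -> approximable L (e i).
Proof.
move=> Li; rewrite (_ : e i = lincomb [:: (1, i)]).
  by apply: approximable_lincomb => p; rewrite inE => /eqP ->.
by apply/funext => x; rewrite /lincomb big_seq1 mul1r.
Qed.

Lemma approximable_lim L f : L2_fun mu f ->
  (forall eps : R, 0 < eps -> exists2 g, approximable L g &
     (N2 (fun x => f x - g x)%R < eps%:E)%E) -> approximable L f.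
Proof.
move=> f2 h; split=> // eps eps0.
have e4 : 0 < eps / 4 by lra.
have [g [g2 ga] fg] := h _ e4; have [s [sL gs]] := ga _ e4.
exists s; split=> //.
by apply: L2_sqnorm_trans_lt fg gs => //; exact: L2_fun_lincomb.
Qed.

Lemma lincomb_cat s t x : lincomb (s ++ t) x = lincomb s x + lincomb t x.
Proof. by rewrite /lincomb big_cat. Qed.

Lemma lincombZ (c : R[i]) s x :
  lincomb [seq (c * p.1, p.2) | p <- s] x = c * lincomb s x.
Proof.
by rewrite /lincomb big_map mulr_sumr; apply: eq_bigr => p _; rewrite mulrA.
Qed.

Lemma approximableD L f g : approximable L f -> approximable L g ->
  approximable L (fun x => f x + g x).
Proof.
move=> [f2 fa] [g2 ga]; split; first exact: L2_funD.
move=> eps eps0; have e4 : 0 < eps / 4 by lra.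
have [s [sL fs]] := fa _ e4; have [t [tL gt]] := ga _ e4.
exists (s ++ t); split=> [p|]; first by rewrite mem_cat => /orP[/sL|/tL].
have /L2_funP[m1 _] := L2_funB f2 (L2_fun_lincomb s).
have /L2_funP[m2 _] := L2_funB g2 (L2_fun_lincomb t).
have := L2_sqnormD_lt m1 m2 fs gt.
rewrite (_ : (fun x => f x - _ + _) = fun x => f x + g x - lincomb (s ++ t) x) //.
by apply/funext => x; rewrite lincomb_cat; ring.
Qed.

Lemma sqnorm_mul_lt f h (C eps : R) : 0 < eps -> 0 <= C -> cmeasurable f ->
  cmeasurable h -> (forall x, sqmod (h x) <= C) ->
  (N2 f < (eps / (C + 1))%:E)%E -> (N2 (fun x => h x * f x)%R < eps%:E)%E.
Proof.
move=> eps0 C0 mf mh hC fe.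
apply: (@le_lt_trans _ _ (C%:E * N2 f)%E).
  apply: L2_sqnorm_le => //; first exact: cmeasurableM.
  by move=> x; rewrite sqmodM ler_wpM2r ?sqmod_ge0.
have C1 : 0 < C + 1 by lra.
apply: (@le_lt_trans _ _ ((C + 1)%:E * N2 f)%E).
  by rewrite lee_wpmul2r ?L2_sqnorm_ge0// lee_fin; lra.
have -> : eps%:E = ((C + 1)%:E * (eps / (C + 1))%:E)%E.
  by rewrite -EFinM; congr EFin; field; lra.
by rewrite lte_pmul2l ?lte_fin.
Qed.

Lemma approximableZ L (c : R[i]) f : approximable L f ->
  approximable L (fun x => c * f x).
Proof.
move=> [f2 fa]; split; first exact: L2_funZ.
move=> eps eps0.
have c0 := sqmod_ge0 c; have c1 : 0 < eps / (sqmod c + 1).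
  by rewrite divr_gt0//; lra.
have [s [sL fs]] := fa _ c1.
exists [seq (c * p.1, p.2) | p <- s]; split=> [p /mapP[q qs ->] /=|].
  exact: sL.
have /L2_funP[m1 _] := L2_funB f2 (L2_fun_lincomb s).
rewrite (_ : (fun _ => _) = fun x => (fun=> c) x * (f x - lincomb s x)).
  by apply: (@sqnorm_mul_lt _ _ (sqmod c)) => //; exact: cmeasurable_cst.
by apply/funext => x; rewrite lincombZ mulrBr.
Qed.

(** Completeness of the subfamily [L] only has to be tested on the functions
    [e i]. *)
Lemma approximable_trans L f : (forall i, approximable L (e i)) ->
  approximable setT f -> approximable L f.
Proof.
move=> eL [f2 fa]; apply: approximable_lim => // eps eps0.
have [s [_ fs]] := fa _ eps0; exists (lincomb s) => //.
elim: s {fs} => [|p s ih]; first exact: approximable_lincomb.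
rewrite (_ : lincomb _ = fun x => p.1 * e p.2 x + lincomb s x).
  by apply: approximableD => //; exact: approximableZ.
by apply/funext => x; rewrite /lincomb big_cons.
Qed.

(** Multiplication by [f] is bounded, so it only has to be tested on the family
    that approximates [g]. *)
Lemma approximable_mul_bounded f g (C : R) : cmeasurable f ->
  (forall x, sqmod (f x) <= C) ->
  (forall i, approximable setT (fun x => e i x * f x)) ->
  approximable setT g -> approximable setT (fun x => f x * g x).
Proof.
move=> mf fC fe [g2 ga].
have C0 : 0 <= C by apply: le_trans (fC point); exact: sqmod_ge0.
have /L2_funP[mg g2'] := g2.
apply: approximable_lim.
  apply/L2_funP; split; first exact: cmeasurableM.
  apply: (@le_lt_trans _ _ (C%:E * N2 g)%E).
    apply: L2_sqnorm_le => //; first exact: cmeasurableM.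
    by move=> x; rewrite sqmodM ler_wpM2r ?sqmod_ge0.
  by rewrite lte_mul_pinfty.
move=> eps eps0; have C1 : 0 < eps / (C + 1) by rewrite divr_gt0//; lra.
have [s [_ gs]] := ga _ C1.
exists (fun x => f x * lincomb s x).
  elim: s {gs} => [|p s ih].
    rewrite (_ : (fun _ => _) = lincomb [::]); first exact: approximable_lincomb.
    by apply/funext => x; rewrite /lincomb big_nil mulr0.
  rewrite (_ : (fun _ => _) = fun x => p.1 * (e p.2 x * f x) + f x * lincomb s x).
    by apply: approximableD => //; exact: approximableZ.
  by apply/funext => x; rewrite /lincomb big_cons; ring.
have /L2_funP[m1 _] := L2_funB g2 (L2_fun_lincomb s).
rewrite (_ : (fun _ => _) = fun x => f x * (g x - lincomb s x)).
  exact: (@sqnorm_mul_lt _ _ C).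
by apply/funext => x; rewrite mulrBr.
Qed.

Hypothesis eM : forall i j, exists k, forall x, e i x * e j x = e k x.

(** The bounded functions of the closed span form an algebra, because the family
    [e] is closed under products. *)
Lemma approximableM f g (C : R) : (forall x, sqmod (f x) <= C) ->
  approximable setT f -> approximable setT g ->
  approximable setT (fun x => f x * g x).
Proof.
move=> fC fa; have /L2_funP[mf _] := fa.1.
apply: (approximable_mul_bounded mf fC) => i.
apply: (@approximable_mul_bounded (e i) f 1) => // [x|j]; first by rewrite e1.
have [k ek] := eM j i; rewrite (funext ek); exact: approximable_e.
Qed.

End System.

End Approximation.

(** * Totality of a multiplicative family of functions *)

Import HBSimple HBNNSimple.

Section Totality.
Context (R : realType) (d : measure_display) (T : measurableType d).
Variable mu : probability T R.
Variables (I : choiceType) (e : I -> T -> R[i]).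
Hypothesis me : forall i, cmeasurable (e i).
Hypothesis e1 : forall i x, sqmod (e i x) = 1.
Hypothesis eM : forall i j, exists k, forall x, e i x * e j x = e k x.
Hypothesis e0 : exists i, forall x, e i x = 1.

Notation N2 := (L2_sqnorm mu).
Notation total := (approximable mu e setT).

(** Bounded real functions of the closed span.  They form an algebra that is
    closed under bounded pointwise limits, so that the sets whose indicator
    function is tame form a sigma-algebra. *)
Definition tame (g : T -> R) := [/\ measurable_fun setT g,
  exists C, forall x, `|g x| <= C & total (fun x => (g x)%:C%C)].

Lemma tame_cst c : tame (fun=> c).
Proof.
split; [exact: measurable_cst | by exists `|c| |].
have [i ei] := e0.
rewrite (_ : (fun _ => _) = fun x => c%:C%C * e i x).
  by apply: approximableZ => //; exact: approximable_e.
by apply/funext => x; rewrite ei mulr1.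
Qed.

Lemma tameD g h : tame g -> tame h -> tame (fun x => g x + h x).
Proof.
move=> [mg [C gC] ag] [mh [D hD] ah]; split.
- exact: measurable_funD.
- by exists (C + D) => x; apply: le_trans (ler_normD _ _) _; rewrite lerD.
- rewrite (_ : (fun _ => _) = fun x => (g x)%:C%C + (h x)%:C%C).
    exact: approximableD.
  by apply/funext => x; rewrite rmorphD.
Qed.

Lemma tameM g h : tame g -> tame h -> tame (fun x => g x * h x).
Proof.
move=> [mg [C gC] ag] [mh [D hD] ah]; split.
- exact: measurable_funM.
- by exists (C * D) => x; rewrite normrM ler_pM.
- rewrite (_ : (fun _ => _) = fun x => (g x)%:C%C * (h x)%:C%C).
    apply: (@approximableM _ _ _ _ _ _ _ _ _ _ _ (C ^+ 2)) => // x.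
    rewrite /sqmod /= expr0n addr0 -real_normK ?num_real//.
    by rewrite lerXn2r// nnegrE // (le_trans _ (gC x)).
  by apply/funext => x; rewrite rmorphM.
Qed.

Lemma tameZ c g : tame g -> tame (fun x => c * g x).
Proof. by apply: tameM; exact: tame_cst. Qed.

(** The dominating function is a constant for bounded sequences and [h ^+ 2] for
    the approximations of [h] by simple functions from below. *)
Lemma L2_dominated_cvg (g_ : nat -> T -> R) (h D : T -> R) :
  (forall n, measurable_fun setT (g_ n)) -> measurable_fun setT h ->
  mu.-integrable setT (EFin \o D) ->
  (forall n x, (h x - g_ n x) ^+ 2 <= D x) ->
  (forall x, g_ ^~ x @ \oo --> h x) ->
  forall eps : R, 0 < eps ->
  exists n, (N2 (fun x => (h x)%:C%C - (g_ n x)%:C%C)%R < eps%:E)%E.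
Proof.
move=> mg mh iD hD gh eps eps0.
have h0 x : (fun n => ((h x - g_ n x) ^+ 2)%:E) @ \oo --> 0%E.
  apply: cvg_EFin; first by apply: nearW.
  rewrite (_ : 0 = (h x - h x) ^+ 2); last by rewrite subrr expr0n.
  by apply: (@cvg_comp _ _ _ (fun n => h x - g_ n x) (fun y => y ^+ 2));
    [apply: cvgB => //; exact: cvg_cst | exact: exprn_continuous].
have [] := @dominated_convergence _ _ _ mu setT measurableT
  (fun n x => ((h x - g_ n x) ^+ 2)%:E) (fun=> 0%E) (EFin \o D).
- move=> n; apply/measurable_EFinP; apply: measurable_funX.
  exact: measurable_funB.
- exact: measurable_cst.
- by apply: aeW => x _; exact: h0.
- exact: iD.
- by apply: aeW => x n _ /=; rewrite lee_fin ger0_norm ?sqr_ge0.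
move=> _ _; rewrite integral0_eq// => /fine_cvgP[fin /cvgr_lt lt].
have lt' : \forall n \near \oo,
    fine (\int[mu]_x ((h x - g_ n x) ^+ 2)%:E)%E < eps by exact: (lt eps eps0).
near \oo => n; exists n.
rewrite (_ : N2 _ = \int[mu]_x ((h x - g_ n x) ^+ 2)%:E)%E; last first.
  by apply: eq_integral => x _; rewrite /= oppr0 addr0 expr0n addr0.
have fn : (\int[mu]_x ((h x - g_ n x) ^+ 2)%:E)%E \is a fin_num by near: n.
by rewrite -(fineK fn) lte_fin; near: n.
Unshelve. all: by end_near. Qed.

Lemma tame_lim (g_ : nat -> T -> R) h (C : R) : (forall n, tame (g_ n)) ->
  (forall n x, `|g_ n x| <= C) -> (forall x, g_ ^~ x @ \oo --> h x) -> tame h.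
Proof.
move=> tg gC gh.
have hC x : `|h x| <= C.
  by apply: (@cvgr_to_le _ _ _ _ (fun n => `|g_ n x|) _ _ (cvg_norm (gh x))); exact: nearW.
have mh : measurable_fun setT h.
  by apply: (@measurable_fun_cvg _ _ _ _ g_) => // n; have [] := tg n.
split=> //; first by exists C.
apply: approximable_lim => //.
  apply: (@L2_fun_bounded _ _ _ _ _ (C ^+ 2)); first exact: cmeasurable_real.
  move=> x; rewrite /sqmod /= expr0n addr0 -real_normK ?num_real//.
  by rewrite lerXn2r// nnegrE // (le_trans _ (hC x)).
have iD : mu.-integrable setT (EFin \o (fun=> (C + C) ^+ 2)).
  exact: finite_measure_integrable_cst.
have mg n : measurable_fun setT (g_ n) by have [] := tg n.
have gD n x : (h x - g_ n x) ^+ 2 <= (C + C) ^+ 2.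
  have C0 : 0 <= C by apply: le_trans (hC x).
  rewrite -real_normK ?num_real// lerXn2r// ?nnegrE ?addr_ge0//.
  by apply: le_trans (ler_normB _ _) _; rewrite lerD.
move=> eps eps0; have [n hn] := L2_dominated_cvg mg mh iD gD gh eps0.
by exists (fun x => (g_ n x)%:C%C) => //; have [] := tg n.
Qed.

Lemma tame_indic_setC A : tame (\1_A : T -> R) -> tame (\1_(~` A) : T -> R).
Proof.
move=> tA; rewrite (_ : \1_(~` A) = (fun x => 1 + (-1) * \1_A x) :> (T -> R)).
  by apply: tameD; [exact: tame_cst | exact: tameZ].
by apply/funext => x; rewrite !indicE in_setC; case: (x \in A) => /=; ring.
Qed.

Lemma tame_indic_setI A B : tame (\1_A : T -> R) -> tame (\1_B : T -> R) ->
  tame (\1_(A `&` B) : T -> R).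
Proof. by move=> tA tB; rewrite indicI; exact: tameM. Qed.

Lemma tame_indic_setU A B : tame (\1_A : T -> R) -> tame (\1_B : T -> R) ->
  tame (\1_(A `|` B) : T -> R).
Proof.
move=> tA tB; rewrite -[A `|` B]setCK setCU; apply: tame_indic_setC.
by apply: tame_indic_setI; exact: tame_indic_setC.
Qed.

Lemma tame_indic_bigcup (A : (set T)^nat) :
  (forall n, tame (\1_(A n) : T -> R)) -> tame (\1_(\bigcup_n A n) : T -> R).
Proof.
move=> tA; pose B n := \big[setU/set0]_(i < n) A i.
apply: (@tame_lim (fun n => \1_(B n)) _ 1).
- elim=> [|n ih]; first by rewrite /B big_ord0 indic0; exact: tame_cst.
  by rewrite /B big_ord_recr; exact: tame_indic_setU.
- by move=> n x; rewrite indicE; case: (_ \in _); rewrite ?normr1 ?normr0.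
- move=> x; have [[n _ Anx]|Ax] := pselect ((\bigcup_n A n) x).
    rewrite indicE mem_set; last by exists n.
    apply: cvg_near_cst; exists n.+1 => // m /= nm.
    rewrite indicE mem_set// /B -bigcup_mkord; exists n => //.
  rewrite indicE memNset//; apply: cvg_near_cst; apply: nearW => m.
  by rewrite indicE memNset// /B -bigcup_mkord => -[k _ ?]; apply: Ax; exists k.
Qed.

Lemma tame_indic (G : set (set T)) : @measurable _ T = <<s G >> ->
  (forall A, G A -> tame (\1_A : T -> R)) ->
  forall A, measurable A -> tame (\1_A : T -> R).
Proof.
move=> mG tG A; rewrite mG; pose S := [set B : set T | tame (\1_B : T -> R)].
apply: (@smallest_sub _ _ G S) => //; split.
- by rewrite /S /= indic0; exact: tame_cst.
- by move=> B; rewrite setTD; exact: tame_indic_setC.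
- by move=> B tB; exact: tame_indic_bigcup.
Qed.

Lemma tame_sum (J : eqType) (s : seq J) (F : J -> T -> R) :
  (forall j, tame (F j)) -> tame (fun x => \sum_(j <- s) F j x).
Proof.
move=> tF; elim: s => [|j s ih].
  rewrite (_ : (fun _ => _) = fun=> 0); first exact: tame_cst.
  by apply/funext => x; rewrite big_nil.
rewrite (_ : (fun _ => _) = fun x => F j x + \sum_(j <- s) F j x).
  exact: tameD.
by apply/funext => x; rewrite big_cons.
Qed.

Section Conclusion.
Hypothesis tameS : forall A, measurable A -> tame (\1_A : T -> R).

Lemma tame_nnsfun (g : {nnsfun T >-> R}) : tame (fun x => g x).
Proof.
suff -> : (fun x => g x) = (fun x => \sum_(r <- fset_set (range g))
    (r * \1_(g @^-1` [set r]) x)).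
  by apply: tame_sum => r; apply: tameZ; exact: tameS.
by apply/funext => x; rewrite {1}(fimfunE g) fsbig_finite.
Qed.

(** Simple functions are tame and increase to [g]. *)
Lemma approximable_ge0 (g : T -> R) : measurable_fun setT g ->
  (forall x, 0 <= g x) -> mu.-integrable setT (EFin \o (fun x => g x ^+ 2)) ->
  total (fun x => (g x)%:C%C).
Proof.
move=> mg g0 ig.
have mg' : measurable_fun setT (EFin \o g) by exact/measurable_EFinP.
pose h := nnsfun_approx measurableT mg'.
have hg x : (fun n => h n x) @ \oo --> g x.
  have g0' y : setT y -> (0 <= (EFin \o g) y)%E by rewrite /= lee_fin.
  have H : (fun n => (h n x)%:E) @ \oo --> (g x)%:E.
    by apply: (cvg_nnsfun_approx measurableT mg' g0').
  by have [_] := (fine_cvgP (fun n => (h n x)%:E) (g x)).1 H.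
have hle n x : h n x <= g x.
  have nd : {homo (fun n => h n x) : m n / (m <= n)%N >-> m <= n}.
    by move=> m k mk; exact/lefP/nd_nnsfun_approx.
  by rewrite -(cvg_lim _ (hg x))//; apply: nondecreasing_cvgn_le => //; exact: cvgP (hg x).
have gD n x : (g x - h n x) ^+ 2 <= g x ^+ 2.
  rewrite lerXn2r// ?nnegrE ?subr_ge0//.
  by rewrite gerBl.
have mh n : measurable_fun setT (h n) by [].
apply: approximable_lim => //.
  apply/L2_funP; split; first exact: cmeasurable_real.
  move/integrableP : ig => [_]; apply: le_lt_trans.
  apply: ge0_le_integral => //=.
  - by move=> x _; rewrite lee_fin addr_ge0 ?sqr_ge0.
  - exact: (measurable_EFin_sqmod (cmeasurable_real mg)).
  - apply/measurable_EFinP; apply: measurableT_comp => //.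
    exact: measurable_funX.
  - by move=> x _; rewrite lee_fin expr0n addr0 ler_norm.
move=> eps eps0; have [n hn] := L2_dominated_cvg mh mg ig gD hg eps0.
by exists (fun x => (h n x)%:C%C) => //; have [] := tame_nnsfun (h n).
Qed.

Lemma approximable_real (g : T -> R) : measurable_fun setT g ->
  mu.-integrable setT (EFin \o (fun x => g x ^+ 2)) ->
  total (fun x => (g x)%:C%C).
Proof.
move=> mg ig.
have pos (f : T -> R) : measurable_fun setT f ->
   mu.-integrable setT (EFin \o (fun x => f x ^+ 2)) ->
   total (fun x => (Num.max (f x) 0)%:C%C).
  move=> mf fi; apply: approximable_ge0.
  - by apply: measurable_maxr => //; exact: measurable_cst.
  - by move=> x; rewrite le_max lexx orbT.
  - apply: (@le_integrable _ _ _ _ _ _ _ (EFin \o (fun x => f x ^+ 2))) => //.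
      apply/measurable_EFinP; apply: measurable_funX.
      by apply: measurable_maxr => //; exact: measurable_cst.
    move=> x _ /=; rewrite lee_fin !ger0_norm ?sqr_ge0//.
    by case: (leP (f x) 0) => //; rewrite expr0n sqr_ge0.
rewrite (_ : (fun _ => _) = fun x => (Num.max (g x) 0)%:C%C +
    (-1) * (Num.max (- g x) 0)%:C%C).
  apply: approximableD => //; first exact: pos.
  apply: approximableZ => //; apply: (pos (fun x => - g x)).
    exact: measurable_funN.
  by under eq_fun do rewrite sqrrN.
apply/funext => x; rewrite mulN1r -rmorphB /=; congr (_%:C)%C.
by case: (leP (g x) 0) => ?; case: (leP (- g x) 0) => ?; lra.
Qed.

Lemma approximable_L2_fun f : L2_fun mu f -> total f.
Proof.
move=> /L2_funP[[mr mi] f2].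
have part (g : T -> R) : measurable_fun setT g ->
    (forall x, g x ^+ 2 <= sqmod (f x)) ->
    mu.-integrable setT (EFin \o (fun x => g x ^+ 2)).
  move=> mg gf; apply/integrableP; split.
    by apply/measurable_EFinP; exact: measurable_funX.
  apply: le_lt_trans f2; apply: ge0_le_integral => //=.
  - apply/measurable_EFinP; apply: measurableT_comp => //.
    exact: measurable_funX.
  - exact: measurable_EFin_sqmod.
  - by move=> x _; rewrite lee_fin ger0_norm ?sqr_ge0//; exact: gf.
rewrite (_ : f = fun x => (complex.Re (f x))%:C%C + 'i%C * (complex.Im (f x))%:C%C).
  apply: approximableD => //; last apply: approximableZ => //.
    apply: approximable_real => //; apply: part => // x.
    by rewrite /sqmod lerDl sqr_ge0.
  apply: approximable_real => //; apply: part => // x.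
  by rewrite /sqmod lerDr sqr_ge0.
by apply/funext => x; case: (f x) => a b /=; apply/eqP; rewrite eq_complex /=;
  apply/andP; split; apply/eqP; ring.
Qed.

End Conclusion.

End Totality.

(** * Totality of exponentials for Borel probability measures *)

Section SmoothStep.
Variable R : realType.
Implicit Types u v : R.

(** The polynomial [3 u^2 - 2 u^3] fixes 0, 1/2 and 1, and its iterates push the
    other points of the unit interval to 0 or 1.  Applied to a tame function it
    produces indicator functions with products and limits only. *)
Definition smoothstep u : R := 3 * u ^+ 2 - 2 * u ^+ 3.

Lemma smoothstep_itv u : 0 <= u <= 1 -> 0 <= smoothstep u <= 1.
Proof.
move=> /andP[u0 u1]; rewrite /smoothstep.
have -> : 3 * u ^+ 2 - 2 * u ^+ 3 = u ^+ 2 * (3 - 2 * u) by ring.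
apply/andP; split; first by rewrite mulr_ge0 ?sqr_ge0//; lra.
rewrite -subr_ge0 (_ : _ - _ = (1 - u) ^+ 2 * (1 + 2 * u)); last by ring.
by rewrite mulr_ge0 ?sqr_ge0//; lra.
Qed.

Lemma smoothstepC u : smoothstep (1 - u) = 1 - smoothstep u.
Proof. by rewrite /smoothstep; ring. Qed.

Lemma iter_smoothstep_itv k u : 0 <= u <= 1 -> 0 <= iter k smoothstep u <= 1.
Proof. by elim: k => [//|k ih] /ih; exact: smoothstep_itv. Qed.

Lemma iter_smoothstepC k u :
  iter k smoothstep (1 - u) = 1 - iter k smoothstep u.
Proof. by elim: k => [//|k /= ->]; rewrite smoothstepC. Qed.

Lemma iter_smoothstep_half k : iter k smoothstep 2^-1 = 2^-1.
Proof. by elim: k => [//|k /= ->]; rewrite /smoothstep; field. Qed.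

Lemma iter_smoothstep_cvg1 u : 2^-1 < u <= 1 ->
  (fun k => iter k smoothstep u) @ \oo --> (1 : R).
Proof.
move=> /andP[u2 u1]; pose rho := (1 - u) * (1 + 2 * u).
have rho0 : 0 <= rho by rewrite mulr_ge0//; lra.
have rho1 : rho < 1 by rewrite /rho; nra.
have est k : [/\ u <= iter k smoothstep u, iter k smoothstep u <= 1 &
    1 - iter k smoothstep u <= rho ^+ k].
  elim: k => [|k [h1 h2 h3]]; first by rewrite expr0 /=; split; lra.
  rewrite /= -/(smoothstep _); move: h1 h2 h3.
  set v := iter k smoothstep u => h1 h2 h3.
  have /andP[_ s1] : 0 <= smoothstep v <= 1 by apply: smoothstep_itv; lra.
  split=> //.
    apply: (le_trans h1); rewrite -subr_ge0.
    have -> : smoothstep v - v = v * (1 - v) * (2 * v - 1).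
      by rewrite /smoothstep; ring.
    by rewrite !mulr_ge0//; lra.
  have -> : 1 - smoothstep v = (1 - v) * ((1 - v) * (1 + 2 * v)).
    by rewrite /smoothstep; ring.
  rewrite exprSr ler_pM//; [lra | by rewrite mulr_ge0//; lra |].
  rewrite /rho -subr_ge0.
  have -> : (1 - u) * (1 + 2 * u) - (1 - v) * (1 + 2 * v) =
    (v - u) * (2 * (u + v) - 1) by ring.
  by rewrite mulr_ge0//; lra.
rewrite -[X in _ --> X]subr0.
rewrite (_ : (fun k => _) = fun k => 1 - (1 - iter k smoothstep u)); last first.
  by apply/funext => k; rewrite subKr.
apply: cvgB; first exact: cvg_cst.
apply: (@squeeze_cvgr _ _ _ _ (fun=> 0) (fun k => rho ^+ k)).
- by apply: nearW => k; have [_ h1 h2] := est k; rewrite h2 subr_ge0 h1.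
- exact: cvg_cst.
- by apply: cvg_expr; rewrite ger0_norm.
Qed.

Lemma iter_smoothstep_cvg0 u : 0 <= u < 2^-1 ->
  (fun k => iter k smoothstep u) @ \oo --> (0 : R).
Proof.
move=> /andP[u0 u2].
rewrite (_ : (fun k => _) = fun k => 1 - iter k smoothstep (1 - u)); last first.
  by apply/funext => k; rewrite iter_smoothstepC subKr.
rewrite -[X in _ --> X](subrr 1); apply: cvgB; first exact: cvg_cst.
by apply: iter_smoothstep_cvg1; lra.
Qed.

End SmoothStep.

Section ExponentialsAreTotal.
Variables (R : realType) (n : nat) (mu : probability (Rn R n) R).
Implicit Types l x : 'cV[R]_n.

Lemma dotvDl l l' x : dotv (l + l') x = dotv l x + dotv l' x.
Proof. by rewrite -big_split; apply: eq_bigr => i _; rewrite mxE mulrDl. Qed.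

Lemma dotvZl c l x : dotv (c *: l) x = c * dotv l x.
Proof. by rewrite mulr_sumr; apply: eq_bigr => i _; rewrite mxE mulrA. Qed.

Lemma dotvNl l x : dotv (- l) x = - dotv l x.
Proof. by rewrite -scaleN1r dotvZl mulN1r. Qed.

Lemma dotv0l x : dotv 0 x = 0.
Proof. by rewrite -(scale0r 0) dotvZl mul0r. Qed.

Lemma dotv_delta i x : dotv (delta_mx i 0) x = x i 0.
Proof.
rewrite /dotv (bigD1 i)//= mxE !eqxx mul1r big1 ?addr0// => j ji.
by rewrite mxE (negbTE ji) mul0r.
Qed.

Lemma continuous_measurable_Rn (f : 'cV[R]_n -> R) :
  continuous f -> measurable_fun setT (f : Rn R n -> R).
Proof.
move=> /continuousP cf; apply: (measurability _ (RGenOpens.measurableE R)).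
move=> _ [_ [a [b ->] <-]]; rewrite setTI; apply: sub_sigma_algebra.
exact/cf/interval_open.
Qed.

Lemma continuous_dotv l : continuous (dotv l).
Proof.
move=> x; have FF : Filter (nbhs x) by exact: nbhs_filter.
apply: (@cvg_big R _ _ _ _ _ _ (nbhs x)) => [|i _]; first exact: add_continuous.
apply: cvgM; [exact: cvg_cst | exact: coord_continuous].
Qed.

Lemma measurable_dotv l : measurable_fun setT (dotv l : Rn R n -> R).
Proof. by apply: continuous_measurable_Rn; exact: continuous_dotv. Qed.

Lemma measurable_cos_dotv l :
  measurable_fun setT (fun x : Rn R n => cos (2 * pi * dotv l x)).
Proof.
have mf : measurable_fun setT (@cos R).
  by apply: continuous_measurable_fun; exact: continuous_cos.
apply: (measurableT_comp mf).
by apply: measurable_funM => //; exact: measurable_dotv.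
Qed.

Lemma measurable_sin_dotv l :
  measurable_fun setT (fun x : Rn R n => sin (2 * pi * dotv l x)).
Proof.
have mf : measurable_fun setT (@sin R).
  by apply: continuous_measurable_fun; exact: continuous_sin.
apply: (measurableT_comp mf).
by apply: measurable_funM => //; exact: measurable_dotv.
Qed.

Lemma cmeasurable_expchar l : cmeasurable (@expchar R n l).
Proof. by split; [exact: measurable_cos_dotv | exact: measurable_sin_dotv]. Qed.

Lemma sqmod_expchar l (x : Rn R n) : sqmod (expchar l x) = 1.
Proof. exact: cos2Dsin2. Qed.

Lemma expcharD l l' (x : Rn R n) :
  expchar l x * expchar l' x = expchar (l + l') x.
Proof.
rewrite /expchar.
have -> : 2 * pi * dotv (l + l') x = 2 * pi * dotv l x + 2 * pi * dotv l' x.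
  by rewrite dotvDl mulrDr.
rewrite cosD sinD; apply/eqP; rewrite eq_complex /=.
by apply/andP; split; apply/eqP; ring.
Qed.

Lemma expchar0 (x : Rn R n) : expchar 0 x = 1.
Proof. by rewrite /expchar dotv0l mulr0 cos0 sin0. Qed.

Let eM l l' : exists k, forall x : Rn R n, expchar l x * expchar l' x = expchar k x.
Proof. by exists (l + l') => x; rewrite expcharD. Qed.
Let e0 : exists l, forall x : Rn R n, expchar l x = 1.
Proof. by exists 0 => x; rewrite expchar0. Qed.

Notation tame := (tame mu (@expchar R n)).
Let tD := tameD (mu:=mu) cmeasurable_expchar sqmod_expchar.
Let tM := tameM (mu:=mu) cmeasurable_expchar sqmod_expchar eM.
Let tC := tame_cst mu cmeasurable_expchar sqmod_expchar e0.
Let tZ := tameZ (mu:=mu) cmeasurable_expchar sqmod_expchar eM e0.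
Let tlim := tame_lim (mu:=mu) cmeasurable_expchar sqmod_expchar.

(** Cosine and sine, by Euler's formulas. *)
Lemma tame_expchar_pair (f : Rn R n -> R) (u v : R[i]) l :
  measurable_fun setT f -> (forall x, `|f x| <= 1) ->
  (forall x, (f x)%:C%C = u * expchar l x + v * expchar (- l) x) -> tame f.
Proof.
move=> mf f1 fE; split=> //; [by exists 1 | rewrite (funext fE)].
have mc := cmeasurable_expchar; have c1 := sqmod_expchar.
by apply: approximableD => //; apply: approximableZ => //; exact: approximable_e.
Qed.

Lemma tame_cos l : tame (fun x => cos (2 * pi * dotv l x)).
Proof.
apply: (@tame_expchar_pair _ (2^-1)%:C%C (2^-1)%:C%C l) => [|x|x].
- exact: measurable_cos_dotv.
- by rewrite ler_norml cos_geN1 cos_le1.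
rewrite /expchar dotvNl mulrN cosN sinN.
by apply/eqP; rewrite eq_complex /=; apply/andP; split; apply/eqP; field.
Qed.

Lemma tame_sin l : tame (fun x => sin (2 * pi * dotv l x)).
Proof.
apply: (@tame_expchar_pair _ (Complex 0 (- 2^-1)) (Complex 0 2^-1) l) => [|x|x].
- exact: measurable_sin_dotv.
- by rewrite ler_norml sin_geN1 sin_le1.
rewrite /expchar dotvNl mulrN cosN sinN.
by apply/eqP; rewrite eq_complex /=; apply/andP; split; apply/eqP; field.
Qed.

Lemma tame_iter_smoothstep k (t : Rn R n -> R) : tame t ->
  tame (fun x => iter k (@smoothstep R) (t x)).
Proof.
move=> tt; elim: k => [//|k ih].
rewrite (_ : (fun _ => _) = fun x => 3 * (iter k (@smoothstep R) (t x) *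
   iter k (@smoothstep R) (t x)) + (-2) * (iter k (@smoothstep R) (t x) *
   (iter k (@smoothstep R) (t x) * iter k (@smoothstep R) (t x)))).
  by apply: tD; apply: tZ; apply: tM => //; exact: tM.
by apply/funext => x /=; rewrite /smoothstep; ring.
Qed.

(** The iterates of [smoothstep] on [t] converge to the function [L] with values
    0, 1/2 and 1, and [2 L^2 - L] erases the value 1/2 of the boundary. *)
Lemma tame_superlevel (t : Rn R n -> R) : tame t ->
  (forall x, 0 <= t x <= 1) -> tame (\1_[set x | 2^-1 < t x] : Rn R n -> R).
Proof.
move=> tt t01.
pose L x : R := if 2^-1 < t x then 1 else if t x < 2^-1 then 0 else 2^-1.
have tL : tame L.
  apply: (@tlim (fun k x => iter k (@smoothstep R) (t x)) _ 1).
  - by move=> k; exact: tame_iter_smoothstep.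
  - move=> k x; have /andP[? ?] := iter_smoothstep_itv k (t01 x).
    by rewrite ger0_norm.
  - move=> x; have /andP[t0 t1] := t01 x; rewrite /L.
    case: ltP => [h|h]; first by apply: iter_smoothstep_cvg1; rewrite h.
    case: ltP => [h'|h']; first by apply: iter_smoothstep_cvg0; rewrite t0.
    have -> : t x = 2^-1 by apply/eqP; rewrite eq_le h.
    by rewrite (eq_fun (@iter_smoothstep_half R)); exact: cvg_cst.
rewrite (_ : \1__ = (fun x => 2 * (L x * L x) + (-1) * L x) :> (_ -> R)).
  by apply: tD; apply: tZ => //; exact: tM.
apply/funext => x; rewrite indicE /L; case: ltP => h.
  by rewrite mem_set //=; ring.
rewrite memNset /=; last by apply/negP; rewrite -leNgt.
by case: ltP => _; field.
Qed.

(** Once [k] is large, the phase [(dotv l x + a) / k.+1] lies between [- pi] and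
    [pi], where the sine has the sign of its argument. *)
Lemma tame_halfspace l (a : R) :
  tame (\1_[set x | 0 < dotv l x + a] : Rn R n -> R).
Proof.
pose u k (x : Rn R n) : R := (dotv l x + a) / k.+1%:R.
pose t k x := 2^-1 + 2^-1 * sin (u k x).
have usplit k x : sin (u k x) =
    cos (a / k.+1%:R) * sin (2 * pi * dotv ((k.+1%:R^-1 / (2 * pi)) *: l) x) +
    sin (a / k.+1%:R) * cos (2 * pi * dotv ((k.+1%:R^-1 / (2 * pi)) *: l) x).
  have -> : 2 * pi * dotv ((k.+1%:R^-1 / (2 * pi)) *: l) x = dotv l x / k.+1%:R.
    have : k.+1%:R != 0 :> R by rewrite pnatr_eq0.
    have p0 : pi != 0 :> R by rewrite gt_eqF ?pi_gt0.
    rewrite dotvZl; move: (k.+1%:R) (@pi R) p0 => c w w0 c0; field.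
    by rewrite c0 w0.
  by rewrite /u mulrDl sinD; ring.
have tt k : tame (t k).
  apply: tD; first exact: tC; apply: tZ.
  rewrite (funext (usplit k)).
  by apply: tD; apply: tZ; [exact: tame_sin | exact: tame_cos].
have t01 k x : 0 <= t k x <= 1.
  have := sin_geN1 (u k x); have := sin_le1 (u k x); rewrite /t => h1 h2.
  by apply/andP; split; lra.
apply: (@tlim (fun k => \1_[set x | 2^-1 < t k x]) _ 1).
- by move=> k; exact: tame_superlevel.
- by move=> k x; rewrite indicE; case: (_ \in _); rewrite ?normr1 ?normr0.
move=> x; apply: cvg_near_cst.
have : \forall k \near \oo, `|u k x| < pi.
  have : u ^~ x @ \oo --> (0 : R).
    rewrite -(mulr0 (dotv l x + a)); apply: cvgM; first exact: cvg_cst.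
    exact: cvg_harmonic.
  by move=> /cvgr0Pnorm_lt; apply; exact: pi_gt0.
apply: filterS => k; rewrite ltr_norml => /andP[u1 u2].
have ux : (0 < dotv l x + a) = (0 < u k x) by rewrite /u pmulr_lgt0 ?invr_gt0.
rewrite !indicE; congr (_%:R); congr (nat_of_bool _).
suff st : (2^-1 < t k x) = (0 < dotv l x + a).
  by apply/idP/idP => /set_mem /= h; apply/mem_set; rewrite /= ?st // -st.
rewrite ux /t; case: (ltP 0 (u k x)) => h.
  have : 0 < sin (u k x) by apply: sin_gt0_pi; rewrite h.
  by move=> ?; apply/idP; lra.
have : 0 <= sin (- u k x) by apply: sin_ge0_pi; rewrite oppr_ge0 h /=; lra.
by rewrite sinN => ?; apply/negbTE; rewrite -leNgt; lra.
Qed.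

Let iI := tame_indic_setI (mu:=mu) cmeasurable_expchar sqmod_expchar eM.
Let iU := tame_indic_bigcup (mu:=mu) cmeasurable_expchar sqmod_expchar eM e0.

Lemma tame_indic_forall (J : eqType) (s : seq J) (A : J -> set (Rn R n)) :
  (forall j, tame (\1_(A j) : Rn R n -> R)) ->
  tame (\1_[set x | forall j, j \in s -> A j x] : Rn R n -> R).
Proof.
move=> tA; elim: s => [|j s ih].
  rewrite (_ : \1__ = (fun=> 1) :> (_ -> R)); first exact: tC.
  by apply/funext => x; rewrite indicE mem_set.
rewrite (_ : [set x | _] = A j `&` [set x | forall j, j \in s -> A j x]).
  exact: iI.
rewrite predeqE => x; split=> [h|[h1 h2] i].
  by split=> [|i si]; apply: h; rewrite inE ?eqxx// si orbT.
by rewrite inE => /predU1P[->|/h2].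
Qed.

Lemma tame_ball (q : 'cV[R]_n) (e : R) :
  tame (\1_[set x : Rn R n | forall i, `|x i 0 - q i 0| < e] : Rn R n -> R).
Proof.
rewrite (_ : [set x | _] = [set x | forall i : 'I_n, i \in enum 'I_n ->
   ([set x | 0 < dotv (delta_mx i 0) x + (e - q i 0)] `&`
    [set x | 0 < dotv (- delta_mx i 0) x + (e + q i 0)]) x]).
  by apply: tame_indic_forall => i; apply: iI; exact: tame_halfspace.
rewrite predeqE => x; split=> /= h i.
  have := h i; rewrite dotvNl dotv_delta ltr_norml => /andP[? ?] _.
  by split; lra.
have := h i (mem_enum _ i); rewrite dotvNl dotv_delta => -[? ?].
by rewrite ltr_norml; apply/andP; split; lra.
Qed.

(** An open set is a countable union of cubes with rational centers, and a cube
    is a finite intersection of half-spaces. *)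
Lemma tame_open (U : set (Rn R n)) : open (U : set 'cV[R]_n) ->
  tame (\1_U : Rn R n -> R).
Proof.
move=> oU.
pose B (p : 'cV[rat]_n * nat) : set (Rn R n) :=
  [set x | forall i, `|x i 0 - map_mx ratr p.1 i 0| < p.2.+1%:R^-1].
pose F k : set (Rn R n) :=
  if @choice.unpickle ('cV[rat]_n * nat)%type k is Some p then
    if `[< B p `<=` U >] then B p else set0
  else set0.
have -> : U = \bigcup_k F k.
  rewrite eqEsubset; split=> [x Ux|x [k _]]; last first.
    by rewrite /F; case: (choice.unpickle k) => // p; case: asboolP => // BU /BU.
  have /nbhs_ballP[e /= e_gt0 eU] : nbhs (x : 'cV[R]_n) U by exact: open_nbhs_nbhs.
  pose m := Num.truncn (2 / e).
  have m2 : 2 * m.+1%:R^-1 < e.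
    rewrite ltr_pdivrMr// mulrC -ltr_pdivrMr//.
    exact: truncnS_gt.
  pose r : R := m.+1%:R^-1.
  have r0 : 0 < r by rewrite invr_gt0.
  have qP i : exists q : rat, `|x i 0 - ratr q| < r.
    have [|q] := @rat_in_itvoo R (x i 0) (x i 0 + r); first by rewrite ltrDl.
    by rewrite in_itv /= => /andP[h1 h2]; exists q; rewrite ltr_norml; lra.
  pose q : 'cV[rat]_n := \col_i sval (cid (qP i)).
  have Bx : B (q, m) x.
    by move=> i; rewrite !mxE; exact: (svalP (cid (qP i))).
  have BU : B (q, m) `<=` U.
    move=> y By; apply: eU; split=> // i j; rewrite (ord1 j) /ball /=.
    have := Bx i; have := By i; rewrite /= -/r => h1 h2.
    have -> : x i 0 - y i 0 = (x i 0 - map_mx ratr q i 0) -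
      (y i 0 - map_mx ratr q i 0) by ring.
    apply: le_lt_trans (ler_normB _ _) _; move: m2; rewrite -/r; lra.
  by exists (choice.pickle (q, m)) => //; rewrite /F choice.pickleK asboolT.
apply: iU => k; rewrite /F; case: (choice.unpickle k) => [p|].
  case: asboolP => _; first exact: tame_ball.
  by rewrite indic0; exact: tC.
by rewrite indic0; exact: tC.
Qed.

(** Open sets have tame indicators and generate the Borel sets, so simple
    functions, and with them all square-integrable functions, are in the closed
    span. *)
Theorem expchar_total f : L2_fun mu f -> approximable mu (@expchar R n) setT f.
Proof.
apply: approximable_L2_fun.
- exact: cmeasurable_expchar.
- exact: sqmod_expchar.
- exact: eM.
- exact: e0.
- move=> A mA.
  by apply: (tame_indic cmeasurable_expchar sqmod_expchar eM e0 _ tame_open mA).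
Qed.

End ExponentialsAreTotal.

(** * Fourier transform and distances to spans of exponentials *)

Section FourierTransform.
Variables (R : realType) (n : nat) (mu : probability (Rn R n) R).
Implicit Types l k : 'cV[R]_n.

Definition cos_int l : R := (\int[mu]_x cos (2 * pi * dotv l x))%R.
Definition sin_int l : R := (\int[mu]_x sin (2 * pi * dotv l x))%R.
Definition fourier l : R[i] := Complex (cos_int l) (sin_int l).
Definition power l : R := sqmod (fourier l).

Lemma integrable_bounded1 (f : Rn R n -> R) : measurable_fun setT f ->
  (forall x, `|f x| <= 1) -> mu.-integrable setT (EFin \o f).
Proof.
move=> mf f1; have i1 : mu.-integrable setT (EFin \o (fun=> 1)).
  exact: finite_measure_integrable_cst.
apply: (le_integrable measurableT _ _ i1); first exact/measurable_EFinP.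
by move=> x _; rewrite /= lee_fin normr1.
Qed.

Lemma integrable_cos_dotv l :
  mu.-integrable setT (EFin \o (fun x => cos (2 * pi * dotv l x))).
Proof.
apply: integrable_bounded1; first exact: measurable_cos_dotv.
by move=> x; rewrite ler_norml cos_geN1 cos_le1.
Qed.

Lemma integrable_sin_dotv l :
  mu.-integrable setT (EFin \o (fun x => sin (2 * pi * dotv l x))).
Proof.
apply: integrable_bounded1; first exact: measurable_sin_dotv.
by move=> x; rewrite ler_norml sin_geN1 sin_le1.
Qed.

Lemma fourier0 : fourier 0 = 1.
Proof.
rewrite /fourier /cos_int /sin_int.
under eq_Rintegral do rewrite dotv0l mulr0 cos0.
under [X in Complex _ X]eq_Rintegral do rewrite dotv0l mulr0 sin0.
rewrite !Rintegral_cst// mul0r mul1r.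
by rewrite [X in fine X](_ : _ = 1%E)//; exact: probability_setT.
Qed.

Lemma fourierN l : fourier (- l) = conjc (fourier l).
Proof.
rewrite /fourier /cos_int /sin_int /=; congr Complex.
  by apply: eq_Rintegral => x _; rewrite dotvNl mulrN cosN.
rewrite -mulN1r -RintegralZl//; last exact: integrable_sin_dotv.
by apply: eq_Rintegral => x _; rewrite dotvNl mulrN sinN mulN1r.
Qed.

Lemma power0 : power 0 = 1.
Proof. by rewrite /power fourier0 /sqmod /= expr1n expr0n addr0. Qed.

Lemma powerN l : power (- l) = power l.
Proof. by rewrite /power fourierN /sqmod /= sqrrN. Qed.

Lemma power_ge0 l : 0 <= power l.
Proof. exact: sqmod_ge0. Qed.

Lemma power_eq0 l : power l = 0 -> fourier l = 0.
Proof.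
move=> /eqP; rewrite /power /sqmod paddr_eq0 ?sqr_ge0// !sqrf_eq0 /fourier /=.
by move=> /andP[/eqP -> /eqP ->].
Qed.

Lemma expchar_mul_conj l k (x : Rn R n) :
  expchar l x * conjc (expchar k x) = expchar (l - k) x.
Proof.
rewrite (_ : conjc _ = expchar (- k) x); first exact: expcharD.
by rewrite /expchar dotvNl mulrN cosN sinN.
Qed.

Lemma L2_inner_expchar l k :
  L2_inner mu (@expchar R n l) (@expchar R n k) = fourier (l - k).
Proof.
by congr Complex; apply: eq_Rintegral => x _; rewrite expchar_mul_conj.
Qed.

Notation lincomb := (lincomb (@expchar R n)).

Lemma Rintegral_Re_lincomb s :
  mu.-integrable setT (EFin \o (fun x => complex.Re (lincomb s x))) /\
  (\int[mu]_x complex.Re (lincomb s x))%R =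
    complex.Re (\sum_(p <- s) p.1 * fourier p.2).
Proof.
elim: s => [|[[a b] l] s [ih1 ih2]].
  rewrite /lincomb; split.
    rewrite (_ : _ \o _ = cst 0%E); first exact: integrable0.
    by apply/funext => x; rewrite /= big_nil.
  under eq_Rintegral do rewrite big_nil.
  by rewrite Rintegral_cst// mul0r big_nil.
have E x : complex.Re (lincomb ((Complex a b, l) :: s) x) =
   (a * cos (2 * pi * dotv l x) + (- b) * sin (2 * pi * dotv l x)) +
   complex.Re (lincomb s x).
  by rewrite /lincomb big_cons /=; case: (\sum_(_ <- _) _) => c d /=; ring.
have i1 : mu.-integrable setT (EFin \o (fun x => a * cos (2 * pi * dotv l x))).
  exact: (integrableZl measurableT a (integrable_cos_dotv l)).
have i2 : mu.-integrable setT (EFin \o (fun x => - b * sin (2 * pi * dotv l x))).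
  exact: (integrableZl measurableT (- b) (integrable_sin_dotv l)).
have i3 : mu.-integrable setT (EFin \o (fun x => a * cos (2 * pi * dotv l x) +
    - b * sin (2 * pi * dotv l x))).
  exact: (integrableD measurableT i1 i2).
split.
  rewrite (_ : _ \o _ = EFin \o (fun x => (a * cos (2 * pi * dotv l x) +
    (- b) * sin (2 * pi * dotv l x)) + complex.Re (lincomb s x))).
    exact: (integrableD measurableT i3 ih1).
  by apply/funext => x /=; rewrite E.
under eq_Rintegral do rewrite E.
rewrite RintegralD// ih2 RintegralD// RintegralZl//; last exact: integrable_cos_dotv.
rewrite RintegralZl//; last exact: integrable_sin_dotv.
rewrite big_cons /=; case: (\sum_(_ <- _) _) => c d /=.
by rewrite -/(cos_int l) -/(sin_int l); ring.
Qed.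

Lemma L2_sqnorm_lincomb s : L2_sqnorm mu (lincomb s) =
  (complex.Re (\sum_(p <- s) \sum_(q <- s) p.1 * conjc q.1 * fourier (p.2 - q.2)))%:E.
Proof.
pose t := [seq (p.1 * conjc q.1, p.2 - q.2) | p <- s, q <- s].
have E x : sqmod (lincomb s x) = complex.Re (lincomb t x).
  have -> : sqmod (lincomb s x) =
      complex.Re (lincomb s x * conjc (lincomb s x)).
    by case: (lincomb s x) => a b; rewrite /sqmod /=; ring.
  congr (complex.Re _).
  rewrite /t /lincomb big_allpairs_dep /= mulr_suml; apply: eq_bigr => p _.
  rewrite rmorph_sum mulr_sumr; apply: eq_bigr => q _.
  by rewrite rmorphM -expchar_mul_conj; ring.
have [it Et] := Rintegral_Re_lincomb t.
transitivity (\int[mu]_x (complex.Re (lincomb t x))%:E)%E.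
  by apply: eq_integral => x _; rewrite -E.
have fi : (\int[mu]_x (complex.Re (lincomb t x))%:E)%E \is a fin_num.
  exact: (integrable_fin_num _ it).
rewrite -(fineK fi) -/(Rintegral _ _ _) Et; congr (_%:E); congr complex.Re.
by rewrite /t big_allpairs_dep.
Qed.

(** Pythagoras: the first two terms are the squared distance of the exponential
    [k] to the span of [F], the last one is the squared distance of the
    coefficients [c] to the Fourier coefficients. *)
Lemma L2_sqnorm_residual (F : seq 'cV[R]_n) (c : 'cV[R]_n -> R[i]) k :
  uniq F -> {in F &, forall l l', l != l' -> fourier (l - l') = 0} ->
  L2_sqnorm mu (fun x => expchar k x - \sum_(l <- F) c l * expchar l x) =
  (1 - \sum_(l <- F) power (k - l) +
     \sum_(l <- F) sqmod (c l - fourier (k - l)))%:E.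
Proof.
move=> uF oF.
rewrite (_ : (fun _ => _) = lincomb ((1, k) :: [seq (- c l, l) | l <- F])); last first.
  apply/funext => x; rewrite /lincomb big_cons big_map /= mul1r -sumrN.
  by congr (_ + _); apply: eq_bigr => l _; rewrite mulNr.
rewrite L2_sqnorm_lincomb; congr (_%:E).
have c1 : Complex 1 (- 0) = 1 :> R[i] by rewrite oppr0.
rewrite big_cons big_cons big_map big_map /= subrr fourier0 c1 !mul1r.
have E l : l \in F -> \sum_(j <- F) - c l * conjc (- c j) * fourier (l - j) =
    (sqmod (c l))%:C%C.
  move=> lF; rewrite (bigD1_seq l) //= subrr fourier0 big1_seq ?addr0.
    case: (c l) => a b; apply/eqP; rewrite eq_complex /sqmod /=.
    by apply/andP; split; apply/eqP; ring.
  by move=> j /andP[jl jF]; rewrite oF ?mulr0// eq_sym.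
rewrite [X in complex.Re (_ + _ + X)](_ : _ =
    \sum_(l <- F) (- c l * fourier (l - k) + (sqmod (c l))%:C%C)); last first.
  by apply: eq_big_seq => l lF; rewrite big_cons /= big_map c1 mulr1 E.
rewrite -addrA -big_split /= raddfD raddf_sum /= -addrA -sumrN -big_split.
congr (_ + _); apply: eq_bigr => l _; rewrite mul1r.
have -> : l - k = - (k - l) by rewrite opprB.
rewrite fourierN /power; case: (fourier _) (c l) => [u v] [a b].
by rewrite /sqmod /=; ring.
Qed.

End FourierTransform.

(** * Spectra as sets satisfying the Parseval identity *)

Section ParsevalSets.
Variables (R : realType) (V : zmodType) (phi : V -> R).

Definition orthogonal_set (L : set V) :=
  forall l l', L l -> L l' -> l != l' -> phi (l - l') = 0.

(** The identity [\sum_(l in L) phi (k - l) = 1].  Finite partial sums suffice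
    to state it since orthogonality bounds them by 1. *)
Definition parseval_set (L : set V) := [/\ countable L, orthogonal_set L &
  forall k (eps : R), 0 < eps -> exists F : seq V,
    [/\ uniq F, forall l, l \in F -> L l & 1 - eps < \sum_(l <- F) phi (k - l)]].

End ParsevalSets.

(** Adds up the coefficients of repeated indices. *)
Lemma lincomb_fset (R : realType) (I : choiceType) (d : measure_display)
    (T : measurableType d) (e : I -> T -> R[i]) (s : seq (R[i] * I)) :
  exists c : I -> R[i], forall x, lincomb e s x = \sum_(l <- [fset p.2 | p in s]%fset) c l * e l x.
Proof.
exists (fun l => \sum_(p <- s | p.2 == l) p.1) => x.
under eq_bigr do rewrite mulr_suml big_mkcond.
rewrite exchange_big /lincomb /=; apply: eq_big_seq => p ps.
have pF : p.2 \in [fset p.2 | p in s]%fset by apply/imfsetP; exists p.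
rewrite (big_fsetD1 p.2)//= eqxx big1_seq ?addr0// => l /andP[_].
by rewrite !inE eq_sym => /andP[/negbTE -> _].
Qed.

Section SpectralCriterion.
Variables (R : realType) (n : nat) (mu : probability (Rn R n) R).
Implicit Types (l k : 'cV[R]_n) (L : set 'cV[R]_n).

Lemma power_bessel (F : seq 'cV[R]_n) k : uniq F ->
  orthogonal_set (power mu) [set` F] -> \sum_(l <- F) power mu (k - l) <= 1.
Proof.
move=> uF oF; rewrite -subr_ge0 -lee_fin.
have := @L2_sqnorm_residual R n mu F (fun l => fourier mu (k - l)) k uF.
rewrite [X in (_ + X)%:E]big1 => [|l _]; last first.
  by rewrite subrr /sqmod /= expr0n addr0.
rewrite addr0 => <-; first exact: L2_sqnorm_ge0.
by move=> l l' lF l'F ll'; apply: power_eq0; exact: oF.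
Qed.

(** By [L2_sqnorm_residual], [1 - \sum_(l <- F) power mu (k - l)] is the squared
    distance of the exponential [k] to the span of [F].  It tends to 0 for every
    [k] exactly when all exponentials are in the closed span, and these are
    total. *)
Lemma spectral_measureP : compactly_supported mu ->
  spectral_measure mu <-> exists L, parseval_set (power mu) L.
Proof.
have eL2 k : L2_fun mu (@expchar R n k).
  by apply: L2_fun_e; [exact: cmeasurable_expchar | exact: sqmod_expchar].
move=> cmu; split=> [[_ [L [cL [eL oL dL]]]]|[L [cL oL dL]]].
  have oL' : orthogonal_set (power mu) L.
    move=> l l' Ll Ll' ll'; rewrite /power -L2_inner_expchar oL// (negbTE ll').
    by rewrite /sqmod /= expr0n addr0.
  exists L; split=> // k eps eps0.
  have [F [c [FL]]] := dL _ (eL2 k) _ eps0.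
  rewrite L2_sqnorm_residual ?fset_uniq//; last first.
    move=> l l' lF l'F ll'; apply: power_eq0; apply: oL' => //; exact: FL.
  rewrite lte_fin => lt; exists F; split=> //; first exact: fset_uniq.
  have : 0 <= \sum_(l <- F) sqmod (c l - fourier mu (k - l)).
    by apply: sumr_ge0 => l _; exact: sqmod_ge0.
  lra.
split=> //; exists L; split=> //; split.
- by move=> l _; exact: eL2.
- move=> l l' Ll Ll'; rewrite L2_inner_expchar; have [->|ll'] := eqVneq l l'.
    by rewrite subrr fourier0.
  by apply: power_eq0; exact: oL.
- move=> f f2 eps eps0.
  have [_ fL] : approximable mu (@expchar R n) L f.
    apply: approximable_trans; last exact: expchar_total;
      do ?[exact: cmeasurable_expchar | exact: sqmod_expchar].
    move=> k; split=> // e e0; have [F [uF FL lt]] := dL k e e0.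
    exists [seq (fourier mu (k - l), l) | l <- F]; split=> [p /mapP[l lF ->]|].
      exact: FL.
    rewrite (_ : (fun _ => _) = fun x => expchar k x -
        \sum_(l <- F) fourier mu (k - l) * expchar l x); last first.
      by apply/funext => x; rewrite /lincomb big_map.
    rewrite L2_sqnorm_residual//; last first.
      by move=> l l' lF l'F ll'; apply: power_eq0; apply: oL => //; exact: FL.
    rewrite [X in _ + X]big1 ?addr0 ?lte_fin; first lra.
    by move=> l _; rewrite subrr /sqmod /= expr0n addr0.
  have [s [sL fs]] := fL _ eps0.
  have [c cE] := lincomb_fset (@expchar R n) s.
  exists [fset p.2 | p in s]%fset, c; split.
    by move=> l /= /imfsetP[p /= ps ->]; exact: sL.
  by under eq_fun do rewrite -cE.
Qed.

End SpectralCriterion.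

Section PowerContinuity.
Variables (R : realType) (n : nat) (mu : probability (Rn R n) R).
Implicit Types l h : 'cV[R]_n.

Lemma ler_dist_sin_cos (a b : R) :
  `|cos a - cos b| <= `|a - b| /\ `|sin a - sin b| <= `|a - b|.
Proof.
have key (f df : R -> R) : (forall x : R, is_derive x 1 f (df x)) ->
    (forall x, `|df x| <= 1) -> `|f a - f b| <= `|a - b|.
  move=> fd df1; wlog ab : a b / a <= b => [h|].
    by case: (leP a b) => [|/ltW] ?; [exact: h | rewrite distrC [leRHS]distrC; exact: h].
  have cf : {within `[a, b], continuous f}.
    apply: continuous_subspaceT => x; apply/differentiable_continuous.
    by apply/derivable1_diffP; have [] := fd x.
  have [c _ E] := MVT_segment ab (fun x _ => fd x) cf.
  by rewrite distrC E normrM [leRHS]distrC ler_piMl.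
split.
  apply: (key (@cos R) (fun x => - sin x)) => x.
  by rewrite normrN ler_norml sin_geN1 sin_le1.
apply: (key (@sin R) (@cos R)) => x.
by rewrite ler_norml cos_geN1 cos_le1.
Qed.

Definition box (K : R) : set (Rn R n) := [set x | forall i, `|x i 0| <= K].

Lemma measurable_coord (i : 'I_n) :
  measurable_fun setT (fun x : Rn R n => x i 0).
Proof.
rewrite (_ : (fun _ => _) = dotv (delta_mx i 0)); first exact: measurable_dotv.
by apply/funext => x; rewrite dotv_delta.
Qed.

Lemma measurable_box K : measurable (box K).
Proof.
rewrite (_ : box K = \bigcap_(i in [set: 'I_n]) [set x | `|x i 0| <= K]).
  apply: fin_bigcap_measurable => // i _.
  rewrite -[X in measurable X]setTI.
  apply: (@measurable_fun_ler _ _ R setT (fun x : Rn R n => `|x i 0|) (fun=> K)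
     _ _ measurableT [set true]) => //.
  by apply: measurableT_comp => //; exact: measurable_coord.
by rewrite predeqE => x; split=> [h i _|h i]; [exact: h | exact: (h i)].
Qed.

Variable K : R.
Hypothesis supp : mu (~` box K) = 0%E.

Lemma Rintegral_le_box (f : Rn R n -> R) (c : R) : 0 <= c ->
  mu.-integrable setT (EFin \o f) -> (forall x, 0 <= f x) ->
  (forall x, box K x -> f x <= c) -> (\int[mu]_x f x)%R <= c.
Proof.
move=> c0 fi f0 fc.
have mB : measurable (~` box K) by apply: measurableC; exact: measurable_box.
rewrite -lee_fin /Rintegral fineK; last exact: (integrable_fin_num _ fi).
rewrite (negligible_integral mB)// setTD setCK.
apply: (@le_trans _ _ (\int[mu]_(x in box K) (cst c%:E x))%E).
  apply: ge0_le_integral => //.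
  - exact: measurable_box.
  - by move=> x _; rewrite lee_fin.
  - by apply: measurable_funTS; case/integrableP: fi.
rewrite integral_cst; last exact: measurable_box.
rewrite -[leRHS]mule1 lee_wpmul2l ?lee_fin//.
by apply: probability_le1; exact: measurable_box.
Qed.

Lemma dist_Rintegral_le (f g : Rn R n -> R) (c : R) : 0 <= c ->
  mu.-integrable setT (EFin \o f) -> mu.-integrable setT (EFin \o g) ->
  (forall x, box K x -> `|f x - g x| <= c) ->
  `|(\int[mu]_x f x)%R - (\int[mu]_x g x)%R| <= c.
Proof.
move=> c0 fi gi fc; rewrite -RintegralB//.
have i1 : mu.-integrable setT (EFin \o (fun x => f x - g x)).
  exact: (integrableB measurableT fi gi).
apply: le_trans (le_normr_Rintegral measurableT i1) _.
by apply: Rintegral_le_box => //; exact: (integrable_norm i1).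
Qed.

Lemma Rintegral_le1 (f : Rn R n -> R) : mu.-integrable setT (EFin \o f) ->
  (forall x, `|f x| <= 1) -> `|(\int[mu]_x f x)%R| <= 1.
Proof.
move=> fi f1; have -> : (\int[mu]_x f x)%R =
  (\int[mu]_x f x)%R - (\int[mu]_(x in setT) 0)%R by rewrite Rintegral_cst// mul0r subr0.
apply: dist_Rintegral_le => // [|x _]; first exact: integrable0.
by rewrite subr0.
Qed.

Lemma cos_int_le1 l : `|cos_int mu l| <= 1.
Proof.
apply: Rintegral_le1 => [|x]; first exact: integrable_cos_dotv.
by rewrite ler_norml cos_geN1 cos_le1.
Qed.

Lemma sin_int_le1 l : `|sin_int mu l| <= 1.
Proof.
apply: Rintegral_le1 => [|x]; first exact: integrable_sin_dotv.
by rewrite ler_norml sin_geN1 sin_le1.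
Qed.

(** On a bounded support the integrands of [cos_int] and [sin_int] are Lipschitz
    in the frequency, uniformly in the point. *)
Lemma power_lipschitz : exists2 C : R, 0 <= C &
  forall l h, `|power mu (l + h) - power mu l| <= C * \sum_i `|h i 0|.
Proof.
have K0 : 0 <= `|K| by [].
have pi0 : 0 <= @pi R by exact: pi_ge0.
exists (8 * pi * `|K|) => [|l h]; first by rewrite !mulr_ge0.
pose c : R := 2 * pi * `|K| * \sum_i `|h i 0|.
have c0 : 0 <= c by rewrite !mulr_ge0// sumr_ge0.
have hc x : box K x -> `|2 * pi * dotv (l + h) x - 2 * pi * dotv l x| <= c.
  move=> Bx; rewrite -mulrBr dotvDl addrC addKr normrM ger0_norm ?mulr_ge0//.
  rewrite /c -!mulrA !ler_wpM2l// mulr_sumr.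
  apply: le_trans (ler_norm_sum _ _ _) _; apply: ler_sum => i _.
  rewrite normrM mulrC ler_wpM2r//.
  by apply: le_trans (Bx i) _; exact: ler_norm.
have dc : `|cos_int mu (l + h) - cos_int mu l| <= c.
  apply: dist_Rintegral_le => //; try exact: integrable_cos_dotv.
  by move=> x /hc; apply: le_trans; have [] := ler_dist_sin_cos
    (2 * pi * dotv (l + h) x) (2 * pi * dotv l x).
have ds : `|sin_int mu (l + h) - sin_int mu l| <= c.
  apply: dist_Rintegral_le => //; try exact: integrable_sin_dotv.
  by move=> x /hc; apply: le_trans; have [] := ler_dist_sin_cos
    (2 * pi * dotv (l + h) x) (2 * pi * dotv l x).
have -> : 8 * pi * `|K| * \sum_i `|h i 0| = 2 * c + 2 * c by rewrite /c; ring.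
rewrite /power /sqmod /fourier /=.
have sq (u v : R) : `|u| <= 1 -> `|v| <= 1 -> `|u - v| <= c ->
    `|u ^+ 2 - v ^+ 2| <= 2 * c.
  move=> u1 v1 uv; rewrite subr_sqr normrM mulrC ler_pM//.
  by apply: le_trans (ler_normD _ _) _; lra.
have := sq _ _ (cos_int_le1 (l + h)) (cos_int_le1 l) dc.
have := sq _ _ (sin_int_le1 (l + h)) (sin_int_le1 l) ds.
move: (cos_int _ _) (cos_int _ _) (sin_int _ _) (sin_int _ _) => b a b' a'.
move=> h1 h2; rewrite (_ : _ - _ = (a ^+ 2 - b ^+ 2) + (a' ^+ 2 - b' ^+ 2)).
  by apply: le_trans (ler_normD _ _) _; rewrite lerD.
by ring.
Qed.

Lemma compactly_supported_box : compactly_supported mu.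
Proof.
exists (box K : set 'cV[R]_n); split; last exact: supp.
pose A := [set v : 'rV[R]_n | forall i, `[- K, K]%classic (v ord0 i)].
have cA : compact A.
  by apply: (@rV_compact R n (fun=> `[- K, K]%classic)) => i; exact: segment_compact.
rewrite (_ : box K = trmx @` A).
  apply: continuous_compact cA; apply: continuous_subspaceT => v.
  move=> S /nbhs_ballP[e /= e0 eS]; apply/nbhs_ballP; exists e => //= w [_ vw].
  by apply: eS; split=> // i j; rewrite !mxE.
rewrite eqEsubset; split=> [x Bx|_ [v Av <-] i].
  exists x^T; last by rewrite trmxK.
  by move=> i; rewrite /= mxE in_itv /= -ler_norml; exact: Bx.
by have := Av i; rewrite /= in_itv /= -ler_norml mxE.
Qed.

End PowerContinuity.

(** * A norm expanded by a 2 x 2 matrix *)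

Section AdaptedNorm.
Variable R : realType.

Definition cabs (z : R[i]) : R := complex.Re `|z|.

Lemma cabsE z : (cabs z)%:C%C = `|z|.
Proof. by rewrite /cabs RRe_real // normr_real. Qed.

Lemma cabs_ge0 z : 0 <= cabs z.
Proof. by rewrite -lecR cabsE; exact: normr_ge0. Qed.

Lemma cabsM z w : cabs (z * w) = cabs z * cabs w.
Proof. by apply: (@complexI R); rewrite rmorphM /= !cabsE normrM. Qed.

Lemma cabsD z w : cabs (z + w) <= cabs z + cabs w.
Proof. by rewrite -lecR rmorphD /= !cabsE ler_normD. Qed.

Lemma cabsB z w : cabs (z - w) <= cabs z + cabs w.
Proof. by rewrite -lecR rmorphD /= !cabsE ler_normB. Qed.

Lemma cabs_real (x : R) : cabs x%:C%C = `|x|.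
Proof. by apply: (@complexI R); rewrite cabsE normc_def /= expr0n addr0 sqrtr_sqr. Qed.

(** Let [L] be the matrix with rows [(a, b)] and [(c, d)], [z1] and [z2] its
    eigenvalues, and [g u] the size of [(L - z1) u].  By Cayley-Hamilton
    [g (L u) = |z2| g u], and [|z1| |u| <= |L u| + g u].  Therefore [L] expands
    the norm [|u| + K g u] once [K] is large, also if the eigenvalues
    coincide. *)
Lemma expanding_norm (a b c d : R) :
  (forall z : R[i], z ^+ 2 - (a + d)%:C%C * z + (a * d - b * c)%:C%C = 0 ->
     1 < `|z|) ->
  exists (N : R * R -> R) (rho C : R), [/\ 0 < rho < 1, 0 <= C,
    forall u v, N (u + v) <= N u + N v,
    forall u, `|u.1| <= N u /\ `|u.2| <= N u /\ N u <= C * (`|u.1| + `|u.2|) &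
    forall u, N u <= rho * N (a * u.1 + b * u.2, c * u.1 + d * u.2)].
Proof.
move=> H; pose s := sqrtC (((a + d) ^+ 2 - 4 * (a * d - b * c))%:C%C : R[i]).
pose z1 : R[i] := ((a + d)%:C%C + s) / 2; pose z2 : R[i] := ((a + d)%:C%C - s) / 2.
have s2 : s ^+ 2 = ((a + d)%:C%C) ^+ 2 - 4 * (a * d - b * c)%:C%C.
  by rewrite sqrtCK rmorphB rmorphXn rmorphM rmorph_nat.
have two0 : 2 != 0 :> R[i] by rewrite pnatr_eq0.
have zsum : z1 + z2 = (a + d)%:C%C by rewrite /z1 /z2; field.
have zprod : z1 * z2 = (a * d - b * c)%:C%C.
  rewrite (_ : z1 * z2 = (((a + d)%:C%C) ^+ 2 - s ^+ 2) / 4); first by rewrite s2; field.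
  by rewrite /z1 /z2; field.
have z1_gt1 : 1 < cabs z1.
  by rewrite -ltcR cabsE; apply: H; rewrite -zsum -zprod; ring.
have z2_gt1 : 1 < cabs z2.
  by rewrite -ltcR cabsE; apply: H; rewrite -zsum -zprod; ring.
pose p (u : R * R) : R[i] := (a%:C%C - z1) * u.1%:C%C + b%:C%C * u.2%:C%C.
pose q (u : R * R) : R[i] := c%:C%C * u.1%:C%C + (d%:C%C - z1) * u.2%:C%C.
pose L (u : R * R) := (a * u.1 + b * u.2, c * u.1 + d * u.2).
have adE : (a + d)%:C%C = a%:C%C + d%:C%C :> R[i] by rewrite rmorphD.
have z2E : z2 = a%:C%C + d%:C%C - z1 by rewrite -adE -zsum; ring.
have zp : z1 * z2 = a%:C%C * d%:C%C - b%:C%C * c%:C%C.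
  by rewrite zprod rmorphB !rmorphM.
have pL u : p (L u) = z2 * p u.
  rewrite /p /L /= !rmorphD !rmorphM /=.
  have -> : z2 * ((a%:C%C - z1) * u.1%:C%C + b%:C%C * u.2%:C%C) =
     (a%:C%C * z2 - z1 * z2) * u.1%:C%C + z2 * b%:C%C * u.2%:C%C by ring.
  by rewrite zp z2E; ring.
have qL u : q (L u) = z2 * q u.
  rewrite /q /L /= !rmorphD !rmorphM /=.
  have -> : z2 * (c%:C%C * u.1%:C%C + (d%:C%C - z1) * u.2%:C%C) =
     z2 * c%:C%C * u.1%:C%C + (d%:C%C * z2 - z1 * z2) * u.2%:C%C by ring.
  by rewrite zp z2E; ring.
pose g u := cabs (p u) + cabs (q u).
have g0 u : 0 <= g u by rewrite addr_ge0 ?cabs_ge0.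
have gL u : g (L u) = cabs z2 * g u by rewrite /g pL qL !cabsM mulrDr.
have z1u u : cabs z1 * (`|u.1| + `|u.2|) <= `|(L u).1| + `|(L u).2| + g u.
  have -> : cabs z1 * (`|u.1| + `|u.2|) =
      cabs ((L u).1%:C%C - p u) + cabs ((L u).2%:C%C - q u).
    rewrite -!cabs_real mulrDr -!cabsM; congr (cabs _ + cabs _).
      by rewrite /p /L /= rmorphD !rmorphM; ring.
    by rewrite /q /L /= rmorphD !rmorphM; ring.
  rewrite -!cabs_real /g addrACA; apply: lerD; exact: cabsB.

set m1 := cabs z1 in z1_gt1 z1u; set m2 := cabs z2 in z2_gt1 gL.
pose K := 2 * m2 / (m2 - 1) + 1.
have K1 : 1 < K by rewrite /K ltrDr divr_gt0//; lra.
have m20 : m2 != 0 by rewrite gt_eqF//; lra.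
have K0 : K != 0 by rewrite gt_eqF//; lra.
have m21 : m2 - 1 != 0 by rewrite gt_eqF//; lra.
have m2K : m2^-1 + K^-1 < 1.
  have -> : m2^-1 + K^-1 = (K + m2) / (m2 * K) by field; rewrite m20 K0.
  rewrite ltr_pdivrMr ?mulr_gt0//; [|lra..].
  have : (K - 1) * (m2 - 1) = 2 * m2 by rewrite /K addrK divfK.
  by nra.
pose rho := Num.max m1^-1 (m2^-1 + K^-1).
have rho0 : 0 < rho by rewrite lt_max invr_gt0; apply/orP; left; lra.
have rho1 : rho < 1 by rewrite gt_max m2K andbT invf_lt1//; lra.
have [C C0 gC] : exists2 C, 0 <= C & forall u, g u <= C * (`|u.1| + `|u.2|).
  pose C := cabs (a%:C%C - z1) + cabs (b%:C%C) + cabs (c%:C%C) + cabs (d%:C%C - z1).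
  have c1 := cabs_ge0 (a%:C%C - z1); have c2 := cabs_ge0 (b%:C%C).
  have c3 := cabs_ge0 (c%:C%C : R[i]); have c4 := cabs_ge0 (d%:C%C - z1).
  exists C; first by rewrite !addr_ge0.
  move=> u; rewrite /g /p /q.
  have := cabsD ((a%:C%C - z1) * u.1%:C%C) (b%:C%C * u.2%:C%C).
  have := cabsD (c%:C%C * u.1%:C%C) ((d%:C%C - z1) * u.2%:C%C).
  rewrite !cabsM !(cabs_real u.1) !(cabs_real u.2) /C.
  have := normr_ge0 u.1; have := normr_ge0 u.2.
  move: (cabs (_ - z1)) (cabs (_ - z1)) (cabs _%:C%C) (cabs _%:C%C) c1 c2 c3 c4.
  by move: `|u.1| `|u.2| => ? ? ? ? ? ? ? ? ? ? ? ?; nra.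
exists (fun u => `|u.1| + `|u.2| + K * g u), rho, (1 + K * C); split.
- by rewrite rho0.
- by rewrite addr_ge0// mulr_ge0//; lra.
- move=> u v.
  have : g (u + v) <= g u + g v.
    have -> : g (u + v) = cabs (p u + p v) + cabs (q u + q v).
      by congr (cabs _ + cabs _); rewrite /p /q /= !rmorphD; ring.
    by have := cabsD (p u) (p v); have := cabsD (q u) (q v); rewrite /g; lra.
  have := ler_normD u.1 v.1; have := ler_normD u.2 v.2 => /= h1 h2 h3.
  have : K * g (u + v) <= K * (g u + g v) by rewrite ler_wpM2l//; lra.
  by lra.
- move=> u; have Kg : 0 <= K * g u by rewrite mulr_ge0//; lra.
  have := normr_ge0 u.1; have := normr_ge0 u.2; have := gC u => h1 h2 h3.
  have : K * g u <= K * (C * (`|u.1| + `|u.2|)) by rewrite ler_wpM2l//; lra.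
  by split; [lra | split; lra].
move=> u; rewrite -/(L u).
have g2 : g u = m2^-1 * g (L u) by rewrite gL mulKf.
have h1 : `|u.1| + `|u.2| <= m1^-1 * (`|(L u).1| + `|(L u).2| + g u).
  by rewrite mulrC ler_pdivlMr 1?mulrC//; lra.
have gL0 := g0 (L u); have n0 : 0 <= `|(L u).1| + `|(L u).2| by rewrite addr_ge0.
have r1 : m1^-1 * (`|(L u).1| + `|(L u).2|) <= rho * (`|(L u).1| + `|(L u).2|).
  by rewrite ler_wpM2r// le_max lexx.
have r2 : (m2^-1 + K^-1) * (K * g (L u)) <= rho * (K * g (L u)).
  by rewrite ler_wpM2r ?mulr_ge0//; [lra | rewrite le_max lexx orbT].
have h2 : m1^-1 * g u <= g (L u).
  rewrite g2 mulrA ler_piMl// mulr_ile1 ?invr_ge0 ?invf_le1//; lra.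
have h3 : (m2^-1 + K^-1) * (K * g (L u)) = K * (m2^-1 * g (L u)) + g (L u).
  by field; rewrite m20 K0.
move: h1 r1 r2 h2 h3; rewrite g2; move: (m1^-1) (m2^-1) (K^-1) => i1 i2 i3.
move: (`|_| + `|_|) (`|_| + `|_|) (g _) => S X Y; lra.
Qed.

End AdaptedNorm.

(** * Self-affine measures *)

Section SelfAffine.
Variables (R : realType) (n : nat) (A : 'M[R]_n) (D : {fset 'cV[R]_n}).
Variable mu : probability (Rn R n) R.
Hypothesis A_unit : A \in unitmx.
Hypothesis mu_affine : self_affine_measure A D mu.
Hypothesis D_gt0 : (0 < #|` D|)%N.

Lemma dotv_mul (B : 'M[R]_n) (l x : 'cV[R]_n) : dotv (B^T *m l) x = dotv l (B *m x).
Proof.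
have dE (u v : 'cV[R]_n) : dotv u v = (u^T *m v) 0 0.
  by rewrite mxE; apply: eq_bigr => i _; rewrite mxE.
by rewrite !dE trmx_mul trmxK mulmxA.
Qed.

Lemma dotvDr (l x y : 'cV[R]_n) : dotv l (x + y) = dotv l x + dotv l y.
Proof. by rewrite -big_split; apply: eq_bigr => i _; rewrite mxE mulrDr. Qed.

Lemma continuous_ifs_map d : continuous (ifs_map A d).
Proof.
move=> x S /nbhs_ballP[e /= e0 eS].
have near_i i : \forall y \near x, `|ifs_map A d x i 0 - ifs_map A d y i 0| < e.
  have E y : ifs_map A d y i 0 = dotv (\col_j (invmx A) i j) (y + d).
    by rewrite /ifs_map mxE; apply: eq_bigr => j _; congr (_ * _); rewrite mxE.
  have : (fun y : 'cV[R]_n => dotv (\col_j (invmx A) i j) y +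
     dotv (\col_j (invmx A) i j) d) @ x -->
     dotv (\col_j (invmx A) i j) x + dotv (\col_j (invmx A) i j) d.
    exact: (cvgD (@continuous_dotv R n _ x) (cvg_cst _)).
  move=> /cvgrPdist_lt /(_ _ e0); apply: filterS => y.
  by rewrite !E !dotvDr.
have FF : Filter (nbhs x) by exact: nbhs_filter.
have : \forall y \near x, forall i, `|ifs_map A d x i 0 - ifs_map A d y i 0| < e.
  exact: (filter_forall FF near_i).
apply: filterS => y Hy; apply: eS; split=> // i j; rewrite (ord1 j).
exact: Hy.
Qed.

Lemma measurable_ifs_map d : measurable_fun setT (ifs_map A d : Rn R n -> Rn R n).
Proof.
apply: (@measurability _ _ (Rn R n) (Rn R n) _ _ (@open 'cV[R]_n)) => //.
move=> _ [U oU <-]; rewrite setTI.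
apply: sub_sigma_algebra.
have /continuousP cf := @continuous_ifs_map d.
exact: cf.
Qed.

Let ndigits := #|` D|.
Let c : {nonneg R} := (ndigits%:R^-1)%:nng.
Let digit (k : nat) : 'cV[R]_n := nth 0 (enum_fset D) k.

Let c_sum : c%:num * ndigits%:R = 1.
Proof. by rewrite /= mulVf// pnatr_eq0 -lt0n. Qed.

(** Self-affinity expresses [mu] as an average of its images under the maps of
    the iterated function system. *)
Lemma ge0_integral_self_affine (f : Rn R n -> R) : measurable_fun setT f ->
  (forall x, 0 <= f x) ->
  (\int[mu]_x (f x)%:E =
   c%:num%:E * \sum_(k < ndigits) \int[mu]_x (f (ifs_map A (digit k) x))%:E)%E.
Proof.
move=> mf f0.
pose phi k : Rn R n -> Rn R n := ifs_map A (digit k).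
have mphi k : measurable_fun setT (phi k) by exact: measurable_ifs_map.
pose m k : {measure set (Rn R n) -> \bar R} :=
  measure_function_pushforward__canonical__measure_function_Measure mu (mphi k).
have mf' : measurable_fun setT (EFin \o f) by exact/measurable_EFinP.
rewrite (eq_measure_integral (mscale c (msum m ndigits))) => [|B mB _]; last first.
  apply: (etrans (mu_affine mB)); rewrite /mscale /= /msum; congr (_ * _)%E.
  rewrite (big_nth 0) big_mkord; apply: eq_bigr => k _.
  by [].
rewrite ge0_integral_mscale//; last by move=> x _; rewrite lee_fin.
congr (_ * _)%E; rewrite ge0_integral_measure_sum//; last first.
  by move=> x _; rewrite lee_fin.
apply: eq_bigr => k _; rewrite ge0_integral_pushforward//.
by move=> x _; rewrite lee_fin.
Qed.

Lemma Rintegral_self_affine (f : Rn R n -> R) : measurable_fun setT f ->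
  (forall x, `|f x| <= 1) ->
  ((\int[mu]_x f x) =
   c%:num * \sum_(k < ndigits) \int[mu]_x f (ifs_map A (digit k) x))%R.
Proof.
move=> mf f1.
have mphi k : measurable_fun setT (ifs_map A (digit k) : Rn R n -> Rn R n).
  exact: measurable_ifs_map.
have mfk k : measurable_fun setT (fun x : Rn R n => f (ifs_map A (digit k) x)).
  exact: (measurableT_comp mf (mphi k)).
have int1 (g : Rn R n -> R) : measurable_fun setT g -> (forall x, `|g x| <= 1) ->
    (\int[mu]_x (1 + g x)%R%:E = (1 + (\int[mu]_x g x)%R)%R%:E)%E.
  move=> mg g1; have gi := integrable_bounded1 mu mg g1.
  have i1 : mu.-integrable setT (EFin \o (fun=> 1)).
    exact: finite_measure_integrable_cst.
  have fi : (\int[mu]_x (1 + g x)%:E)%E \is a fin_num.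
    exact: (integrable_fin_num _ (integrableD measurableT i1 gi)).
  rewrite -(fineK fi) -/(Rintegral _ _ _) RintegralD// Rintegral_cst// mul1r.
  by rewrite [X in fine X](_ : _ = 1%E)//; exact: probability_setT.
(* Adding 1 makes the integrand nonnegative. *)
have := @ge0_integral_self_affine (fun x => 1 + f x).
rewrite int1// => E.
have {}E : (1 + (\int[mu]_x f x)%R)%:E = (c%:num * \sum_(k < ndigits)
    (1 + (\int[mu]_x f (ifs_map A (digit k) x))%R))%:E.
  rewrite E; last 2 first.
  - by apply: measurable_funD => //; exact: measurable_cst.
  - by move=> x; have := f1 x; rewrite ler_norml => /andP[]; lra.
  by rewrite EFinM -sumEFin; congr (_ * _)%E; apply: eq_bigr => k _; rewrite int1.
have {E} : 1 + (\int[mu]_x f x)%R = c%:num * \sum_(k < ndigits)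
    (1 + (\int[mu]_x f (ifs_map A (digit k) x))%R) by case: E.
rewrite big_split /= sumr_const card_ord mulrDr.
have -> : ndigits%:R^-1 * ndigits%:R = 1 :> R by exact: c_sum.
exact: addrI.
Qed.

(** The Fourier transform of the uniform distribution on the digits. *)
Definition mask (l : 'cV[R]_n) : R[i] :=
  (ndigits%:R^-1)%:C%C * \sum_(k < ndigits) expchar l (digit k).

Lemma fourier_self_affine l : fourier mu (A^T *m l) = mask l * fourier mu l.
Proof.
have E k x : 2 * pi * dotv (A^T *m l) (ifs_map A (digit k) x) =
    2 * pi * dotv l x + 2 * pi * dotv l (digit k).
  by rewrite dotv_mul /ifs_map mulmxA mulmxV// mul1mx dotvDr mulrDr.
have Ec : cos_int mu (A^T *m l) = c%:num * \sum_(k < ndigits)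
    (cos (2 * pi * dotv l (digit k)) * cos_int mu l -
     sin (2 * pi * dotv l (digit k)) * sin_int mu l).
  rewrite /cos_int Rintegral_self_affine; [|exact: measurable_cos_dotv|]; last first.
    by move=> x; rewrite ler_norml cos_geN1 cos_le1.
  congr (_ * _); apply: eq_bigr => k _.
  rewrite -!RintegralZl//; [|exact: integrable_sin_dotv|exact: integrable_cos_dotv].
  rewrite -RintegralB//; last 2 first.
  - exact: (integrableZl measurableT _ (integrable_cos_dotv mu l)).
  - exact: (integrableZl measurableT _ (integrable_sin_dotv mu l)).
  by apply: eq_Rintegral => x _; rewrite E cosD; ring.
have Es : sin_int mu (A^T *m l) = c%:num * \sum_(k < ndigits)
    (cos (2 * pi * dotv l (digit k)) * sin_int mu l +
     sin (2 * pi * dotv l (digit k)) * cos_int mu l).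
  rewrite /sin_int Rintegral_self_affine; [|exact: measurable_sin_dotv|]; last first.
    by move=> x; rewrite ler_norml sin_geN1 sin_le1.
  congr (_ * _); apply: eq_bigr => k _.
  rewrite -!RintegralZl//; [|exact: integrable_cos_dotv|exact: integrable_sin_dotv].
  rewrite -RintegralD//; last 2 first.
  - exact: (integrableZl measurableT _ (integrable_sin_dotv mu l)).
  - exact: (integrableZl measurableT _ (integrable_cos_dotv mu l)).
  by apply: eq_Rintegral => x _; rewrite E sinD; ring.
rewrite {1}/fourier Ec Es /mask /=.
have -> : \sum_(k < ndigits) expchar l (digit k) =
  Complex (\sum_(k < ndigits) cos (2 * pi * dotv l (digit k)))
          (\sum_(k < ndigits) sin (2 * pi * dotv l (digit k))).
  apply/eqP; rewrite eq_complex !raddf_sum /=.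
  by apply/andP; split; apply/eqP; apply: eq_bigr.
rewrite sumrB big_split /= -!mulr_suml; apply/eqP; rewrite eq_complex /fourier /=.
by apply/andP; split; apply/eqP; ring.
Qed.

Lemma power_self_affine l :
  power mu (A^T *m l) = sqmod (mask l) * power mu l.
Proof. by rewrite /power fourier_self_affine sqmodM. Qed.

(** The maps of the system send [x] to a point of norm at most
    [rho * (N x + delta)], so the tail [t < N] has at most the mass of the tail
    [t / rho - delta < N].  Above the fixed point [t0] of
    [t |-> t / rho - delta] the iterated thresholds tend to infinity, where the
    tails have no mass. *)
Lemma bounded_support (N : 'cV[R]_n -> R) (rho : R) : 0 < rho < 1 ->
  measurable_fun setT (N : Rn R n -> R) ->
  (forall x y, N (x + y) <= N x + N y) -> (forall x, 0 <= N x) ->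
  (forall x, N (invmx A *m x) <= rho * N x) ->
  exists K : R, mu [set x | K < N x] = 0%E.
Proof.
move=> /andP[rho0 rho1] mN ND N0 Nrho.
pose delta := \sum_(d <- D) N d.
have dD d : d \in D -> N d <= delta.
  move=> dD; rewrite /delta (big_fsetD1 d)//= lerDl sumr_ge0//.
have d0 : 0 <= delta by rewrite sumr_ge0.
pose S t : set (Rn R n) := [set x | t < N x].
have mS t : measurable (S t).
  rewrite -[X in measurable X]setTI.
  have := @measurable_fun_ltr _ (Rn R n) R setT (fun=> t) N.
  by move=> /(_ _ mN measurableT [set true]); exact.
have step t : (mu (S t) <= mu (S (t / rho - delta)%R))%E.
  rewrite (mu_affine (mS t)).
  apply: (@le_trans _ _ ((ndigits%:R^-1)%:E *
      \sum_(d <- D) mu (S (t / rho - delta)%R))%E).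
    rewrite lee_wpmul2l ?lee_fin//; rewrite big_seq [leRHS]big_seq.
    apply: lee_sum => d dDd; apply: le_measure; rewrite ?inE//.
      rewrite -[X in measurable X]setTI.
      exact: (measurable_ifs_map d measurableT (mS t)).
    move=> x; rewrite /S /= => tx.
    have := Nrho (x + d); have := ND x d; have := dD d dDd.
    rewrite -/(ifs_map A d x) => h1 h2 h3.
    suff : t / rho < N x + delta by lra.
    by rewrite ltr_pdivrMr// mulrC; nra.
  rewrite big_const_seq count_predT -/ndigits.
  have -> : iter ndigits (adde (mu (S (t / rho - delta)))) 0%E =
      (ndigits%:R%:E * mu (S (t / rho - delta)%R))%E.
    elim: ndigits => [|k /= ->]; first by rewrite mul0e.
    by rewrite -[in RHS]addn1 addnC natrD EFinD ge0_muleDl ?mul1e// lee_fin.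
  by rewrite muleA -EFinM mulVf ?mul1e// pnatr_eq0 -lt0n.
pose t0 := rho * delta / (1 - rho).
exists (t0 + 1).
have iter k : (mu (S (t0 + 1)%R) <= mu (S (t0 + (rho^-1) ^+ k)%R))%E.
  elim: k => [|k ih]; first by rewrite expr0.
  apply: le_trans ih _; apply: le_trans (step _) _.
  have -> : (t0 + rho^-1 ^+ k) / rho - delta = t0 + rho^-1 ^+ k.+1; last by [].
  by rewrite exprSr /t0; field; apply/andP; split; rewrite gt_eqF//; lra.
apply/eqP; rewrite eq_le measure_ge0 andbT.
have cap : \bigcap_k S (t0 + rho^-1 ^+ k) = set0.
  rewrite -subset0 => x Sx.
  have r1 : 1 < rho^-1 by rewrite invf_gt1.
  have B0 : 0 < N x - t0.
    by have := Sx 0%N I; rewrite /S /= expr0 => ?; lra.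
  have /cvgr0Pnorm_lt /(_ (N x - t0)^-1) : (fun k => rho ^+ k) @ \oo --> (0 : R).
    by apply: cvg_expr; rewrite gtr0_norm.
  rewrite invr_gt0 => /(_ B0) [k _ /(_ k (leqnn k))] /=.
  rewrite gtr0_norm ?exprn_gt0// -[X in X < _]invrK ltf_pV2 ?posrE ?invr_gt0 ?exprn_gt0//.
  by have := Sx k I; rewrite /S /= -exprVn => ? ?; lra.
have cv : (fun k => mu (S (t0 + rho^-1 ^+ k))) @ \oo --> 0%E.
  rewrite -(measure0 mu) -cap; apply: nonincreasing_cvg_mu => //.
  - by apply: (@le_lt_trans _ _ 1%E); [exact: probability_le1 | rewrite ltry].
  - by rewrite cap.
  - move=> m k mk; apply/subsetPset => x; rewrite /S /=; apply: le_lt_trans.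
    by rewrite lerD2l ler_weXn2l// invf_ge1// ltW.
rewrite -(cvg_lim _ cv)//.
by apply: lime_ge; [exact: cvgP cv | exact: nearW].
Qed.

End SelfAffine.

(** * The squared mask and parity of fractions with odd denominator *)

Section MaskModulus.
Variable R : realType.
Implicit Types (x y : R) (m : int).

(** The squared modulus of [(1 + e(x) + e(y) + e(-x-y)) / 4] with
    [e(x) = exp (2 pi i x)], see [cube_mask_sqmod], in the form that displays
    its zeros and its half-shifts. *)
Definition cube_mask x y : R :=
  (cos (pi * (x + y)) * cos (pi * x) * cos (pi * y)) ^+ 2 +
  (sin (pi * (x + y)) * sin (pi * x) * sin (pi * y)) ^+ 2.

Lemma sin_pi_int m : sin (pi * m%:~R) = 0 :> R.
Proof.
have nat_case (k : nat) : sin (pi * k%:R) = 0 :> R.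
  elim: k => [|k ih]; first by rewrite mulr0 sin0.
  by rewrite -natr1 mulrDr mulr1 sinD ih sinpi mul0r mulr0 addr0.
case: m => k; first exact: nat_case.
by rewrite NegzE mulrNz mulrN sinN nat_case oppr0.
Qed.

Lemma cos_pi_int_sqr m : cos (pi * m%:~R) ^+ 2 = 1 :> R.
Proof. by have := cos2Dsin2 (pi * m%:~R : R); rewrite sin_pi_int expr0n addr0. Qed.

Lemma cos_sqr_periodic x m : cos (pi * (x + m%:~R)) ^+ 2 = cos (pi * x) ^+ 2.
Proof.
by rewrite mulrDr cosD sin_pi_int mulr0 subr0 exprMn cos_pi_int_sqr mulr1.
Qed.

Lemma sin_sqr_periodic x m : sin (pi * (x + m%:~R)) ^+ 2 = sin (pi * x) ^+ 2.
Proof.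
by rewrite mulrDr sinD sin_pi_int mulr0 addr0 exprMn cos_pi_int_sqr mulr1.
Qed.

Lemma cube_mask_ge0 x y : 0 <= cube_mask x y.
Proof. by rewrite addr_ge0 ?sqr_ge0. Qed.

Lemma cube_mask_periodic x y u v : u \is a Num.int -> v \is a Num.int ->
  cube_mask (x + u) (y + v) = cube_mask x y.
Proof.
move=> /intrP[m ->] /intrP[k ->]; rewrite /cube_mask !exprMn addrACA -intrD.
by rewrite !cos_sqr_periodic !sin_sqr_periodic.
Qed.

Lemma cos_sqr_half x : cos (pi * (x + 2^-1)) ^+ 2 = sin (pi * x) ^+ 2.
Proof. by rewrite mulrDr cosD cos_pihalf sin_pihalf mulr0 mulr1 sub0r sqrrN. Qed.

Lemma sin_sqr_half x : sin (pi * (x + 2^-1)) ^+ 2 = cos (pi * x) ^+ 2.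
Proof. by rewrite mulrDr sinD cos_pihalf sin_pihalf mulr0 mulr1 add0r. Qed.

(** A shift by 1/2 exchanges the squared sine and cosine of its variable and of
    [x + y].  The eight terms are those of the product of
    [cos ^+ 2 + sin ^+ 2] for [x], [y] and [x + y]. *)
Lemma cube_mask_sum x y : cube_mask x y + cube_mask (x + 2^-1) y +
  cube_mask x (y + 2^-1) + cube_mask (x + 2^-1) (y + 2^-1) = 1.
Proof.
rewrite /cube_mask !exprMn (addrAC x 2^-1 y) (addrA x y 2^-1).
have -> : x + 2^-1 + (y + 2^-1) = x + y + 1%:~R by field.
rewrite !cos_sqr_half !sin_sqr_half cos_sqr_periodic sin_sqr_periodic.
have := cos2Dsin2 (pi * x); have := cos2Dsin2 (pi * y).
have := cos2Dsin2 (pi * (x + y)).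
move: (cos _ ^+ 2) (sin _ ^+ 2) (cos _ ^+ 2) (sin _ ^+ 2) (cos _ ^+ 2) (sin _ ^+ 2).
move=> C S cy sy cx sx h1 h2 h3.
transitivity ((C + S) * (cx + sx) * (cy + sy)); first by ring.
by rewrite h1 h2 h3 !mulr1.
Qed.

Lemma sin_pi_eq0 x : sin (pi * x) = 0 -> x \is a Num.int.
Proof.
move=> s0; pose k := Num.floor x; pose r := x - k%:~R.
have r0 : 0 <= r by rewrite subr_ge0 floor_le.
have r1 : r < 1 by rewrite ltrBlDl; have := floorD1_gt x; rewrite intrD.
have sr : sin (pi * r) ^+ 2 = 0.
  by rewrite /r -mulrNz sin_sqr_periodic s0 expr0n.
have [rp|] := ltP 0 r; last first.
  move=> r0'; have : r = 0 by lra.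
  by move=> /eqP; rewrite subr_eq0 => /eqP ->; exact: intr_int.
have : 0 < sin (pi * r).
  by apply: sin_gt0_pi; rewrite mulr_gt0 ?pi_gt0//= gtr_pMr ?pi_gt0.
by move=> /lt0r_neq0; rewrite -sqrf_eq0 sr eqxx.
Qed.

Lemma cos_pi_eq0 x : cos (pi * x) = 0 -> x + 2^-1 \is a Num.int.
Proof.
move=> c0; apply: sin_pi_eq0; apply/eqP.
by rewrite -sqrf_eq0 sin_sqr_half c0 expr0n.
Qed.

Lemma int_half_int x : x + 2^-1 \is a Num.int -> 2 * x \is a Num.int.
Proof.
move=> xi; have -> : 2 * x = 2 * (x + 2^-1) - 1 by field.
by rewrite rpredB ?rpred1// rpredM ?rpred_nat.
Qed.

Lemma half_notin_int : (2^-1 : R) \is a Num.int = false.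
Proof.
apply/negbTE/negP => /intrP[m hm].
have : (2 * m)%:~R = 1%:~R :> R by rewrite intrM -hm mulfV ?pnatr_eq0.
by move=> /intr_inj; lia.
Qed.

Lemma half_int_dichotomy (u : R) : 2 * u \is a Num.int ->
  u \is a Num.int \/ exists2 m, m \is a Num.int & u = 2^-1 + m.
Proof.
move=> /intrP[m hm]; have [/dvdzP[k mk]|om'] := boolP (2 %| m)%Z.
  left; have -> : u = k%:~R; last exact: intr_int.
  apply: (@mulfI _ 2); first by rewrite pnatr_eq0.
  by rewrite hm mk intrM mulrC.
right; have /dvdzP[k mk] : (2 %| m - 1)%Z by lia.
exists k%:~R; first exact: intr_int.
apply: (@mulfI _ 2); first by rewrite pnatr_eq0.
by rewrite hm (_ : m = k * 2 + 1) ?intrD ?intrM; [field | lia].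
Qed.

(** Both products vanish: one of [x], [y], [x + y] is an integer and another one
    differs from an integer by 1/2, which fixes all three modulo 1/2. *)
Lemma cube_mask_eq0 x y : cube_mask x y = 0 ->
  [/\ 2 * x \is a Num.int, 2 * y \is a Num.int &
      ~~ ((x \is a Num.int) && (y \is a Num.int))].
Proof.
move=> xy0; have cube00 : cube_mask 0 0 = 1 :> R.
  by rewrite /cube_mask addr0 mulr0 cos0 sin0 !mul1r mulr0 expr0n expr1n addr0.
have notint : ~~ ((x \is a Num.int) && (y \is a Num.int)).
  apply/negP => /andP[xi yi]; have := cube_mask_periodic 0 0 xi yi.
  by rewrite !add0r cube00 xy0 => /eqP; rewrite eq_sym oner_eq0.
move: xy0 => /eqP; rewrite /cube_mask paddr_eq0 ?sqr_ge0// !sqrf_eq0 !mulf_eq0.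
have two (u : R) : u \is a Num.int -> 2 * u \is a Num.int.
  by move=> ui; rewrite rpredM ?rpred_nat.
have half (u v : R) : u + v \is a Num.int -> u \is a Num.int -> v \is a Num.int.
  by move=> uv ui; rewrite -(addKr u v) addrC rpredB.
have sum2 (u v : R) : u + v + 2^-1 \is a Num.int -> u \is a Num.int -> 2 * v \is a Num.int.
  by move=> uv ui; apply: int_half_int; apply: (half u) => //; rewrite addrA.
have half2 (u v : R) : u + v \is a Num.int -> 2 * u \is a Num.int -> 2 * v \is a Num.int.
  by move=> uv ui; apply: (half (2 * u)) => //; rewrite -mulrDr; exact: two.
have absurd (u : R) : u + 2^-1 \is a Num.int -> u \is a Num.int -> False.
  by move=> u2 ui; have := half u 2^-1 u2 ui; rewrite half_notin_int.
move=> /andP[/orP[/orP[]|] /eqP/cos_pi_eq0 h /orP[/orP[]|] /eqP/sin_pi_eq0 k].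
- by case: (absurd (x + y)).
- by split=> //; [exact: two | exact: (sum2 x)].
- by split=> //; [apply: (sum2 y) => //; rewrite (addrC y) | exact: two].
- by have x2 := int_half_int h; split=> //; exact: (half2 x).
- by case: (absurd x).
- by split=> //; [exact: int_half_int | exact: two].
- by have y2 := int_half_int h; split=> //; apply: (half2 y) => //; rewrite addrC.
- by split=> //; [exact: two | exact: int_half_int].
- by case: (absurd y).
Qed.

Lemma cube_mask_sqmod x y : cube_mask x y = sqmod (4^-1%:C%C *
  (1 + Complex (cos (2 * pi * x)) (sin (2 * pi * x)) +
   Complex (cos (2 * pi * y)) (sin (2 * pi * y)) +
   Complex (cos (2 * pi * (- x - y))) (sin (2 * pi * (- x - y))))).
Proof.
rewrite -opprD mulrN cosN sinN /sqmod /cube_mask /=.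
have dbl u : 2 * pi * u = pi * u + pi * u :> R by ring.
rewrite !dbl !mulrDr; set X := pi * x; set Y := pi * y.
rewrite !(cosD, sinD).
have := cos2Dsin2 X; have := cos2Dsin2 Y.
move: (cos X) (sin X) (cos Y) (sin Y) => cx sx cy sy hy hx.
have ex : sx ^+ 2 = 1 - cx ^+ 2 by rewrite -hx; ring.
have ey : sy ^+ 2 = 1 - cy ^+ 2 by rewrite -hy; ring.
set L := (X in _ = X).
have -> : L = ((4^-1 * (1 + (cx ^+ 2 - sx ^+ 2) + (cy ^+ 2 - sy ^+ 2) +
    ((cx * cy - sx * sy) ^+ 2 - (sx * cy + cx * sy) ^+ 2))) ^+ 2 +
   (4^-1 * (2 * sx * cx + 2 * sy * cy -
    2 * (sx * cy + cx * sy) * (cx * cy - sx * sy))) ^+ 2) by rewrite /L; ring.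
have quarter u v : 4 * u = v -> u = 4^-1 * v :> R by move=> <-; field.
congr (_ ^+ 2 + _ ^+ 2); apply: quarter.
  rewrite (_ : (cx * cy - sx * sy) ^+ 2 - (sx * cy + cx * sy) ^+ 2 =
    cx ^+ 2 * cy ^+ 2 + sx ^+ 2 * sy ^+ 2 - sx ^+ 2 * cy ^+ 2 - cx ^+ 2 * sy ^+ 2
    - 4 * (cx * cy * sx * sy)); last by ring.
  by rewrite ex ey; ring.
rewrite (_ : 2 * (sx * cy + cx * sy) * (cx * cy - sx * sy) =
   2 * (sx * cx * (cy ^+ 2 - sy ^+ 2) + sy * cy * (cx ^+ 2 - sx ^+ 2))); last by ring.
rewrite (_ : 4 * _ = 4 * (sx ^+ 2 * (sy * cy) + sy ^+ 2 * (sx * cx))); last by ring.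
by rewrite ex ey; ring.
Qed.

End MaskModulus.

Section OddDenominators.
Variable R : realType.
Implicit Types (x y : R) (m : int).

(** The ring Z_(2) of fractions with odd denominator, inside [R]. *)
Definition odd_denom x := exists2 n : nat, odd n & n%:R * x \is a Num.int.

Lemma odd_denom_int x : x \is a Num.int -> odd_denom x.
Proof. by exists 1%N => //; rewrite mul1r. Qed.

Lemma odd_denomD x y : odd_denom x -> odd_denom y -> odd_denom (x + y).
Proof.
move=> [n on nx] [k ok ky]; exists (n * k)%N; first by rewrite oddM on.
rewrite mulrDr natrM {1}(mulrC n%:R) -!mulrA.
by rewrite rpredD// rpredM ?rpred_nat.
Qed.

Lemma odd_denomM x y : odd_denom x -> odd_denom y -> odd_denom (x * y).
Proof.
move=> [n on nx] [k ok ky]; exists (n * k)%N; first by rewrite oddM on.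
by rewrite natrM mulrACA rpredM.
Qed.

Lemma odd_denomN x : odd_denom x -> odd_denom (- x).
Proof. by move=> [n on nx]; exists n => //; rewrite mulrN rpredN. Qed.

Lemma odd_denomB x y : odd_denom x -> odd_denom y -> odd_denom (x - y).
Proof. by move=> xo yo; apply: odd_denomD => //; exact: odd_denomN. Qed.

Lemma odd_denom_half : ~ odd_denom 2^-1.
Proof.
move=> [n on /intrP[m hm]].
have : (2 * m)%:~R = n%:Z%:~R :> R by rewrite intrM -hm -pmulrn mulrCA mulfV ?mulr1 ?pnatr_eq0.
by move=> /intr_inj; lia.
Qed.

Lemma odd_denom_divn x (n : nat) : odd n -> odd_denom (n%:R * x) -> odd_denom x.
Proof.
move=> on [k ok kx]; exists (k * n)%N; first by rewrite oddM ok.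
by rewrite natrM -mulrA.
Qed.

(** [x] is congruent to 0 resp. 1 modulo 2 in the ring Z_(2). *)
Definition even2 x := odd_denom (x / 2).
Definition odd2 x := odd_denom ((x - 1) / 2).

Lemma odd_denom_parity x : odd_denom x -> even2 x \/ odd2 x.
Proof.
move=> [n on /intrP[m nx]]; have [em|om] : (2 %| m)%Z \/ (2 %| m - n%:Z)%Z by lia.
  left; exists n => //; case/dvdzP: em => k mk.
  by rewrite mulrA nx mk intrM mulfK ?pnatr_eq0.
right; exists n => //; case/dvdzP: om => k mk.
by rewrite mulrA mulrBr nx mulr1 -[n%:R]/(n%:Z%:~R) -intrB mk intrM mulfK ?pnatr_eq0.
Qed.

Lemma even2_odd2 x : even2 x -> odd2 x -> False.
Proof.
move=> ex ox; apply: odd_denom_half.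
have -> : 2^-1 = x / 2 - (x - 1) / 2 by field.
exact: odd_denomB.
Qed.

Lemma even2_denom x : even2 x -> odd_denom x.
Proof.
move=> ex; have -> : x = x / 2 * 2 by field.
by apply: odd_denomM => //; apply: odd_denom_int; rewrite rpred_nat.
Qed.

Lemma odd2_denom x : odd2 x -> odd_denom x.
Proof.
move=> ox; have -> : x = (x - 1) / 2 * 2 + 1 by field.
apply: odd_denomD; last by apply: odd_denom_int; rewrite rpred1.
by apply: odd_denomM => //; apply: odd_denom_int; rewrite rpred_nat.
Qed.

Lemma even2D x y : even2 x -> even2 y -> even2 (x + y).
Proof. by rewrite /even2 mulrDl; exact: odd_denomD. Qed.

Lemma even2N x : even2 x -> even2 (- x).
Proof. by rewrite /even2 mulNr; exact: odd_denomN. Qed.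

Lemma even2Ml x y : even2 x -> odd_denom y -> even2 (x * y).
Proof. by rewrite /even2 mulrAC; exact: odd_denomM. Qed.

Lemma even2Mr x y : odd_denom x -> even2 y -> even2 (x * y).
Proof. by rewrite /even2 -mulrA; exact: odd_denomM. Qed.

Lemma odd2Dl x y : odd2 x -> even2 y -> odd2 (x + y).
Proof.
rewrite /odd2 /even2 => hx hy.
by have -> : (x + y - 1) / 2 = (x - 1) / 2 + y / 2 by [field]; exact: odd_denomD.
Qed.

Lemma odd2Dr x y : even2 x -> odd2 y -> odd2 (x + y).
Proof. by rewrite addrC => ? ?; exact: odd2Dl. Qed.

Lemma even2_addoo x y : odd2 x -> odd2 y -> even2 (x + y).
Proof.
rewrite /odd2 /even2 => hx hy.
have -> : (x + y) / 2 = (x - 1) / 2 + (y - 1) / 2 + 1 by field.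
by apply: odd_denomD; [exact: odd_denomD | apply: odd_denom_int; rewrite rpred1].
Qed.

Lemma odd2N x : odd2 x -> odd2 (- x).
Proof.
rewrite /odd2 => hx; have -> : (- x - 1) / 2 = - ((x - 1) / 2) - 1 by field.
by apply: odd_denomB; [exact: odd_denomN | apply: odd_denom_int; rewrite rpred1].
Qed.

Lemma odd2M x y : odd2 x -> odd2 y -> odd2 (x * y).
Proof.
move=> hx hy; rewrite /odd2.
have -> : (x * y - 1) / 2 = (x - 1) / 2 * y + (y - 1) / 2 by field.
by apply: odd_denomD => //; apply: odd_denomM => //; exact: odd2_denom.
Qed.

Lemma even2_int m : (2 %| m)%Z -> even2 m%:~R.
Proof.
case/dvdzP=> k ->; rewrite /even2 intrM mulfK ?pnatr_eq0//.
by apply: odd_denom_int.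
Qed.

Lemma odd2_int m : ~~ (2 %| m)%Z -> odd2 m%:~R.
Proof.
move=> om; have /dvdzP[k mk] : (2 %| m - 1)%Z by lia.
rewrite /odd2 (_ : m%:~R - 1 = (m - 1)%:~R); last by rewrite intrB.
by rewrite mk intrM mulfK ?pnatr_eq0//; apply: odd_denom_int.
Qed.

End OddDenominators.

(** * Mask systems *)

Lemma eq_pair (T U : Type) (x y : T * U) : x.1 = y.1 -> x.2 = y.2 -> x = y.
Proof. by case: x y => ? ? [? ?] /= -> ->. Qed.

Section PlaneMap.
Variables (R : realType) (a b c d : R).
Implicit Types x y : R * R.

Definition plane_map x : R * R := (a * x.1 + c * x.2, b * x.1 + d * x.2).

Lemma plane_mapD x y : plane_map (x + y) = plane_map x + plane_map y.
Proof. by apply: eq_pair => /=; ring. Qed.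

Lemma plane_mapN x : plane_map (- x) = - plane_map x.
Proof. by apply: eq_pair => /=; ring. Qed.

Lemma plane_mapB x y : plane_map (x - y) = plane_map x - plane_map y.
Proof. by rewrite plane_mapD plane_mapN. Qed.

Lemma plane_map0 : plane_map 0 = 0.
Proof. by apply: eq_pair => /=; ring. Qed.

End PlaneMap.

Section PlaneIter.
Variables (R : realType) (f : R * R -> R * R).
Hypothesis fD : forall x y, f (x + y) = f x + f y.
Hypothesis fN : forall x, f (- x) = - f x.
Implicit Types x y : R * R.

Lemma iter_plane_mapD n x y : iter n f (x + y) = iter n f x + iter n f y.
Proof. by elim: n => [//|n /= ->]; rewrite fD. Qed.

Lemma iter_plane_mapN n x : iter n f (- x) = - iter n f x.
Proof. by elim: n => [//|n /= ->]; rewrite fN. Qed.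

End PlaneIter.

(** What both implications use of the function [Phi z = power mu (frequency z)]:
    the functional equation under the transposed matrix, continuity and the
    Bessel inequality.  By [ms_norm] the inverse matrix is a contraction. *)
Record mask_system (R : realType) (al om be : int) (a b c d : R)
    (Phi : R * R -> R) : Prop := MaskSystem {
  ms_det : a * d - b * c != 0;
  ms_mask : forall z, Phi (plane_map a b c d z) =
    cube_mask (al%:~R * z.1) (om%:~R * z.1 + be%:~R * z.2) * Phi z;
  ms_0 : Phi 0 = 1;
  ms_ge0 : forall z, 0 <= Phi z;
  ms_N : forall z, Phi (- z) = Phi z;
  ms_lip : exists2 C : R, 0 <= C & forall x h : R * R,
    `|Phi (x + h) - Phi x| <= C * (`|h.1| + `|h.2|);
  ms_bessel : forall (F : seq (R * R)) k, uniq F ->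
    orthogonal_set Phi [set` F] -> \sum_(l <- F) Phi (k - l) <= 1;
  ms_norm : exists (N : R * R -> R) (rho C : R), [/\ 0 < rho < 1, 0 <= C,
    forall u v, N (u + v) <= N u + N v,
    forall u, `|u.1| <= N u /\ `|u.2| <= N u /\ N u <= C * (`|u.1| + `|u.2|) &
    forall u, N u <= rho * N (plane_map a b c d u)];
  ms_al : ~~ (2 %| al)%Z;
  ms_be : ~~ (2 %| be)%Z
}.

Section Common.
Variables (R : realType) (al om be : int) (a b c d : R) (Phi : R * R -> R).
Hypothesis sys : mask_system al om be a b c d Phi.
Implicit Types x y z u v l : R * R.

Notation A := (plane_map a b c d).
Let delta := a * d - b * c.
Definition plane_inv := plane_map (d / delta) (- b / delta) (- c / delta) (a / delta).
Notation B := plane_inv.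
Definition coords z : R * R := (al%:~R * z.1, om%:~R * z.1 + be%:~R * z.2).
Definition weight z := cube_mask (coords z).1 (coords z).2.

Let delta0 : delta != 0. Proof. exact: ms_det sys. Qed.

Lemma plane_mapK : cancel A B.
Proof. by move=> z; apply: eq_pair; rewrite /= /delta; field; exact: delta0. Qed.

Lemma plane_invK : cancel B A.
Proof. by move=> z; apply: eq_pair; rewrite /= /delta; field; exact: delta0. Qed.

Lemma iter_plane_mapK n : cancel (iter n A) (iter n B).
Proof. by elim: n => [//|n ih] z; rewrite iterSr /= plane_mapK ih. Qed.

Lemma iter_plane_invK n : cancel (iter n B) (iter n A).
Proof. by elim: n => [//|n ih] z; rewrite iterSr /= plane_invK ih. Qed.

Lemma phi_map z : Phi (A z) = weight z * Phi z.
Proof. exact: ms_mask sys z. Qed.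

Lemma phi_inv z : Phi z = weight (B z) * Phi (B z).
Proof. by rewrite -phi_map plane_invK. Qed.

Lemma cube_mask_le1 (x y : R) : cube_mask x y <= 1.
Proof.
have := cube_mask_sum x y; have := cube_mask_ge0 (x + 2^-1) y.
have := cube_mask_ge0 x (y + 2^-1); have := cube_mask_ge0 (x + 2^-1) (y + 2^-1).
lra.
Qed.

Lemma weight_ge0 z : 0 <= weight z. Proof. exact: cube_mask_ge0. Qed.
Lemma weight_le1 z : weight z <= 1. Proof. exact: cube_mask_le1. Qed.

Lemma phi_le_inv z : Phi z <= Phi (B z).
Proof. by rewrite {1}phi_inv ler_piMl ?(ms_ge0 sys) ?weight_le1. Qed.

Lemma iter_inv_small z (e : R) : 0 < e ->
  exists n0, forall n, (n0 <= n)%N ->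
    `|(iter n B z).1| + `|(iter n B z).2| < e.
Proof.
move=> e0; have [N [rho [C [/andP[r0 r1] C0 ND Nb Nr]]]] := ms_norm sys.
have N0 : 0 <= N z by have [h _] := Nb z; exact: le_trans h.
have bnd n : N (iter n B z) <= rho ^+ n * N z.
  elim: n => [|n ih]; first by rewrite expr0 mul1r.
  apply: le_trans (Nr _) _; rewrite [iter n.+1 B z]/= plane_invK exprS -mulrA.
  by rewrite ler_wpM2l// ltW.
have M0 : 0 < e / (2 * N z + 1) by rewrite divr_gt0//; lra.
have /cvgr0Pnorm_lt /(_ _ M0) [n0 _ hn] : (fun k => rho ^+ k) @ \oo --> (0 : R).
  by apply: cvg_expr; rewrite gtr0_norm.
exists n0 => n nn; have := hn n nn; rewrite /= gtr0_norm ?exprn_gt0// => rn.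
have [h1 [h2 _]] := Nb (iter n B z).
apply: (@le_lt_trans _ _ (rho ^+ n * (2 * N z))); first by have := bnd n; lra.
apply: (@le_lt_trans _ _ (rho ^+ n * (2 * N z + 1))).
  by apply: ler_wpM2l; [rewrite exprn_ge0 ?ltW | lra].
by rewrite -ltr_pdivlMr//; lra.
Qed.

Lemma phi_near0 (e : R) : 0 < e -> exists2 r : R, 0 < r &
  forall x h, `|h.1| + `|h.2| < r -> `|Phi (x + h) - Phi x| < e.
Proof.
move=> e0; have [C C0 lip] := ms_lip sys.
exists (e / (C + 1)) => [|x h hr]; first by rewrite divr_gt0//; lra.
apply: le_lt_trans (lip x h) _.
apply: (@le_lt_trans _ _ ((C + 1) * (`|h.1| + `|h.2|))).
  by rewrite ler_wpM2r ?addr_ge0//; lra.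
by rewrite mulrC -ltr_pdivlMr//; lra.
Qed.

(** Backward orbits tend to 0, where [Phi] is 1. *)
Lemma phi_iter_inv_cvg z (e : R) : 0 < e ->
  exists n0, forall n, (n0 <= n)%N -> 1 - e < Phi (iter n B z).
Proof.
move=> e0; have [r r0 hr] := phi_near0 e0.
have [n0 hn] := iter_inv_small z r0; exists n0 => n /hn /(hr 0).
by rewrite add0r (ms_0 sys) ltr_norml => /andP[]; lra.
Qed.

(** [Phi z] is the product of the weights along the backward orbit of [z] times
    a value close to 1, so a zero of [Phi] is a zero of one of the weights. *)
Lemma phi_eq0 z : Phi z = 0 -> exists j, weight (iter j.+1 B z) = 0.
Proof.
move=> z0; apply: contrapT => /forallNP nz.
have all0 n : Phi (iter n B z) = 0.
  elim: n => [//|n ih]; have := phi_inv (iter n B z); rewrite ih => /esym/eqP.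
  by rewrite mulf_eq0 => /orP[/eqP h|/eqP//]; case: (nz n).
have [|n0 /(_ n0 (leqnn _))] := @phi_iter_inv_cvg z 2^-1; first by lra.
rewrite all0; lra.
Qed.

End Common.

(** * Even entries: lower bounds for the power along periods *)

Lemma odd_mulz (m n : int) : ~~ (2 %| m)%Z -> ~~ (2 %| n)%Z -> ~~ (2 %| m * n)%Z.
Proof. by rewrite !dvdzE abszM Euclid_dvdM// negb_or => -> ->. Qed.

Lemma odd_intr_neq0 (R : realType) (m : int) : ~~ (2 %| m)%Z -> m%:~R != 0 :> R.
Proof. by rewrite intr_eq0; apply: contra => /eqP ->. Qed.

Section Sufficiency.
Variables (R : realType) (al om be : int) (a b c d : R) (Phi : R * R -> R).
Hypothesis sys : mask_system al om be a b c d Phi.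
Hypothesis a_even : a / 2 \is a Num.int.
Hypothesis b_even : b / 2 \is a Num.int.
Hypothesis c_even : c / 2 \is a Num.int.
Hypothesis d_even : d / 2 \is a Num.int.
Implicit Types x y z u v l s : R * R.

Notation A := (plane_map a b c d).
Notation B := (plane_inv a b c d).
Notation coords := (coords al om be).
Notation weight := (weight al om be).

Definition lattice z := (z.1 \is a Num.int) && (z.2 \is a Num.int).
(** The common periods of [weight] and of its composites with the powers of the
    matrix. *)
Definition periods l := forall j, lattice (coords (iter j A l)).

Lemma latticeD x y : lattice x -> lattice y -> lattice (x + y).
Proof. by move=> /andP[? ?] /andP[? ?]; rewrite /lattice !rpredD. Qed.

Lemma latticeN x : lattice x -> lattice (- x).
Proof. by move=> /andP[? ?]; rewrite /lattice !rpredN; apply/andP. Qed.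

Lemma latticeB x y : lattice x -> lattice y -> lattice (x - y).
Proof. by move=> ? ?; apply: latticeD => //; exact: latticeN. Qed.

Lemma lattice0 : lattice 0.
Proof. by rewrite /lattice !rpred0. Qed.

Lemma coordsD x y : coords (x + y) = coords x + coords y.
Proof. by apply: eq_pair => /=; ring. Qed.

Lemma coordsN x : coords (- x) = - coords x.
Proof. by apply: eq_pair => /=; ring. Qed.

Lemma lattice_coords z : lattice z -> lattice (coords z).
Proof.
move=> /andP[z1 z2]; rewrite /lattice /=; apply/andP; split.
  by rewrite rpredM ?intr_int.
by rewrite rpredD// rpredM ?intr_int.
Qed.

Lemma lattice_map_half z : lattice (z + z) -> lattice (A z).
Proof.
move=> /andP[/= z1 z2]; rewrite /lattice /=.
have -> : a * z.1 + c * z.2 = a / 2 * (z.1 + z.1) + c / 2 * (z.2 + z.2) by field.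
have -> : b * z.1 + d * z.2 = b / 2 * (z.1 + z.1) + d / 2 * (z.2 + z.2) by field.
by rewrite !rpredD// rpredM.
Qed.

Lemma lattice_map z : lattice z -> lattice (A z).
Proof. by move=> zl; apply: lattice_map_half; exact: latticeD. Qed.

Lemma lattice_iter n z : lattice z -> lattice (iter n A z).
Proof. by move=> zl; elim: n => [//|n ih] /=; exact: lattice_map. Qed.

Lemma periods_lattice l : lattice l -> periods l.
Proof. by move=> ll j; apply: lattice_coords; exact: lattice_iter. Qed.

Lemma iterAD n x y : iter n A (x + y) = iter n A x + iter n A y.
Proof. exact: iter_plane_mapD (@plane_mapD _ a b c d) n x y. Qed.

Lemma iterAN n x : iter n A (- x) = - iter n A x.
Proof. exact: iter_plane_mapN (@plane_mapN _ a b c d) n x. Qed.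

Lemma iterBD n x y : iter n B (x + y) = iter n B x + iter n B y.
Proof. by apply: iter_plane_mapD; exact: plane_mapD. Qed.

Lemma iterBN n x : iter n B (- x) = - iter n B x.
Proof. by apply: iter_plane_mapN; exact: plane_mapN. Qed.

Lemma periodsD x y : periods x -> periods y -> periods (x + y).
Proof. by move=> px py j; rewrite iterAD coordsD; exact: latticeD. Qed.

Lemma periodsN x : periods x -> periods (- x).
Proof. by move=> px j; rewrite iterAN coordsN; exact: latticeN. Qed.

Lemma periods_iter n x : periods x -> periods (iter n A x).
Proof. by move=> px j; rewrite -iterD. Qed.

Lemma weight_periodic z l : periods l -> weight (z + l) = weight z.
Proof.
move=> /(_ 0%N) /andP[l1 l2]; rewrite /weight coordsD.
exact: cube_mask_periodic.
Qed.

Definition half_shifts : seq (R * R) :=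
  [:: (0, 0); (2^-1, 0); (0, 2^-1); (2^-1, 2^-1)].

Lemma half_shifts_uniq : uniq half_shifts.
Proof.
have h0 : (2^-1 == 0 :> R) = false by rewrite invr_eq0 pnatr_eq0.
by rewrite /= !inE !xpair_eqE ![0 == 2^-1]eq_sym !h0 !eqxx.
Qed.

Lemma half_shifts_double s : s \in half_shifts -> lattice (s + s).
Proof.
have hh : 2^-1 + 2^-1 = 1 :> R by field.
by rewrite !inE => /or4P[] /eqP ->; rewrite /lattice /= ?hh ?addr0 ?rpred0 ?rpred1.
Qed.

Lemma periods_map_shift s : s \in half_shifts -> periods (A s).
Proof.
by move=> /half_shifts_double ss; apply: periods_lattice; exact: lattice_map_half.
Qed.

(** As [al] and [be] are odd, the half-shifts of [z] realize, modulo integers,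
    the four half-shifts of the arguments of the mask. *)
Lemma weight_shift_sum z : \sum_(s <- half_shifts) weight (z + s) = 1.
Proof.
have halfE (m : int) : exists k : int,
    m%:~R / 2 = (~~ (2 %| m)%Z)%:R / 2 + k%:~R :> R.
  have [/dvdzP[k ->]|om'] := boolP (2 %| m)%Z.
    by exists k; rewrite intrM mulfK ?pnatr_eq0// mul0r add0r.
  have /dvdzP[k mk] : (2 %| m - 1)%Z by lia.
  by exists k; have -> : m = k * 2 + 1 by [lia]; rewrite intrD intrM /=; field.
have [k1 E1] := halfE al; have [k2 E2] := halfE be; have [k3 E3] := halfE om.
rewrite (ms_al sys) in E1; rewrite (ms_be sys) in E2.
set x := al%:~R * z.1; set y := om%:~R * z.1 + be%:~R * z.2.
have wE s (u v : R) (i j : int) : al%:~R * s.1 = u + i%:~R ->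
    om%:~R * s.1 + be%:~R * s.2 = v + j%:~R ->
    weight (z + s) = cube_mask (x + u) (y + v).
  move=> hu hv.
  rewrite -(cube_mask_periodic (x + u) (y + v) (intr_int R i) (intr_int R j)).
  by rewrite -!addrA -hu -hv /weight /= /x /y; congr cube_mask; ring.
rewrite /half_shifts !big_cons big_nil (wE (0, 0) 0 0 0 0) ?mulr0 ?addr0//.
rewrite (wE (0, 2^-1) 0 2^-1 0 k2) ?mulr0 ?addr0 ?add0r//; last by rewrite E2 mul1r.
move: E3; case: (2 %| om)%Z => /= E3; rewrite -[RHS](cube_mask_sum x y).
- rewrite (wE (2^-1, 0) 2^-1 0 k1 k3) /= ?E1 ?E3 ?mulr0 ?addr0 ?mul0r ?mul1r//.
  rewrite (wE (2^-1, 2^-1) 2^-1 2^-1 k1 (k3 + k2)) /= ?E1 ?E3 ?E2 ?mul1r//; first ring.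
  by rewrite intrD; ring.
- rewrite (wE (2^-1, 0) 2^-1 2^-1 k1 k3) /= ?E1 ?E3 ?mulr0 ?addr0 ?mul1r//.
  rewrite (wE (2^-1, 2^-1) 2^-1 0 k1 (k3 + k2 + 1)) /= ?E1 ?E3 ?E2 ?mul1r ?addr0//; first ring.
  by rewrite !intrD; field.
Qed.

Lemma weight_shift_sumN z : \sum_(s <- half_shifts) weight (z - s) = 1.
Proof.
rewrite -(weight_shift_sum z); apply: eq_big_seq => s /half_shifts_double ss.
have -> : z + s = z - s + (s + s) by rewrite addrA subrK.
by rewrite (@weight_periodic (z - s) (s + s))//; exact: periods_lattice.
Qed.

Let N : R := (al * be)%:~R.

Definition torsion z := lattice (N * z.1, N * z.2).

(** A zero is the image under some power [j.+1] of the matrix of a point at which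
    the mask has half-integral arguments.  Such a point has coordinates in
    [1 / (2 al be)] times the integers, and the first application of the matrix
    removes the factor 2. *)
Lemma phi0_torsion z : Phi z = 0 -> torsion z.
Proof.
move=> /(phi_eq0 sys)[j]; set y := iter j.+1 B z => /cube_mask_eq0[/= y1 y2 _].
have zE : z = iter j A (A y).
  by rewrite -iterSr /y (iter_plane_invK sys).
have tor : lattice (A (N * y.1, N * y.2)).
  apply: lattice_map_half; rewrite /lattice /= /N intrM.
  have -> : al%:~R * be%:~R * y.1 + al%:~R * be%:~R * y.1 =
      be%:~R * (2 * (al%:~R * y.1)) by ring.
  have -> : al%:~R * be%:~R * y.2 + al%:~R * be%:~R * y.2 =
      al%:~R * (2 * (om%:~R * y.1 + be%:~R * y.2)) - om%:~R * (2 * (al%:~R * y.1)).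
    by ring.
  by apply/andP; split; [|apply: rpredB]; apply: rpredM => //; exact: intr_int.
have scal n w : iter n A (N * w.1, N * w.2) =
    (N * (iter n A w).1, N * (iter n A w).2).
  by elim: n => [//|n /= ->]; apply: eq_pair => /=; ring.
rewrite /torsion zE -scal; apply: lattice_iter.
by have := scal 1%N y => /= <-.
Qed.

(** The denominator [al * be] is odd. *)
Lemma torsion_shift z s s' : s \in half_shifts -> s' \in half_shifts ->
  torsion (z + s) -> torsion (z + s') -> s = s'.
Proof.
have Nodd : (N / 2) \is a Num.int = false.
  apply/negbTE/negP => /intrP[m hm].
  have : (al * be)%:~R = (2 * m)%:~R :> R by rewrite [RHS]intrM -hm mulrCA mulfV ?mulr1 ?pnatr_eq0.
  by move=> /intr_inj E; have := odd_mulz (ms_al sys) (ms_be sys); rewrite E dvdz_mulr.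
move=> hs hs' /andP[/= t1 t2] /andP[/= t1' t2'].
have d1 : N * (s.1 - s'.1) \is a Num.int.
  have -> : N * (s.1 - s'.1) = N * (z.1 + s.1) - N * (z.1 + s'.1) by ring.
  exact: rpredB.
have d2 : N * (s.2 - s'.2) \is a Num.int.
  have -> : N * (s.2 - s'.2) = N * (z.2 + s.2) - N * (z.2 + s'.2) by ring.
  exact: rpredB.
have Nodd' : (N * (0 - 2^-1)) \is a Num.int = false by rewrite sub0r mulrN rpredN.
move: hs hs' d1 d2; rewrite !inE.
by move=> /or4P[] /eqP -> /or4P[] /eqP -> //=; rewrite ?subr0 ?Nodd ?Nodd'.
Qed.

Lemma cube_mask_eq1 (x y : R) : cube_mask x y = 1 ->
  (x \is a Num.int) && (y \is a Num.int).
Proof.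
move=> xy1; have := cube_mask_sum x y; rewrite xy1 => s1.
have g1 := cube_mask_ge0 (x + 2^-1) y; have g2 := cube_mask_ge0 x (y + 2^-1).
have g3 := cube_mask_ge0 (x + 2^-1) (y + 2^-1).
have /cube_mask_eq0[_ y2 n1] : cube_mask (x + 2^-1) y = 0 by lra.
have /cube_mask_eq0[x2 _ n2] : cube_mask x (y + 2^-1) = 0 by lra.
have /cube_mask_eq0[_ _ n3] : cube_mask (x + 2^-1) (y + 2^-1) = 0 by lra.
have half (m : R) : m \is a Num.int -> 2^-1 + m + 2^-1 \is a Num.int.
  by move=> mi; have -> : 2^-1 + m + 2^-1 = m + 1 by [field]; rewrite rpredD ?rpred1.
move: n1 n2 n3; case: (half_int_dichotomy x2) => [xi|[m mi ->]];
  case: (half_int_dichotomy y2) => [yi|[k ki ->]]; by rewrite ?xi ?yi ?half.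
Qed.

Definition dead x := forall l, periods l -> Phi (x + l) = 0.

Lemma dead_torsion x : dead x -> torsion x.
Proof.
move=> dx; apply: phi0_torsion; rewrite -[x]addr0; apply: dx.
by apply: periods_lattice; exact: lattice0.
Qed.

(** Every preimage of [x] modulo integers with nonzero weight is dead, hence
    torsion.  Only one half-shift can be torsion, so it carries the whole weight
    1, and the mask takes the value 1 at integers only. *)
Lemma dead_preimage x : dead x ->
  exists y, [/\ dead y, lattice (A y - x) & lattice (coords y)].
Proof.
move=> dx; pose y0 := B x.
have alive s : s \in half_shifts -> weight (y0 + s) != 0 -> dead (y0 + s).
  move=> hs w0 l pl; have E : A (y0 + s + l) = x + (A s + A l).
    by rewrite !plane_mapD /y0 (plane_invK sys) addrA.
  have := phi_map sys (y0 + s + l); rewrite E weight_periodic// dx; last first.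
    apply: periodsD; first exact: periods_map_shift.
    exact: (periods_iter 1 pl).
  by move=> /esym/eqP; rewrite mulf_eq0 (negbTE w0) => /eqP.
have [s hs ws] : exists2 s, s \in half_shifts & weight (y0 + s) != 0.
  apply: contrapT => /forall2NP h; have := weight_shift_sum y0.
  rewrite big1_seq => [/eqP|s /andP[_ hs]]; first by rewrite eq_sym oner_eq0.
  by have [//|/negP] := h s; rewrite negbK => /eqP.
exists (y0 + s); split; first exact: alive.
  rewrite plane_mapD /y0 (plane_invK sys) addrC addKr.
  exact: lattice_map_half (half_shifts_double hs).
apply: cube_mask_eq1; have := weight_shift_sum y0.
rewrite (bigD1_seq s) ?half_shifts_uniq//= big1_seq ?addr0// => s' /andP[s's hs'].
apply/eqP; apply: contraNT s's => ws'; apply/eqP.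
by apply: (@torsion_shift y0) => //; apply: dead_torsion; exact: alive.
Qed.

Lemma torsion_pigeonhole (y : nat -> R * R) : (forall n, torsion (y n)) ->
  exists i k, (i < k)%N /\ lattice (y i - y k).
Proof.
move=> ty; pose M := absz (al * be).
have M0 : (0 < M)%N.
  have := odd_mulz (ms_al sys) (ms_be sys); rewrite /M lt0n absz_eq0.
  by apply: contra => /eqP ->; rewrite dvdz0.
pose key (u : R) : int := (Num.floor (N * u) %% M%:Z)%Z.
have keyP (u v : R) : N * u \is a Num.int -> N * v \is a Num.int ->
    key u = key v -> u - v \is a Num.int.
  move=> ui vi /eqP; rewrite eqz_mod_dvd dvdzE absz_nat -dvdzE.
  case/dvdzP => k kE; suff -> : u - v = k%:~R by exact: intr_int.
  have N0 : N != 0 by rewrite intr_eq0 -absz_eq0 -lt0n.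
  apply: (mulfI N0); rewrite mulrBr -(floorK ui) -(floorK vi) -intrB kE intrM.
  by rewrite mulrC.
have key_range (u : R) : exists2 m, m \in iota 0 M & key u = m%:Z.
  have k0 : (0 <= key u)%Z by rewrite modz_ge0// -lt0n.
  exists (absz (key u)); last by rewrite gez0_abs.
  by rewrite mem_iota /= add0n -ltz_nat gez0_abs// ltz_pmod.
pose f n := (key (y n).1, key (y n).2).
have /(uniqPn (0, 0))[i [k [ik]]] : ~~ uniq (mkseq f (M * M).+1).
  pose box := [seq (i%:Z, k%:Z) | i <- iota 0 M, k <- iota 0 M].
  have sub : {subset mkseq f (M * M).+1 <= box}.
    move=> _ /mapP[n _ ->]; have [m1 h1 e1] := key_range (y n).1.
    have [m2 h2 e2] := key_range (y n).2; apply/allpairsP; exists (m1, m2).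
    by rewrite h1 h2 /f e1 e2.
  apply/negP => /uniq_leq_size /(_ sub).
  by rewrite size_mkseq size_allpairs !size_iota ltnn.
rewrite size_mkseq => kM; rewrite !nth_mkseq// ?(ltn_trans ik)// => -[e1 e2].
exists i, k; split=> //; have /andP[/= i1 i2] := ty i; have /andP[/= k1 k2] := ty k.
by apply/andP; split; exact: keyP.
Qed.

(** The dead preimages form an infinite backward orbit.  It repeats modulo
    integers at some indices [i < k], since denominators are bounded.  The
    forward orbit of [y i] then runs, modulo integers, through the [y n] with
    [i < n <= k], which makes [y i] a period; deadness at the period [- y i]
    reads [Phi 0 = 0]. *)
Lemma not_dead x : ~ dead x.
Proof.
move=> dx.
have /choice[nxt nxtP] : forall x, exists y, dead x ->
    [/\ dead y, lattice (A y - x) & lattice (coords y)].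
  move=> z; have [dz|ndz] := pselect (dead z); last by exists 0.
  by have [y yP] := dead_preimage dz; exists y.
pose y n := iter n nxt x.
have dy n : dead (y n) by elim: n => [//|n /nxtP[]].
have step n : lattice (A (y n.+1) - y n) by have [] := nxtP _ (dy n).
have cy n : lattice (coords (y n.+1)) by have [] := nxtP _ (dy n).
have [i [k [ik yik]]] := torsion_pigeonhole (fun n => dead_torsion (dy n)).
have cyc j : exists n, (i < n <= k)%N /\ lattice (iter j A (y i) - y n).
  elim: j => [|j [n [/andP[lin nk] ln]]].
    by exists k; rewrite ik leqnn.
  have n0 : n = n.-1.+1 by lia.
  have lm : lattice (iter j.+1 A (y i) - y n.-1).
    have := latticeD (lattice_map ln) (step n.-1); rewrite -n0 plane_mapB.
    by rewrite addrA subrK.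
  have [ni|ni] := eqVneq n.-1 i; last first.
    by exists n.-1; split=> //; lia.
  exists k; rewrite ik leqnn; split=> //.
  by move: (latticeD lm yik); rewrite ni addrA subrK.
have py : periods (y i).
  move=> j; have [n [/andP[lin _] ln]] := cyc j.
  have n0 : n = n.-1.+1 by lia.
  have := latticeD (lattice_coords ln) (cy n.-1).
  by rewrite -n0 -coordsD subrK.
have := dy i _ (periodsN py); rewrite subrr (ms_0 sys) => /eqP.
by rewrite oner_eq0.
Qed.

(** The integer vectors are periods, so the compact unit square represents all
    cosets of periods. *)
Lemma phi_uniform_period : exists2 e : R, 0 < e &
  forall x, exists2 l, periods l & e <= Phi (x + l).
Proof.
pose P (n : nat) (x : R * R) := exists2 l, periods l & n.+1%:R^-1 <= Phi (x + l).
have cK : compact (`[0, 1]%classic `*` `[0, 1]%classic : set (R * R)).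
  by apply: compact_setX; exact: segment_compact.
have : \forall n \near \oo, (`[0, 1]%classic `*` `[0, 1]%classic : set (R * R)) `<=` P n.
  have /compact_near_coveringP cov := cK.
  apply: (cov nat \oo (fun n x => P n x)) => x _.
  have /existsNP[l /not_implyP[pl /eqP xl]] := @not_dead x.
  have e0 : 0 < Phi (x + l) by rewrite lt_def xl (ms_ge0 sys).
  have e2 : 0 < Phi (x + l) / 2 by rewrite divr_gt0.
  have [r r0 hr] := phi_near0 sys e2.
  pose n0 := Num.truncn (2 / Phi (x + l)).
  have n0P : n0.+1%:R^-1 < Phi (x + l) / 2.
    rewrite -[X in _ < X]invrK ltf_pV2 ?posrE ?invr_gt0// invf_div.
    exact: truncnS_gt.
  have r2 : 0 < r / 2 by rewrite divr_gt0.
  exists (ball x (r / 2), [set n | (n0 <= n)%N]).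
    by split; [exact: nbhsx_ballx | exists n0].
  move=> [x' n] /= [[b1 b2] nn]; exists l => //.
  have h1 : `|(x' - x).1| + `|(x' - x).2| < r.
    move: b1 b2; rewrite /ball /= => b1 b2.
    by rewrite distrC [X in _ + X]distrC; lra.
  have := hr (x + l) _ h1; rewrite (_ : x + l + (x' - x) = x' + l); last first.
    by rewrite addrC addrA subrK.
  rewrite ltr_norml => /andP[h2 _].
  have h3 : n.+1%:R^-1 <= n0.+1%:R^-1 :> R by rewrite lef_pV2 ?posrE// ler_nat.
  by apply: (le_trans h3); apply/ltW/(lt_trans n0P); lra.
case=> n _ /(_ n (leqnn n)) hn; exists n.+1%:R^-1; first by rewrite invr_gt0.
move=> x; pose f : R * R := ((Num.floor x.1)%:~R, (Num.floor x.2)%:~R).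
have lf : lattice f by rewrite /lattice !intr_int.
have [|l pl le] := hn (x - f).
  have u (t : R) : t - (Num.floor t)%:~R \in `[0, 1].
    rewrite in_itv /= subr_ge0 floor_le /=.
    by have := floorD1_gt t; rewrite intrD => ?; apply/ltW; lra.
  by split; exact: u.
exists (l - f); last by rewrite addrA addrAC.
by apply: periodsD => //; apply: periodsN; exact: periods_lattice.
Qed.

End Sufficiency.

(** * Even entries: the tree of frequencies *)

Lemma ler_sum_mem (R : numDomainType) (I : eqType) (s : seq I) (P : pred I)
    (F G : I -> R) : (forall i, i \in s -> P i -> F i <= G i) ->
  \sum_(i <- s | P i) F i <= \sum_(i <- s | P i) G i.
Proof.
move=> FG; rewrite big_seq_cond [leRHS]big_seq_cond.
by apply: ler_sum => i /andP[? ?]; exact: FG.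
Qed.

Section FrequencyTree.
Variables (R : realType) (al om be : int) (a b c d : R) (Phi : R * R -> R).
Hypothesis sys : mask_system al om be a b c d Phi.
Hypothesis a_even : a / 2 \is a Num.int.
Hypothesis b_even : b / 2 \is a Num.int.
Hypothesis c_even : c / 2 \is a Num.int.
Hypothesis d_even : d / 2 \is a Num.int.
Implicit Types x y z u v l s lam : R * R.

Notation A := (plane_map a b c d).
Notation B := (plane_inv a b c d).
Notation coords := (coords al om be).
Notation weight := (weight al om be).
Notation periods := (periods al om be a b c d).
Notation half_shifts := (half_shifts R).

Variables (eps : R) (lift : R * R -> R * R).
Hypothesis eps_gt0 : 0 < eps.
Hypothesis lift_periods : forall x, periods (lift x).
Hypothesis lift_phi : forall x, eps <= Phi (x + lift x).

(** The branch of shift 0 adds nothing, so that the levels of the tree are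
    nested. *)
Definition branch n lam s :=
  if s == 0 then 0 else s + lift (iter n.+1 B lam + s).

Fixpoint freqs n : seq (R * R) :=
  if n is m.+1 then
    [seq lam + iter m.+1 A (branch m lam s) | lam <- freqs m, s <- half_shifts]
  else [:: 0].

Definition partial_phi n x := \prod_(j < n) weight (iter j.+1 B x).

Let BD := iterBD a b c d.
Let BN := iterBN a b c d.
Let iterA0 n : iter n A 0 = 0.
Proof. by elim: n => [//|n /= ->]; rewrite plane_map0. Qed.
Let iterB0 n : iter n B 0 = 0.
Proof. by elim: n => [//|n /= ->]; rewrite /plane_inv plane_map0. Qed.

Lemma phi_partial n x : Phi x = partial_phi n x * Phi (iter n B x).
Proof.
elim: n => [|n ih]; first by rewrite /partial_phi big_ord0 mul1r.
by rewrite /partial_phi big_ord_recr /= -mulrA -(phi_inv sys).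
Qed.

Lemma partial_phi_ge0 n x : 0 <= partial_phi n x.
Proof. by apply: prodr_ge0 => j _; exact: weight_ge0. Qed.

Lemma partial_phi0 n : partial_phi n 0 = 1.
Proof. by have := phi_partial n 0; rewrite iterB0 (ms_0 sys) mulr1. Qed.

Lemma branch_split n lam s : exists2 k, periods k & branch n lam s = s + k.
Proof.
rewrite /branch; case: eqP => [->|_]; last by exists (lift (iter n.+1 B lam + s)).
exists 0; last by rewrite addr0.
by apply: periods_lattice => //; exact: lattice0.
Qed.

(** The vector added at level [n.+1] is a period of the first [n] weights and
    shifts the argument of the last one by [s], up to a period. *)
Lemma partial_phi_branch n x lam s : s \in half_shifts ->
  partial_phi n.+1 (x - (lam + iter n.+1 A (branch n lam s))) =
  partial_phi n (x - lam) * weight (iter n.+1 B (x - lam) - s).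
Proof.
move=> hs; have [k pk ->] := branch_split n lam s.
rewrite opprD addrA; set y := x - lam; set w := s + k.
have shiftE j : (j <= n)%N -> iter j.+1 B (y - iter n.+1 A w) =
    iter j.+1 B y - iter (n - j) A w.
  move=> jn; rewrite BD BN; congr (_ - _).
  have -> : n.+1 = (j.+1 + (n - j))%N by lia.
  by rewrite iterD (iter_plane_mapK sys).
rewrite /partial_phi big_ord_recr /=; congr (_ * _).
  apply: eq_bigr => j _; rewrite -!iterS shiftE; last exact: ltnW.
  apply: weight_periodic; apply: periodsN.
  have -> : (n - j)%N = (n - j).-1.+1 by have := ltn_ord j; lia.
  rewrite iterSr plane_mapD; apply: periods_iter; apply: periodsD.
    exact: periods_map_shift.
  exact: (periods_iter 1 pk).
rewrite -!iterS shiftE// subnn /= opprD addrA.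
by apply: weight_periodic; exact: periodsN.
Qed.

Lemma sum_partial_phi n x : \sum_(lam <- freqs n) partial_phi n (x - lam) = 1.
Proof.
elim: n => [|n ih]; first by rewrite big_seq1 /partial_phi big_ord0.
rewrite big_allpairs_dep /= -[RHS]ih; apply: eq_bigr => lam _.
rewrite (eq_big_seq (fun s => partial_phi n (x - lam) *
    weight (iter n.+1 B (x - lam) - s))); last first.
  by move=> s hs; exact: partial_phi_branch.
by rewrite -mulr_sumr (weight_shift_sumN sys) // mulr1.
Qed.

(** In the identity [sum_partial_phi] at a frequency of the level, the term of
    this frequency is already 1, so that the others vanish: frequencies are
    distinct and orthogonal. *)
Lemma sum_rem (n : nat) lam : lam \in freqs n ->
  \sum_(l <- rem lam (freqs n)) partial_phi n (lam - l) = 0.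
Proof.
move=> hl; have := sum_partial_phi n lam.
rewrite (perm_big _ (perm_to_rem hl)) big_cons subrr partial_phi0.
by move=> E; apply: (addrI 1); rewrite addr0.
Qed.

Lemma partial_rem n lam l : lam \in freqs n -> l \in rem lam (freqs n) ->
  partial_phi n (lam - l) = 0.
Proof.
move=> hl lr; have /eqP := sum_rem hl.
rewrite (perm_big _ (perm_to_rem lr)) big_cons paddr_eq0 ?partial_phi_ge0//.
  by move=> /andP[/eqP].
by apply: sumr_ge0 => i _; exact: partial_phi_ge0.
Qed.

Lemma freqs_uniq n : uniq (freqs n).
Proof.
apply: count_mem_uniq => x; have [hx|hx] := boolP (x \in freqs n); last first.
  by apply/count_memPn.
rewrite (permP (perm_to_rem hx)) /= eqxx (count_memPn _) //.
apply/negP => /(partial_rem hx) /eqP.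
by rewrite subrr partial_phi0 oner_eq0.
Qed.

Lemma freqsS n : {subset freqs n <= freqs n.+1}.
Proof.
move=> lam hl; apply/allpairsPdep; exists lam, 0; split=> //.
  by rewrite /half_shifts inE eqxx.
by rewrite /branch eqxx iterA0 addr0.
Qed.

Lemma freqs_mono m n : (m <= n)%N -> {subset freqs m <= freqs n}.
Proof.
move=> mn; rewrite -(subnK mn); elim: (n - m)%N => [//|k ih] l /ih.
by rewrite addSn; exact: freqsS.
Qed.

Lemma freqs_phi n lam : lam \in freqs n -> eps <= Phi (iter n B lam).
Proof.
elim: n lam => [lam|n ih lam].
  rewrite inE => /eqP -> /=; rewrite (ms_0 sys).
  apply: le_trans (lift_phi 0) _; rewrite -[X in Phi X]subr0.
  have := @ms_bessel _ _ _ _ _ _ _ _ _ sys [:: 0] (0 + lift 0); rewrite big_seq1; apply => //.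
  by move=> l l' /=; rewrite !inE => /eqP -> /eqP ->; rewrite eqxx.
move=> /allpairsPdep[l [s [hl hs ->]]].
rewrite BD (iter_plane_mapK sys) /branch; case: eqP => [_|_].
  by rewrite addr0; apply: le_trans (ih _ hl) _; exact: (phi_le_inv sys).
by rewrite addrA; exact: lift_phi.
Qed.

Definition spectrum_tree := [set x | exists n, x \in freqs n].

Lemma spectrum_tree_countable : countable spectrum_tree.
Proof.
rewrite (_ : spectrum_tree = \bigcup_n [set` freqs n]).
  by apply: bigcup_countable => // n _; exact: finite_set_countable.
by rewrite predeqE => x; split=> [[n hn]|[n _ hn]]; exists n.
Qed.

Lemma spectrum_tree_orthogonal : orthogonal_set Phi spectrum_tree.
Proof.
move=> l l' [m hm] [n hn] ll'.
have {}hm := freqs_mono (leq_maxl m n) hm; have {}hn := freqs_mono (leq_maxr m n) hn.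
rewrite (phi_partial (maxn m n)) (@partial_rem _ l l') ?mul0r//.
by rewrite mem_rem_uniq ?freqs_uniq// inE eq_sym ll'.
Qed.

Let mass n x := \sum_(l <- freqs n) Phi (x - l).

Lemma freqs_split m n (F : R * R -> R) : (m <= n)%N ->
  \sum_(l <- freqs n) F l =
  \sum_(l <- freqs m) F l + \sum_(l <- freqs n | l \notin freqs m) F l.
Proof.
move=> mn; rewrite (bigID (fun l => l \in freqs m)) /=; congr (_ + _).
rewrite -big_filter; apply: perm_big; apply: uniq_perm.
- by apply: filter_uniq; exact: freqs_uniq.
- exact: freqs_uniq.
move=> l; rewrite mem_filter; have [lm|//] := boolP (l \in freqs m).
by rewrite (freqs_mono mn lm).
Qed.

Lemma mass_le1 n x : mass n x <= 1.
Proof.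
apply: (ms_bessel sys); first exact: freqs_uniq.
by move=> l l' hl hl'; apply: spectrum_tree_orthogonal; exists n.
Qed.

Lemma mass_cauchy x (e : R) : 0 < e ->
  exists m, forall n, (m <= n)%N -> mass n x - mass m x <= e.
Proof.
move=> e0; have nd : nondecreasing_seq (fun n => mass n x).
  move=> m n mn; rewrite /mass (freqs_split _ mn) lerDl.
  by apply: sumr_ge0 => l _; exact: ms_ge0 sys _.
have cv : cvgn (fun n => mass n x).
  by apply: nondecreasing_is_cvgn => //; exists 1 => _ [n _ <-]; exact: mass_le1.
have /cvgrPdist_lt /(_ _ e0) [m _ hm] := cv.
exists m => n mn; have le := nondecreasing_cvgn_le nd cv n.
have := hm m (leqnn m); rewrite /= ltr_norml => /andP[_ ?]; lra.
Qed.

Lemma uniform_threshold (s : seq (R * R)) x (e : R) : 0 < e -> exists n0,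
  forall n, (n0 <= n)%N -> forall l, l \in s -> 1 - e < Phi (iter n B (x - l)).
Proof.
move=> e0; elim: s => [|l s [n0 h0]]; first by exists 0%N.
have [n1 h1] := phi_iter_inv_cvg sys (x - l) e0.
exists (maxn n0 n1) => n; rewrite geq_max => /andP[nn0 nn1] l'.
by rewrite inE => /predU1P[->|hl]; [exact: h1 | exact: h0].
Qed.

(** Suppose that the masses [mass n x] stay below [1 - t].  Compare at a late
    level [n] with the partial products, whose sum is 1.  For the frequencies of
    a fixed level [m] the quotient of [Phi] by the partial product is close to 1.
    For the later ones it is at least [eps / 2], so their partial products are
    controlled by the increase of [mass] after [m], which is small.  The total
    is then less than 1. *)
Lemma spectrum_tree_complete x (e : R) : 0 < e -> exists F : seq (R * R),
  [/\ uniq F, forall l, l \in F -> spectrum_tree l &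
      1 - e < \sum_(l <- F) Phi (x - l)].
Proof.
move=> e0; suff [n hn] : exists n, 1 - e < mass n x.
  by exists (freqs n); split; [exact: freqs_uniq | move=> l hl; exists n |].
apply: contrapT => /forallNP small.
pose t := Num.min e 2^-1.
have t0 : 0 < t by rewrite lt_min e0 invr_gt0 ltr0n.
have t2 : t <= 2^-1 by rewrite ge_min lexx orbT.
have te : t <= e by rewrite ge_min lexx.
have small' n : mass n x <= 1 - t.
  by have /negP := small n; rewrite -leNgt => h; apply: (le_trans h); lra.
have et0 : 0 < eps * t / 8 by rewrite divr_gt0// mulr_gt0.
have [m hm] := mass_cauchy x et0.
have t20 : 0 < t / 2 by lra.
have [n0 h0] := uniform_threshold (freqs m) x t20.
have ep0 := eps_gt0; have e20 : 0 < eps / 2 by rewrite divr_gt0.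
have [r r0 hr] := phi_near0 sys e20.
have [n1 h1] := iter_inv_small sys x r0.
pose n := maxn m (maxn n0 n1).
have mn : (m <= n)%N by exact: leq_maxl.
have nn0 : (n0 <= n)%N by exact: leq_trans (leq_maxl _ _) (leq_maxr _ _).
have nn1 : (n1 <= n)%N by exact: leq_trans (leq_maxr _ _) (leq_maxr _ _).
have := sum_partial_phi n x; rewrite (freqs_split _ mn).
set S1 := \sum_(_ <- freqs m) _; set S2 := \sum_(_ <- _ | _) _ => S12.
have le1 : (1 - t / 2) * S1 <= 1 - t.
  apply: le_trans (small' m); rewrite mulr_sumr /mass.
  apply: ler_sum_mem => l hl _; rewrite (phi_partial n) mulrC ler_wpM2l//.
    exact: partial_phi_ge0.
  exact/ltW/h0.
have le2 : (eps / 2) * S2 <= eps * t / 8.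
  apply: le_trans (hm n mn); rewrite /mass (freqs_split _ mn) addrC addKr mulr_sumr.
  apply: ler_sum_mem => l hl _; rewrite (phi_partial n) mulrC ler_wpM2l//.
    exact: partial_phi_ge0.
  have := hr (iter n B (- l)) _ (h1 n nn1).
  rewrite -BD (addrC (- l)) BN (ms_N sys) ltr_norml => /andP[h _].
  by have := freqs_phi hl; lra.
have S2le : S2 <= t / 4.
  by rewrite -(ler_pM2l e20); apply: le_trans le2 _; lra.
have t21 : 0 < 1 - t / 2 by lra.
have S1le : S1 <= 1 - t / 2.
  rewrite -(ler_pM2l t21); apply: (le_trans le1).
  by have := sqr_ge0 t; rewrite expr2; lra.
lra.
Qed.

End FrequencyTree.

(** The tree built from a choice of periods along which [Phi] is bounded
    below. *)
Theorem mask_system_parseval (R : realType) (al om be : int) (a b c d : R)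
    (Phi : R * R -> R) : mask_system al om be a b c d Phi ->
  a / 2 \is a Num.int -> b / 2 \is a Num.int ->
  c / 2 \is a Num.int -> d / 2 \is a Num.int ->
  exists L, parseval_set Phi L.
Proof.
move=> sys a2 b2 c2 d2.
have [eps eps0 heps] := phi_uniform_period sys a2 b2 c2 d2.
have /choice[lift hl] : forall x, exists l, periods al om be a b c d l /\
    eps <= Phi (x + l) by move=> x; have [l ? ?] := heps x; exists l.
exists (spectrum_tree a b c d lift); split.
- exact: spectrum_tree_countable.
- by apply: (spectrum_tree_orthogonal sys a2 b2 c2 d2 eps0) => x; have [] := hl x.
- move=> k e e0.
  by apply: (spectrum_tree_complete sys a2 b2 c2 d2 eps0) => // x; have [] := hl x.
Qed.

(** * Parseval sums outside a countable set *)

Lemma esum_fibers (R : realType) (T T' : choiceType) (Z : set T) (r : T -> T')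
    (J : set T') (f : T -> \bar R) :
  (forall y, Z y -> J (r y)) -> (forall y, Z y -> (0 <= f y)%E) ->
  (\esum_(y in Z) f y = \esum_(x in J) \esum_(y in Z `&` r @^-1` [set x]) f y)%E.
Proof.
move=> ZJ f0; rewrite esum_esum => [|x y _ [Zy _]]; last exact: f0.
rewrite (@reindex_esum _ _ _ Z _ (fun y => (r y, y))) //; split.
- by move=> y Zy; split=> //=; exact: ZJ.
- by move=> y y' _ _ [].
- by move=> [x y] /= [_ [Zy <-]]; exists y.
Qed.

Lemma countable_preimage_cancel (T T' : Type) (f : T -> T') (g : T' -> T)
    (S : set T') : cancel f g -> countable S -> countable [set x | S (f x)].
Proof.
move=> fK cS; apply: (@sub_countable _ _ _ (g @` S)).
  by apply: subset_card_le => x Sx; exists (f x).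
exact: (sub_countable (card_image_le g S)).
Qed.

Lemma parseval_set_transfer (R : realType) (V W : zmodType) (phi : V -> R)
    (L : set V) (f : W -> V) (g : V -> W) : cancel f g -> cancel g f ->
  {morph f : x y / x - y} -> parseval_set phi L ->
  parseval_set (phi \o f) [set x | L (f x)].
Proof.
move=> fK gK fB [cL oL dL]; split.
- exact: countable_preimage_cancel fK cL.
- move=> l l' Ll Ll' ne; rewrite /= fB oL//.
  by apply: contra ne => /eqP/(can_inj fK) ->.
- move=> k eps e0; have [F [uF FL lt]] := dL (f k) eps e0.
  exists [seq g l | l <- F]; split.
  + by rewrite (map_inj_uniq (can_inj gK)).
  + by move=> _ /mapP[l lF ->] /=; rewrite gK; exact: FL.
  + by under eq_bigr do rewrite /= fB; rewrite big_map; under eq_bigr do rewrite gK.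
Qed.

Section ParsevalAlmostEverywhere.
Variables (R : realType) (al om be : int) (a b c d : R) (Phi : R * R -> R).
Hypothesis sys : mask_system al om be a b c d Phi.
Implicit Types (x y z : R * R) (L : set (R * R)).

(** The Parseval identity outside a countable set, the form that is stable under
    the passage to a choice of classes. *)
Definition coparseval L := [/\ countable L, orthogonal_set Phi L &
  exists2 C : set (R * R), countable C & forall x, ~ C x ->
    (\esum_(l in L) (Phi (x - l))%:E = 1)%E].

Lemma esum_bessel L x : orthogonal_set Phi L ->
  (\esum_(l in L) (Phi (x - l))%:E <= 1)%E.
Proof.
move=> oL; apply: ge_ereal_sup => _ [X [finX XL] <-].
rewrite fsbig_finite//= sumEFin lee_fin; apply: (ms_bessel sys) => //.
  exact: fset_uniq.
by move=> l l' /=; rewrite !in_fset_set// !inE => /XL ? /XL ?; exact: oL.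
Qed.

Lemma parseval_coparseval L : parseval_set Phi L -> coparseval L.
Proof.
move=> [cL oL dL]; split=> //; exists set0; first exact: countable0.
move=> x _; apply/eqP; rewrite eq_le esum_bessel//=.
apply/lee_addgt0Pr => e e0; have [F [uF FL lt]] := dL x e e0.
rewrite -leeBlDr//; apply: esum_ge; exists [set` F].
  by split; [exact: finite_seq | move=> l /= /FL].
rewrite fsbig_finite; last exact: finite_seq.
rewrite /= sumEFin -EFinB lee_fin (perm_big F) ?(ltW lt)//.
apply: uniq_perm => //; first exact: fset_uniq.
move=> l; rewrite in_fset_set; last exact: finite_seq.
by apply/idP/idP => h; [move/set_mem: h | apply/mem_set].
Qed.

Lemma coparseval_translate L k : coparseval L -> coparseval [set x | L (x + k)].
Proof.
move=> [cL oL [C cC hC]].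
have pre := countable_preimage_cancel (addrK k).
split; first exact: pre.
  move=> l l' Ll Ll' ll'; have -> : l - l' = (l + k) - (l' + k) by rewrite opprD addrACA subrr addr0.
  by apply: oL => //; apply: contra ll' => /eqP/addIr ->.
exists [set x | C (x + k)]; first exact: pre.
move=> x Cx; rewrite -(hC _ Cx).
rewrite [RHS](@reindex_esum _ _ _ [set x | L (x + k)] _ (fun x => x + k)).
  by apply: eq_esum => l _; rewrite opprD addrACA subrr addr0.
split=> //; first by move=> y y' _ _ /addIr.
by move=> l Ll; exists (l - k); rewrite /= ?subrK.
Qed.

End ParsevalAlmostEverywhere.

(** * Classes of the preimage of a spectrum *)

Lemma esumZl (R : realType) (T : choiceType) (Z : set T) (k : R)
    (f : T -> \bar R) : 0 <= k -> (forall y, Z y -> (0 <= f y)%E) ->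
  (\esum_(y in Z) (k%:E * f y) = k%:E * \esum_(y in Z) f y)%E.
Proof.
have le (m : R) (g : T -> \bar R) : 0 <= m -> (forall y, Z y -> (0 <= g y)%E) ->
    (\esum_(y in Z) (m%:E * g y) <= m%:E * \esum_(y in Z) g y)%E.
  move=> m0 g0; apply: ge_ereal_sup => _ [X [finX XZ] <-].
  rewrite fsbig_finite//= big_seq -ge0_sume_distrr; last first.
    by move=> i; rewrite in_fset_set// inE => /XZ; exact: g0.
  rewrite lee_wpmul2l ?lee_fin// -big_seq; apply: esum_ge.
  by exists X => //; rewrite fsbig_finite.
rewrite le_eqVlt => /predU1P[<- _|k0 f0].
  by rewrite mul0e esum1// => y _; rewrite mul0e.
apply/eqP; rewrite eq_le (le k f (ltW k0) f0) /= -lee_pdivlMl//.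
have := le k^-1 (fun y => (k%:E * f y)%E).
rewrite invr_ge0 ltW// => /(_ isT); have -> :
    (\esum_(y in Z) (k^-1%:E * (k%:E * f y)) = \esum_(y in Z) f y)%E.
  by apply: eq_esum => y _; rewrite muleA -EFinM mulVf ?mul1e// gt_eqF.
by apply => y Zy; apply: mule_ge0; [rewrite lee_fin ltW | exact: f0].
Qed.

Section Descent.
Variables (R : realType) (al om be : int) (a b c d : R) (Phi : R * R -> R).
Hypothesis sys : mask_system al om be a b c d Phi.
Implicit Types (x y z : R * R) (L : set (R * R)) (s : bool * bool).

Notation A := (plane_map a b c d).
Notation B := (plane_inv a b c d).
Notation coords := (coords al om be).
Notation weight := (weight al om be).
Notation coparseval := (coparseval Phi).

Definition bits s : R * R := (s.1%:R / 2, s.2%:R / 2).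
(** The mask has half-integral arguments at [x]. *)
Definition half_coset x := lattice (coords x + coords x).

(* A choice of one representative in each coset of the half-points. *)
Variable r : R * R -> R * R.
Hypothesis r_in : forall y, half_coset (y - r y).
Hypothesis r_const : forall y y', half_coset (y - y') -> r y = r y'.

(** The component of [y] in the group of half-points modulo the lattice of points
    with integral arguments, relative to the representative of its coset. *)
Definition class y : bool * bool :=
  ((coords (y - r y)).1 \isn't a Num.int, (coords (y - r y)).2 \isn't a Num.int).

Let coordsB x y : coords (x - y) = coords x - coords y.
Proof. by rewrite coordsD coordsN. Qed.

Lemma half_bit (u : R) : u + u \is a Num.int ->
  u - (u \isn't a Num.int)%:R / 2 \is a Num.int.
Proof.
move=> u2; have [ui|nu] := boolP (u \is a Num.int); first by rewrite mul0r subr0.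
have [|ui|[m mi ->]] := @half_int_dichotomy R u.
- by rewrite mulrDl !mul1r.
- by rewrite ui in nu.
- by rewrite mul1r addrAC subrr add0r.
Qed.

Lemma class_coords y : lattice (coords (y - r y) - bits (class y)).
Proof.
have /andP[h1 h2] := r_in y.
by apply/andP; split; exact: half_bit.
Qed.

Lemma weight_class eta y : weight (eta - y) =
  cube_mask ((coords (eta - r y)).1 - (class y).1%:R / 2)
            ((coords (eta - r y)).2 - (class y).2%:R / 2).
Proof.
have /andP[l1 l2] := class_coords y.
rewrite /weight -(cube_mask_periodic _ _ l1 l2).
have E : coords (eta - r y) = coords (eta - y) + coords (y - r y).
  by rewrite -coordsD addrA subrK.
by rewrite E; congr cube_mask; rewrite /=; ring.
Qed.

Lemma same_class y y' : r y = r y' -> class y = class y' ->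
  lattice (coords (y - y')).
Proof.
move=> ry cy; have := latticeB (class_coords y) (class_coords y').
suff -> : coords (y - r y) - bits (class y) - (coords (y' - r y') - bits (class y')) =
    coords (y - y') by [].
rewrite ry cy opprB addrA subrK -coordsB; congr (coords _).
by rewrite opprB addrA subrK.
Qed.

Definition mask_at eta x s :=
  cube_mask ((coords (eta - x)).1 - s.1%:R / 2) ((coords (eta - x)).2 - s.2%:R / 2).

Lemma sum_mask_at eta x : \sum_s mask_at eta x s = 1.
Proof.
rewrite -(pair_bigA _ (fun i j => mask_at eta x (i, j))) /= !big_bool /mask_at.
move: (coords _).1 (coords _).2 => u v /=.
have := cube_mask_sum (u - 2^-1) (v - 2^-1); rewrite !subrK => E.
by rewrite -[RHS]E !mul1r !mul0r !subr0; ring.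
Qed.

Variable L : set (R * R).
Let Y := [set y | L (A y)].
Hypothesis oL : orthogonal_set Phi L.

(** One class in each coset. *)
Definition selection (t : R * R -> bool * bool) :=
  [set y | L (A y) /\ class y = t (r y)].

(** For two elements [y] and [y'] orthogonality of [L] gives
    [weight (y - y') * Phi (y - y') = 0].  A zero of the weight puts [y] and [y']
    into different classes of one coset. *)
Lemma selection_orthogonal t : orthogonal_set Phi (selection t).
Proof.
move=> y y' [Ly cy] [Ly' cy'] yy'.
have : Phi (A (y - y')) = 0.
  rewrite plane_mapB; apply: oL => //; apply: contra yy' => /eqP E.
  by apply/eqP; exact: (can_inj (plane_mapK sys)).
rewrite (phi_map sys) => /eqP; rewrite mulf_eq0 => /orP[/eqP w0|/eqP//].
have [h1 h2 /negP[]] := cube_mask_eq0 w0.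
have hr : r y = r y'.
  by apply: r_const; rewrite /half_coset; apply/andP; split;
    rewrite /= -mulr2n -mulr_natl.
by apply: same_class => //; rewrite cy cy' hr.
Qed.

Section GenericPoint.
Variable eta : R * R.
Hypothesis eta_sum :
  (\esum_(y in Y) (weight (eta - y) * Phi (eta - y))%:E = 1)%E.
Hypothesis eta_pos : forall y s, Y y -> mask_at eta (r y) s != 0.

Let J := r @` Y.
Let cell x s := [set y | [/\ Y y, r y = x & class y = s]].
Let q x s := (\esum_(y in cell x s) (Phi (eta - y))%:E)%E.
Let phi0 y : (0 <= (Phi (eta - y))%:E)%E.
Proof. by rewrite lee_fin (ms_ge0 sys). Qed.

Let q_ge0 x s : (0 <= q x s)%E.
Proof. by apply: esum_ge0 => y _; exact: phi0. Qed.

Let q_fin x s : q x s \is a fin_num.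
Proof.
rewrite ge0_fin_numE ?q_ge0//; apply: (@le_lt_trans _ _ 1%E); last exact: ltry.
apply: (esum_bessel sys) => y y' [Yy ry cy] [Yy' ry' cy'].
by apply: (@selection_orthogonal (fun=> s)).
Qed.

Let selection_cells t : (\esum_(y in selection t) (Phi (eta - y))%:E =
  \esum_(x in J) q x (t x))%E.
Proof.
rewrite (@esum_fibers _ _ _ _ r J) => [|y [Yy _]|y _]; [|by exists y|exact: phi0].
apply: eq_esum => x _; congr esum; rewrite predeqE => y; split.
  by move=> [[Yy cy] /= ry]; split=> //; rewrite cy ry.
by move=> [Yy ry cy]; split=> //; split=> //; rewrite cy ry.
Qed.

Let weighted_cells : (\esum_(x in J) (\sum_s mask_at eta x s * fine (q x s))%:E = 1)%E.
Proof.
rewrite -eta_sum (@esum_fibers _ _ _ Y r J) => [|y Yy|y _]; last 2 first.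
- by exists y.
- by rewrite lee_fin mulr_ge0 ?weight_ge0 ?(ms_ge0 sys).
apply: eq_esum => x _.
rewrite [RHS](@esum_fibers _ _ _ _ class setT) => [|//|y _]; last first.
  by rewrite lee_fin mulr_ge0 ?weight_ge0 ?(ms_ge0 sys).
have fin : finite_set [set: bool * bool] by exact: finite_finset.
rewrite [RHS](esum_fset fin) => [|s _]; last first.
  apply: esum_ge0 => y _.
  by rewrite lee_fin mulr_ge0 ?weight_ge0 ?(ms_ge0 sys).
rewrite [RHS](fsbig_finite _ _ fin) [RHS](perm_big (index_enum _)) /=; last first.
  apply: uniq_perm; [exact: fset_uniq | exact: index_enum_uniq |] => s.
  by rewrite (in_fset_set fin) mem_index_enum in_setT.
rewrite -sumEFin; apply: eq_bigr => s _; rewrite EFinM fineK//.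
rewrite /q -esumZl ?cube_mask_ge0//.
rewrite (_ : cell x s = Y `&` r @^-1` [set x] `&` class @^-1` [set s]).
  by apply: eq_esum => y [[Yy ry] cy]; rewrite EFinM weight_class /mask_at ry cy.
by rewrite predeqE => y; split=> [[? ? ?]|[[? ?] ?]].
Qed.

(** The class of largest mass in the coset of [x]. *)
Let best x := [arg max_(s > (false, false)) fine (q x s)]%O.
Let bestP x s : fine (q x s) <= fine (q x (best x)).
Proof. by rewrite /best; case: Order.TotalTheory.arg_maxP => // m _; apply. Qed.

Let deficit x := fine (q x (best x)) - \sum_s mask_at eta x s * fine (q x s).
Let deficitE x :
  deficit x = \sum_s mask_at eta x s * (fine (q x (best x)) - fine (q x s)).
Proof.
rewrite /deficit -[X in X - _]mul1r -(sum_mask_at eta x) mulr_suml -sumrB.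
by apply: eq_bigr => s _; rewrite mulrBr.
Qed.

Let deficit_ge0 x : 0 <= deficit x.
Proof.
rewrite deficitE sumr_ge0// => s _.
by rewrite mulr_ge0 ?subr_ge0 ?bestP ?cube_mask_ge0.
Qed.

(** Over the cosets the weighted averages of the class masses add up to 1, and
    the largest class masses add up to at most 1, by Bessel's inequality for the
    selection of the best classes.  Hence no coset can lose anything. *)
Let deficit_eq0 x : J x -> deficit x = 0.
Proof.
move=> Jx.
have total : (\esum_(x in J) (deficit x)%:E + 1 <= 1)%E.
  rewrite -{1}weighted_cells -esumD; last 2 first.
  - by move=> z _; rewrite lee_fin deficit_ge0.
  - move=> z _; rewrite lee_fin sumr_ge0// => s _.
    by rewrite mulr_ge0 ?cube_mask_ge0 ?fine_ge0.
  rewrite (eq_esum (b := fun z => q z (best z))) => [|z _]; last first.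
    by rewrite -EFinD subrK fineK.
  rewrite -selection_cells; apply: (esum_bessel sys).
  exact: selection_orthogonal.
apply/eqP; rewrite eq_le deficit_ge0 andbT -lee_fin.
apply: (@le_trans _ _ (\esum_(x in J) (deficit x)%:E)%E).
  apply: esum_ge; exists [set x]; last by rewrite fsbig_set1.
  by split=> // z ->.
by rewrite -(@leeD2rE _ 1%E)// add0e.
Qed.

Let cells_equal x s : J x -> fine (q x s) = fine (q x (best x)).
Proof.
move=> Jx; have := deficit_eq0 Jx; rewrite deficitE => /eqP.
rewrite psumr_eq0 => [/allP /(_ s)|s' _]; last first.
  by rewrite mulr_ge0 ?subr_ge0 ?bestP ?cube_mask_ge0.
rewrite mem_index_enum => /(_ isT) /=; rewrite mulf_eq0 subr_eq0.
case: Jx => y Yy <-.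
by rewrite (negbTE (eta_pos s Yy)) => /eqP.
Qed.

(** All the weights [mask_at] are nonzero at the generic point [eta], so the four
    classes of a coset have the same mass as the best one. *)
Lemma selection_sum t : (\esum_(y in selection t) (Phi (eta - y))%:E = 1)%E.
Proof.
rewrite selection_cells -[RHS]weighted_cells; apply: eq_esum => x Jx.
have /eqP := deficit_eq0 Jx; rewrite subr_eq0 => /eqP <-.
by rewrite -(@cells_equal x (t x))// fineK.
Qed.

Lemma class_hit y s : Y y -> Phi (eta - y) != 0 ->
  exists y', [/\ Y y', r y' = r y & class y' = s].
Proof.
move=> Yy py; apply: contrapT => /forallNP none.
have Jy : J (r y) by exists y.
have q0 : q (r y) s = 0%E by apply: esum1 => y' [? ? ?]; case: (none y').
have : fine (q (r y) (class y)) = fine (q (r y) s) by rewrite !cells_equal.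
rewrite q0 /= => qy.
have : ((Phi (eta - y))%:E <= q (r y) (class y))%E.
  apply: esum_ge; exists [set y]; last by rewrite fsbig_set1.
  by split=> // z ->.
rewrite -(fineK (q_fin _ _)) qy lee_fin => le.
by move: py; rewrite eq_le le (ms_ge0 sys).
Qed.

End GenericPoint.

End Descent.

(** * Generic points *)

Section GenericPoints.
Variables (R : realType) (al om be : int) (a b c d : R) (Phi : R * R -> R).
Hypothesis sys : mask_system al om be a b c d Phi.
Implicit Types (x y z : R * R) (L : set (R * R)) (s : bool * bool).

Notation A := (plane_map a b c d).
Notation B := (plane_inv a b c d).
Notation coords := (coords al om be).
Notation half_coset := (half_coset al om be).

Lemma countable_avoid (D : set R) (e : R) : countable D -> 0 < e ->
  exists2 t, 0 < t < e & ~ D t.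
Proof.
move=> cD e0; apply: contrapT => /forall2NP h.
have sub : `]0, e[%classic `<=` D.
  move=> t; rewrite /= in_itv /= => t0e.
  by have [//|/contrapT] := h t.
have : (@lebesgue_measure R) `]0, e[%classic = 0%E.
  apply: countable_lebesgue_measure0.
  by apply: sub_countable cD; exact: subset_card_le.
rewrite lebesgue_measure_itv /= lte_fin e0 oppr0 adde0 => /eqP.
by rewrite eqe gt_eqF.
Qed.

Lemma generic_near (C : set (R * R)) y : countable C ->
  exists2 x, ~ C x & Phi (x - y) != 0.
Proof.
move=> cC; have h0 : 0 < (2^-1 : R) by rewrite invr_gt0.
have [e e0 he] := phi_near0 sys h0.
pose D := [set t : R | C (y + (t, 0))].
have cD : countable D.
  apply: (@sub_countable _ _ _ ((fun x => (x - y).1) @` C)).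
    apply: subset_card_le => t Ct; exists (y + (t, 0)) => //.
    by rewrite addrC addKr.
  exact: (sub_countable (card_image_le _ C)).
have [t /andP[t0 te] Dt] := countable_avoid cD e0.
exists (y + (t, 0)) => //; rewrite addrC addKr.
have := he 0 (t, 0); rewrite add0r (ms_0 sys) /= normr0 addr0 gtr0_norm// => /(_ te).
rewrite ltr_norml => /andP[h _]; apply/negP => /eqP p0; move: h; rewrite p0; lra.
Qed.

Let al0 : al%:~R != 0 :> R.
Proof. exact: odd_intr_neq0 (ms_al sys). Qed.
Let be0 : be%:~R != 0 :> R.
Proof. exact: odd_intr_neq0 (ms_be sys). Qed.

Lemma countable_half_coset : countable [set u : R * R | half_coset u].
Proof.
pose g (k : int * int) : R * R := (k.1%:~R / 2 / al%:~R,
  (k.2%:~R / 2 - om%:~R * (k.1%:~R / 2 / al%:~R)) / be%:~R).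
apply: (@sub_countable _ _ _ (g @` setT)); last first.
  by apply: (sub_countable (card_image_le _ _)); exact: countableP.
apply: subset_card_le => u /andP[/intrP[m hm] /intrP[k hk]].
have al0' := al0; have be0' := be0.
exists (m, k) => //; rewrite /g -hm -hk /=; apply: eq_pair => /=; field => //.
by rewrite al0' be0'.
Qed.

Variable r : R * R -> R * R.
Hypothesis r_in : forall y, half_coset (y - r y).
Hypothesis r_const : forall y y', half_coset (y - y') -> r y = r y'.
Notation class := (class al om be r) (only parsing).
Notation selection := (selection al om be a b c d r).

Lemma half_cosetD x y : half_coset x -> half_coset y -> half_coset (x + y).
Proof.
move=> hx hy; rewrite /half_coset coordsD addrACA; exact: latticeD.
Qed.

Lemma half_cosetN x : half_coset x -> half_coset (- x).
Proof. by move=> hx; rewrite /half_coset coordsN -opprD; exact: latticeN. Qed.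

(** The exceptional points are those with an exceptional image for [L], and those
    at which some weight [mask_at] vanishes: these lie in countably many cosets
    of the countable group of half-points. *)
Lemma generic_sums L : coparseval Phi L -> exists2 C : set (R * R), countable C &
  forall eta, ~ C eta ->
  (\esum_(y in [set y | L (A y)])
      (weight al om be (eta - y) * Phi (eta - y))%:E = 1)%E /\
  (forall y s, L (A y) -> mask_at al om be eta (r y) s != 0).
Proof.
move=> [cL oL [C cC hC]].
have cY : countable [set y | L (A y)].
  exact: (countable_preimage_cancel (plane_mapK sys)).
pose bad := \bigcup_(y in [set y | L (A y)]) [set eta | half_coset (eta - y)].
exists ([set eta | C (A eta)] `|` bad).
  rewrite -bigcup2E; apply: bigcup_countable => // i _.
  case: i => [|[|i]] /=; last exact: countable0.
    exact: (countable_preimage_cancel (plane_mapK sys)).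
  apply: bigcup_countable => // y _.
  exact: (countable_preimage_cancel (subrK y) countable_half_coset).
move=> eta /not_orP[Ce be_]; split.
  rewrite -[RHS](hC _ Ce) (@reindex_esum _ _ _ [set y | L (A y)] L A); last first.
    split=> //; first by move=> y y' _ _; exact: (can_inj (plane_mapK sys)).
    by move=> l Ll; exists (B l); rewrite /= ?(plane_invK sys).
  by apply: eq_esum => y _; rewrite -(phi_map sys) plane_mapB.
move=> y s Ly; apply/negP => /eqP /cube_mask_eq0[h1 h2 _]; apply: be_.
exists y => //=; have -> : eta - y = (eta - r y) + (- (y - r y)).
  by rewrite opprB addrA subrK.
apply: half_cosetD; last exact: half_cosetN.
have twice (u : R) (bb : bool) : 2 * (u - bb%:R / 2) \is a Num.int ->
    u + u \is a Num.int.
  move=> hu; have -> : u + u = 2 * (u - bb%:R / 2) + bb%:R by field.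
  by rewrite rpredD// rpred_nat.
by apply/andP; split; [exact: twice h1 | exact: twice h2].
Qed.

Lemma coparseval_selection L t : coparseval Phi L -> coparseval Phi (selection L t).
Proof.
move=> cpL; have [C cC hC] := generic_sums cpL; have [cL oL _] := cpL.
split.
- apply: (@sub_countable _ _ _ [set y | L (A y)]).
    by apply: subset_card_le => y [].
  exact: (countable_preimage_cancel (plane_mapK sys)).
- exact: (selection_orthogonal sys).
- exists C => // eta /hC[h1 h2].
  exact: (selection_sum sys).
Qed.

(** At a generic point near [y] the class of [y] has positive mass, hence so have
    the other classes of its coset. *)
Lemma class_realized L y s : coparseval Phi L -> L (A y) ->
  exists y', [/\ L (A y'), r y' = r y & class y' = s].
Proof.
move=> cpL Ly; have [C cC hC] := generic_sums cpL; have [_ oL _] := cpL.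
have [eta /hC[h1 h2] pe] := generic_near y cC.
exact: (class_hit sys r_in r_const oL h1 h2).
Qed.

End GenericPoints.

(** * Parity along descents of a spectrum *)

Section OddDenominatorExtras.
Variable R : realType.
Implicit Types (x y : R) (m : int).

Lemma odd_denom_cancel_int x m : ~~ (2 %| m)%Z -> odd_denom (m%:~R * x) ->
  odd_denom x.
Proof.
case: m => k om; first by apply: odd_denom_divn; move: om; lia.
rewrite NegzE mulrNz mulNr => /odd_denomN; rewrite opprK.
by apply: odd_denom_divn; move: om; lia.
Qed.

Lemma odd_denom_cancel x y : odd2 y -> odd_denom (x * y) -> odd_denom x.
Proof.
move=> oy oxy; have [n on /intrP[m nm]] := odd2_denom oy.
have om : ~~ (2 %| m)%Z.
  apply/negP => /even2_int em; apply: (@even2_odd2 R m%:~R) => //.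
  rewrite -nm; apply: odd2M => //.
  by apply: (@odd2_int R n%:Z); move: on; lia.
apply: (odd_denom_cancel_int om); rewrite -nm -mulrA (mulrC y).
by apply: odd_denomM => //; apply: odd_denom_int; rewrite rpred_nat.
Qed.

Lemma odd_denom_pow2_int x (n : nat) m : 2 ^+ n * x = m%:~R -> odd_denom x ->
  x \is a Num.int.
Proof.
move=> hm [k ok /intrP[j kj]].
have E : k%:Z * m = 2 ^+ n * j.
  apply: (@intr_inj R); rewrite !intrM -hm -kj rmorphXn /=.
  by rewrite [k%:~R]/(k%:R) mulrCA.
have : (2 ^+ n %| m)%Z.
  rewrite -(@Gauss_dvdzr (2 ^+ n) k%:Z); first by rewrite E dvdz_mulr.
  by rewrite coprimezE abszX coprimeXl// coprime2n.
case/dvdzP => i mi; suff -> : x = i%:~R by exact: intr_int.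
have p0 : (2 : R) ^+ n != 0 by rewrite expf_neq0 ?pnatr_eq0.
by apply: (mulfI p0); rewrite hm mi intrM rmorphXn /= mulrC.
Qed.

End OddDenominatorExtras.

Section Necessity.
Variables (R : realType) (al om be : int) (a b c d : R) (Phi : R * R -> R).
Hypothesis sys : mask_system al om be a b c d Phi.
Implicit Types (x y z u v w g : R * R) (L : set (R * R)) (s : bool * bool).

Notation A := (plane_map a b c d).
Notation coords := (coords al om be).
Notation half_coset := (half_coset al om be).

Definition local2 x := odd_denom x.1 /\ odd_denom x.2.

Lemma local2D x y : local2 x -> local2 y -> local2 (x + y).
Proof. by move=> [? ?] [? ?]; split; exact: odd_denomD. Qed.

Lemma local2N x : local2 x -> local2 (- x).
Proof. by move=> [? ?]; split; exact: odd_denomN. Qed.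

Lemma local2B x y : local2 x -> local2 y -> local2 (x - y).
Proof. by move=> ? ?; apply: local2D => //; exact: local2N. Qed.

Lemma local2_lattice x : lattice x -> local2 x.
Proof. by move=> /andP[? ?]; split; exact: odd_denom_int. Qed.

Lemma local2_coords x : local2 x -> local2 (coords x).
Proof.
have oi (m : int) : odd_denom (m%:~R : R) by apply: odd_denom_int.
by move=> [h1 h2]; split; rewrite /=; [|apply: odd_denomD]; exact: odd_denomM.
Qed.

Lemma coords_local2 x : local2 (coords x) -> local2 x.
Proof.
move=> [/= h1 h2]; have x1 := odd_denom_cancel_int (ms_al sys) h1.
split=> //; apply: (odd_denom_cancel_int (ms_be sys)).
have -> : be%:~R * x.2 = om%:~R * x.1 + be%:~R * x.2 - om%:~R * x.1 by ring.
by apply: odd_denomB => //; apply: odd_denomM => //; apply: odd_denom_int.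
Qed.

Definition local_points y := [set z | half_coset (y - z) /\ local2 z].

(** A representative with odd denominators, if its coset contains one. *)
Definition local_rep y : R * R :=
  if pselect (exists z, local_points y z) then get (local_points y)
  else get [set z | half_coset (y - z)].

Lemma half_coset0 : half_coset (0 : R * R).
Proof.
by rewrite /half_coset -coordsD addr0 lattice_coords// lattice0.
Qed.

Lemma local_rep_in y : half_coset (y - local_rep y).
Proof.
rewrite /local_rep; case: pselect => [h|h]; first by have [] := getPex h.
apply: (@getPex _ [set z | half_coset (y - z)]).
by exists y; rewrite /= subrr; exact: half_coset0.
Qed.

Lemma local_rep_const y y' : half_coset (y - y') -> local_rep y = local_rep y'.
Proof.
move=> hy; have E z : half_coset (y - z) <-> half_coset (y' - z).
  split=> h.
    have -> : y' - z = - (y - y') + (y - z) by rewrite opprB addrA subrK.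
    by apply: half_cosetD => //; exact: half_cosetN.
  have -> : y - z = (y - y') + (y' - z) by rewrite addrA subrK.
  exact: half_cosetD.
have E1 : [set z | half_coset (y - z)] = [set z | half_coset (y' - z)].
  by rewrite predeqE.
have E2 : local_points y = local_points y'.
  by rewrite predeqE => z; split=> -[/E ? ?].
by rewrite /local_rep E1 E2.
Qed.

Notation class := (class al om be local_rep).

Lemma local_rep_local2 y : local2 (y + y) -> local2 (local_rep y).
Proof.
move=> hy; rewrite /local_rep; case: pselect => [h|[]]; first by have [] := getPex h.
have [h1 h2] := local2_coords hy.
have bit (p : R) : odd_denom (p + p) -> exists bb : bool, odd_denom (p - bb%:R / 2).
  move=> /odd_denom_parity[e|o]; [exists false | exists true].
    by rewrite mul0r subr0; have -> : p = (p + p) / 2 by field.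
  by have -> : p - 1 / 2 = (p + p - 1) / 2 by field.
move: h1 h2; rewrite coordsD => /bit[b1 hb1] /bit[b2 hb2].
pose u : R * R := (b1%:R / 2 / al%:~R,
  (b2%:R / 2 - om%:~R * (b1%:R / 2 / al%:~R)) / be%:~R).
have al0 : al%:~R != 0 :> R by exact: odd_intr_neq0 (ms_al sys).
have be0 : be%:~R != 0 :> R by exact: odd_intr_neq0 (ms_be sys).
have cu : coords u = (b1%:R / 2, b2%:R / 2).
  by apply: eq_pair; rewrite /=; field => //; rewrite al0 be0.
have half_half (bb : bool) : bb%:R / 2 + bb%:R / 2 = (bb%:R : R) by field.
have hu : half_coset (y - (y - u)).
  have -> : y - (y - u) = u by rewrite opprB addrCA subrr addr0.
  by rewrite /half_coset cu /lattice /= !half_half !rpred_nat.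
exists (y - u); split; first exact: hu.
by apply: coords_local2; rewrite coordsD coordsN cu; split.
Qed.

(** Two half-points of a coset with odd denominators differ by a vector whose
    mask arguments are integral. *)
Lemma class_local2 y : local2 (y + y) ->
  local2 y <-> class y = (false, false).
Proof.
move=> hy; have ry := local_rep_local2 hy.
have /andP[c1 c2] := local_rep_in y.
split=> [yl|[/negbFE h1 /negbFE h2]].
  have [l1 l2] := local2_coords (local2B yl ry).
  have key (p : R) : p + p \is a Num.int -> odd_denom p -> p \is a Num.int.
    move=> /intrP[m hm]; apply: (@odd_denom_pow2_int R p 1 m).
    by rewrite expr1 mulr_natl mulr2n.
  by rewrite /class (key _ c1 l1) (key _ c2 l2).
have : local2 (coords (y - local_rep y)).
  by apply: local2_lattice; rewrite /lattice h1.
by move=> /coords_local2 hd; rewrite -(subrK (local_rep y) y); exact: local2D.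
Qed.

(** Selects in each coset the class of the representative, that is, by
    [class_local2], the vectors with odd denominators if there are any. *)
Definition descend L := selection al om be a b c d local_rep L (fun=> (false, false)).

Lemma coparseval_descend L : coparseval Phi L -> coparseval Phi (descend L).
Proof.
by apply: (coparseval_selection sys); [exact: local_rep_in | exact: local_rep_const].
Qed.

Let A0 : A 0 = 0. Proof. exact: plane_map0. Qed.

Lemma local2_0 : local2 (0 : R * R).
Proof. by apply: local2_lattice; exact: lattice0. Qed.

Lemma class0 : class 0 = (false, false).
Proof. by apply/(class_local2 _); rewrite ?addr0; exact: local2_0. Qed.

Lemma descend0 L : L 0 -> descend L 0.
Proof. by move=> L0; split; rewrite ?A0// class0. Qed.

(** The doubles of the points of class [s] in the coset of 0.  They have odd
    denominators and lie in one residue class modulo 2, see [residueE]. *)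
Definition residue s w := local2 w /\
  exists2 z, w = z + z & lattice (coords z - bits R s).

Lemma residue_realized L s : coparseval Phi L -> L 0 ->
  exists z, L (A z) /\ residue s (z + z).
Proof.
move=> cpL L0; have LA0 : L (A 0) by rewrite A0.
have [z [Lz rz cz]] := class_realized sys local_rep_in local_rep_const s cpL LA0.
exists z; split=> //.
have bits0 : bits R (false, false) = 0 by rewrite /bits /= mul0r.
have hz : lattice (coords z - bits R s).
  have := latticeB (class_coords local_rep_in z) (class_coords local_rep_in 0).
  rewrite rz cz class0 bits0 subr0 sub0r coordsD coordsN opprK.
  by rewrite addrAC subrK.
split; last by exists z.
apply: coords_local2; apply: local2_lattice.
have -> : coords (z + z) = (coords z - bits R s) + (coords z - bits R s) +
    (bits R s + bits R s).
  by rewrite coordsD addrACA !subrK.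
apply: latticeD; first exact: latticeD.
have half_half (bb : bool) : bb%:R / 2 + bb%:R / 2 = (bb%:R : R) by field.
by rewrite /lattice /= !half_half !rpred_nat.
Qed.

Lemma residueE s w : residue s w -> [/\ local2 w,
  even2 (al%:~R * w.1 - s.1%:R) & even2 (om%:~R * w.1 + be%:~R * w.2 - s.2%:R)].
Proof.
move=> [wl [z wz /andP[/= h1 h2]]]; split=> //; rewrite wz /even2 /=.
  by apply: odd_denom_int; have -> : (al%:~R * (z.1 + z.1) - s.1%:R) / 2 =
    al%:~R * z.1 - s.1%:R / 2 by field.
apply: odd_denom_int.
by have -> : (om%:~R * (z.1 + z.1) + be%:~R * (z.2 + z.2) - s.2%:R) / 2 =
    om%:~R * z.1 + be%:~R * z.2 - s.2%:R / 2 by field.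
Qed.

Lemma even2_cancel (x : R) m : ~~ (2 %| m)%Z -> odd_denom x ->
  even2 (m%:~R * x) -> even2 x.
Proof.
move=> om' /odd_denom_parity[//|ox] em; case: (even2_odd2 em).
by apply: odd2M => //; exact: odd2_int.
Qed.

Lemma odd2_cancel (x : R) m : ~~ (2 %| m)%Z -> odd_denom x ->
  odd2 (m%:~R * x) -> odd2 x.
Proof.
move=> om' /odd_denom_parity[ex|//] oo; case: (even2_odd2 _ oo).
by apply: even2Mr => //; apply: odd_denom_int.
Qed.

Lemma residue01 w : residue (false, true) w -> even2 w.1 /\ odd2 w.2.
Proof.
move=> /residueE[[w1 w2] /= h1 h2].
have e1 : even2 w.1 by apply: (even2_cancel (ms_al sys)) => //; rewrite subr0 in h1.
split=> //; apply: (odd2_cancel (ms_be sys)) => //.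
have -> : be%:~R * w.2 = 1 - om%:~R * w.1 + (om%:~R * w.1 + be%:~R * w.2 - 1) by ring.
apply: odd2Dl => //; apply: odd2Dl; first by apply: (@odd2_int R 1).
by apply: even2N; apply: even2Mr => //; apply: odd_denom_int.
Qed.

Lemma residue10 w : residue (true, ~~ (2 %| om)%Z) w -> odd2 w.1 /\ even2 w.2.
Proof.
move=> /residueE[[w1 w2] /= h1 h2].
have o1 : odd2 w.1 by apply: (odd2_cancel (ms_al sys)).
split=> //; apply: (even2_cancel (ms_be sys)) => //.
move: h2; have [eo|oo] := boolP (2 %| om)%Z => h2.
  have -> : be%:~R * w.2 = (om%:~R * w.1 + be%:~R * w.2 - 0) - om%:~R * w.1 by ring.
  by apply: even2D => //; apply: even2N; apply: even2Ml => //; exact: even2_int.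
have -> : be%:~R * w.2 = (om%:~R * w.1 + be%:~R * w.2 - 1) + (1 - om%:~R * w.1) by ring.
apply: even2D => //; apply: even2_addoo; first by apply: (@odd2_int R 1).
by apply: odd2N; apply: odd2M => //; exact: odd2_int.
Qed.

(** The vectors over Z_(2) that are nonzero modulo 2. *)
Definition unimodular w := local2 w /\ (odd2 w.1 \/ odd2 w.2).

Lemma iter_descend L n x : iter n descend L x -> L (iter n A x).
Proof.
elim: n x => [//|n ih] x /= [/ih]; rewrite -iterSr.
by [].
Qed.

(** Realize the class [s] at a point [z] in the [i.+1]-fold descent of [L].  Then
    [x = iter i.+1 A z] belongs to the descent of [L] while [x + x] has odd
    denominators, so [x] itself has odd denominators and [x + x] is even. *)
Lemma no_recurrent_residue L s i : coparseval Phi L -> L 0 ->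
  (forall w, residue s w -> unimodular (iter i.+1 A w)) -> False.
Proof.
move=> cpL L0 hi.
have cp n : coparseval Phi (iter n descend L) /\ iter n descend L 0.
  elim: n => [//|n [ih1 ih2]]; split=> /=; first exact: coparseval_descend.
  exact: descend0.
have [cpi Li0] := cp i.+1.
have [z [Lz rz]] := residue_realized s cpi Li0.
have Dx : descend L (iter i A (A z)).
  by move: Lz; rewrite iterSr => /iter_descend.
have [_ cx] := Dx.
have [ul uo] := hi _ rz.
have E : iter i.+1 A (z + z) = iter i.+1 A z + iter i.+1 A z.
  exact: iter_plane_mapD (@plane_mapD _ a b c d) _ _ _.
move: ul uo; rewrite E iterSr => ul uo.
have [x1 x2] := (class_local2 ul).2 cx.
have dbl (p : R) : odd_denom p -> even2 (p + p).
  by move=> hp; rewrite /even2 (_ : (p + p) / 2 = p) //; field.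
by case: uo => /=; [exact: even2_odd2 (dbl _ x1) | exact: even2_odd2 (dbl _ x2)].
Qed.

(** Realize [s] at [y] over [L] and [t] at [z] over the descent of [L].  By
    orthogonality [Phi] vanishes at the difference [y - A z], which therefore is
    an image under some [iter j A] of a zero of the mask; [g] is the double of
    this zero. *)
Lemma residue_difference L s t : coparseval Phi L -> L 0 ->
  exists u w g j, [/\ residue s u, residue t w, local2 g & u - A w = iter j A g].
Proof.
move=> cpL L0.
have [y [Ly ry]] := residue_realized s cpL L0.
have [z [[Lz _] rz]] := residue_realized t (coparseval_descend cpL) (descend0 L0).
exists (y + y), (z + z).
have dE : y + y - A (z + z) = (y - A z) + (y - A z).
  by rewrite plane_mapD opprD addrACA.
have [E|E] := eqVneq (A y) (A (A z)).
  exists 0, 0%N; split=> //; first exact: local2_0.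
  by rewrite dE (can_inj (plane_mapK sys) E) subrr addr0.
have [_ oL _] := cpL.
have := oL _ _ Ly Lz E; rewrite -plane_mapB => /(phi_eq0 sys)[j].
rewrite iterSr (plane_mapK sys); set e := iter j _ _ => /cube_mask_eq0[/= h1 h2 _].
exists (e + e), j; split=> //.
  apply: coords_local2; apply: local2_lattice; rewrite coordsD /lattice /=.
  have dbl (p : R) : p + p = 2 * p by rewrite mulr_natl mulr2n.
  by rewrite !dbl h1.
rewrite dE (iter_plane_mapD (@plane_mapD _ a b c d)).
by rewrite /e (iter_plane_invK sys).
Qed.

End Necessity.

(** * Necessity of even entries *)

Section Combination.
Variables (R : realType) (a b c d : R).
Notation A := (plane_map a b c d).
Implicit Types (x : R * R) (p q : R).

(** The action of the polynomial [p A + q] in the matrix [A]. *)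
Definition comb p q x : R * R :=
  (p * (A x).1 + q * x.1, p * (A x).2 + q * x.2).

Lemma comb01 x : comb 0 1 x = x.
Proof. by apply: eq_pair => /=; ring. Qed.

Lemma plane_map_comb p q x :
  A (comb p q x) = comb ((a + d) * p + q) (- (a * d - b * c) * p) x.
Proof. by apply: eq_pair => /=; ring. Qed.

Lemma comb_comb p q p' q' x : comb p q (comb p' q' x) =
  comb (p * ((a + d) * p' + q') + q * p') (q * q' - (a * d - b * c) * (p * p')) x.
Proof. by apply: eq_pair => /=; ring. Qed.

End Combination.

Section IntegralCombination.
Variables (R : realType) (a b c d : R) (tau delta : int).
Hypotheses (tauE : a + d = tau%:~R) (deltaE : a * d - b * c = delta%:~R).
Notation A := (plane_map a b c d).
Notation comb := (comb a b c d).

(** Passing from [A ^ n] to [A ^ n.+1] replaces the coefficient [q] by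
    [- delta p]. *)
Lemma iter_comb_even (x : R * R) n : (2 %| delta)%Z -> exists p q : int,
  iter n A x = comb p%:~R q%:~R x /\ ((2 %| p)%Z || (2 %| q)%Z).
Proof.
move=> de; elim: n => [|n [p [q [E _]]]].
  by exists 0, 1; rewrite comb01.
exists (tau * p + q), (- delta * p).
rewrite iterS E plane_map_comb tauE deltaE; split.
  by rewrite !(intrD, intrM, intrN).
by apply/orP; right; rewrite mulNr rpredN dvdz_mulr.
Qed.

(** The matrix is invertible modulo 2, so its power 2 or 3 is scalar modulo 2.
    Squaring [p A + q] turns [p] into [p (tau p + 2 q)], which gains a factor 2
    each time. *)
Lemma iter_comb_pow2 n : ~~ (2 %| delta)%Z -> exists i (p q : int),
  [/\ forall x, iter i.+1 A x = comb p%:~R q%:~R x, (2 ^+ n.+1 %| p)%Z &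
      ~~ (2 %| q)%Z].
Proof.
move=> dodd; elim: n => [|n [i [p [q [ih pn qo]]]]].
  have step1 x : A x = comb 1 0 x by apply: eq_pair => /=; ring.
  have step2 x : A (A x) = comb tau%:~R (- delta)%:~R x.
    by rewrite (step1 x) plane_map_comb tauE deltaE !mulr1 addr0 intrN.
  have [te|to] := boolP (2 %| tau)%Z.
    by exists 1%N, tau, (- delta); split=> //=; rewrite ?expr1 ?rpredN.
  exists 2, (tau * tau - delta), (- delta * tau); split.
  - move=> x; rewrite -[iter 3 A x]/(A (A (A x))) (step2 x) plane_map_comb tauE deltaE.
    by rewrite !(intrD, intrM, intrN).
  - by rewrite expr1; have := odd_mulz to to; lia.
  - by rewrite mulNr rpredN; exact: odd_mulz.
exists (i.+1 + i)%N, (p * (tau * p + q) + q * p), (q * q - delta * (p * p)); split.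
- move=> x; rewrite -addnS iterD !ih comb_comb tauE deltaE.
  by rewrite !(intrD, intrM, intrN).
- have /dvdzP[k pk] := pn; apply/dvdzP.
  exists (k * (tau * (k * 2 ^+ n) + q)).
  by rewrite pk !exprS; ring.
- have /dvdzP[k pk] : (2 %| p)%Z by apply: dvdz_trans pn; rewrite exprS dvdz_mulr.
  apply: contra qo => he.
  have : (2 %| q * q)%Z.
    rewrite -[q * q](subrK (delta * (p * p))) rpredD//.
    by rewrite pk; apply/dvdzP; exists (delta * (k * (k * 2))); ring.
  by have [//|qo'] := boolP (2 %| q)%Z; rewrite (negPf (odd_mulz qo' qo')).
Qed.

End IntegralCombination.

Section NecessityEven.
Variables (R : realType) (al om be : int) (a b c d : R) (Phi : R * R -> R).
Hypothesis sys : mask_system al om be a b c d Phi.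
Variables (ta tb tc td : int) (n : nat).
Hypotheses (aE : a = ta%:~R) (bE : b = 2 ^+ n.+1 * tb%:~R)
  (cE : 2 ^+ n.+1 * c = tc%:~R) (dE : d = td%:~R).
Variable L : set (R * R).
Hypotheses (cpL : coparseval Phi L) (L0 : L 0).
Notation A := (plane_map a b c d).

Let odi (m : int) : odd_denom (m%:~R : R). Proof. exact: odd_denom_int. Qed.

Let b_even : even2 b.
Proof.
rewrite bE exprS -mulrA; apply: even2Ml; first by apply: (@even2_int R 2).
by apply: odd_denomM => //; apply: odd_denom_int; rewrite rpredX ?rpred_nat.
Qed.

Let bcE : b * c = (tb * tc)%:~R.
Proof. by rewrite bE mulrAC cE mulrC intrM. Qed.

Let deltaE : a * d - b * c = (ta * td - tb * tc)%:~R.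
Proof. by rewrite bcE aE dE intrB !intrM. Qed.

Let tauE : a + d = (ta + td)%:~R.
Proof. by rewrite aE dE intrD. Qed.

Let od_a : odd_denom a. Proof. by rewrite aE. Qed.
Let od_d : odd_denom d. Proof. by rewrite dE. Qed.
Let od_b : odd_denom b. Proof. exact: even2_denom. Qed.

(** One application of an integral matrix already maps a residue class to nonzero
    vectors modulo 2 if [ta], or else [c] or [td], is odd: the class of the first
    or of the second basis vector. *)
Lemma necessary_integral : c \is a Num.int ->
  [/\ (2 %| ta)%Z, (2 %| td)%Z & c / 2 \is a Num.int].
Proof.
move=> /intrP[k ck].
have od_c : odd_denom c by rewrite ck.
have local2A w : local2 w -> local2 (A w).
  by move=> [w1 w2]; split=> /=; apply: odd_denomD; exact: odd_denomM.
have [tae|tao] := boolP (2 %| ta)%Z; last first.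
  case: (@no_recurrent_residue _ _ _ _ _ _ _ _ _ sys L (true, ~~ (2 %| om)%Z) 0 cpL L0) => w rw.
  have [[lw _] [w1 w2]] := (rw, residue10 sys rw); split; first exact: local2A.
  left; rewrite /=; apply: odd2Dl; first by rewrite aE; apply: odd2M => //; exact: odd2_int.
  exact: even2Mr.
have F : ~~ (2 %| k)%Z \/ ~~ (2 %| td)%Z -> False.
  move=> ktd; apply: (@no_recurrent_residue _ _ _ _ _ _ _ _ _ sys L (false, true) 0 cpL L0) => w rw.
  have [[lw _] [w1 w2]] := (rw, residue01 sys rw); split; first exact: local2A.
  case: ktd => h; [left | right]; rewrite /=.
    by apply: odd2Dr; [exact: even2Mr | apply: odd2M => //; rewrite ck; exact: odd2_int].
  by apply: odd2Dr; [exact: even2Mr | apply: odd2M => //; rewrite dE; exact: odd2_int].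
have [ke|ko] := boolP (2 %| k)%Z; last by case: F; left.
have [tde|tdo] := boolP (2 %| td)%Z; last by case: F; right.
split=> //; have /dvdzP[j kj] := ke.
by rewrite ck kj intrM mulfK ?pnatr_eq0// intr_int.
Qed.

(** The first coordinate of [u - A w = (p A + q) g] shows that [c] times
    [w.2 + p g.2] has odd denominator, so that this factor is even when [c] is
    not an integer.  Modulo 2 the second coordinate becomes [q g.2 = u.2 = 1], so
    [q] is odd, [p] is even and [w.2] would be even. *)
Lemma integral_of_even_det : (2 %| ta * td - tb * tc)%Z -> c \is a Num.int.
Proof.
move=> de; apply/negP => /negP cni.
have [u [w [g [j [ru rw [g1 g2] E]]]]] :=
  residue_difference sys (false, true) (false, true) cpL L0.
have [[u1 u2] _] := ru; have [[w1 w2] _] := rw.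
have [_ ou] := residue01 sys ru; have [_ ow] := residue01 sys rw.
have [p [q [Ej pq]]] := iter_comb_even tauE deltaE g j de.
rewrite {}Ej in E.
have [E1 E2] : u.1 - (a * w.1 + c * w.2) = p%:~R * (a * g.1 + c * g.2) + q%:~R * g.1 /\
    u.2 - (b * w.1 + d * w.2) = p%:~R * (b * g.1 + d * g.2) + q%:~R * g.2.
  by split; [exact: (congr1 (@fst R R) E) | exact: (congr1 (@snd R R) E)].
have hc : odd_denom (c * (w.2 + p%:~R * g.2)).
  have -> : c * (w.2 + p%:~R * g.2) = u.1 - a * w.1 - p%:~R * (a * g.1) - q%:~R * g.1.
    by lra.
  by do ![apply: odd_denomB | apply: odd_denomM].
have od_wg : odd_denom (w.2 + p%:~R * g.2) by apply: odd_denomD => //; exact: odd_denomM.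
case: (odd_denom_parity od_wg) => [ewg|owg]; last first.
  by move: cni; rewrite (odd_denom_pow2_int cE (odd_denom_cancel owg hc)).
have oqg : odd2 (q%:~R * g.2).
  have -> : q%:~R * g.2 = u.2 - b * (w.1 + p%:~R * g.1) - d * (w.2 + p%:~R * g.2).
    by lra.
  apply: odd2Dl; last by apply: even2N; exact: even2Mr.
  apply: odd2Dl => //; apply: even2N; apply: even2Ml => //.
  by apply: odd_denomD => //; exact: odd_denomM.
have pe : (2 %| p)%Z.
  case/orP: pq => // qe; case: (even2_odd2 _ oqg).
  by apply: even2Ml => //; exact: even2_int.
apply: (even2_odd2 ewg); apply: odd2Dl => //; apply: even2Ml => //; exact: even2_int.
Qed.

(** In the power [p A + q] of the matrix given by [iter_comb_pow2] the factor
    [2 ^+ n.+1] of [p] absorbs the denominator of [c], and [q] odd preserves the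
    residue class of the second basis vector. *)
Lemma even_det_necessary : (2 %| ta * td - tb * tc)%Z.
Proof.
apply/negP => /negP dodd.
have [i [p [q [E /dvdzP[k pk] qo]]]] := iter_comb_pow2 tauE deltaE n dodd.
apply: (@no_recurrent_residue _ _ _ _ _ _ _ _ _ sys L (false, true) i cpL L0) => w rw.
have [[[l1 l2] _] [w1 w2]] := (rw, residue01 sys rw).
have ep : even2 (p%:~R : R).
  by apply: even2_int; rewrite pk exprS mulrCA dvdz_mulr.
have o2 : odd2 (p%:~R * (b * w.1 + d * w.2) + q%:~R * w.2).
  apply: odd2Dr; last by apply: odd2M => //; exact: odd2_int.
  by apply: even2Ml => //; apply: odd_denomD; exact: odd_denomM.
rewrite E; split; last by right.
split; last exact: odd2_denom.
rewrite /=.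
have -> : p%:~R * (a * w.1 + c * w.2) + q%:~R * w.1 =
    p%:~R * a * w.1 + k%:~R * tc%:~R * w.2 + q%:~R * w.1.
  by rewrite -cE pk intrM rmorphXn /=; ring.
by do ![apply: odd_denomD | apply: odd_denomM].
Qed.

End NecessityEven.

(** After a translation the spectrum contains 0, the base point of the descents. *)
Theorem mask_system_necessary (R : realType) (al om be : int) (a b c d : R)
    (Phi : R * R -> R) (ta tb tc td : int) (n : nat) (L : set (R * R)) :
  mask_system al om be a b c d Phi ->
  a = ta%:~R -> b = 2 ^+ n.+1 * tb%:~R -> 2 ^+ n.+1 * c = tc%:~R ->
  d = td%:~R -> parseval_set Phi L ->
  [/\ (2 %| ta)%Z, (2 %| td)%Z & c / 2 \is a Num.int].
Proof.
move=> sys aE bE cE dE pL; have [_ _ dL] := pL.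
have [F [_ FL]] := dL 0 1 ltr01; case: F FL => [|k F] FL.
  by rewrite subrr big_nil ltxx.
move=> _; have cpL := coparseval_translate k (parseval_coparseval sys pL).
have L0 : [set x | L (x + k)] 0 by rewrite /= add0r; apply: FL; rewrite mem_head.
apply: (necessary_integral sys aE bE dE cpL L0).
apply: (integral_of_even_det sys aE bE cE dE cpL L0).
exact: (even_det_necessary sys aE bE cE dE cpL L0).
Qed.

(** * Determinant, trace and the conjugate matrix *)

Lemma det2 (S : comRingType) (A : 'M[S]_2) :
  \det A = A 0 0 * A 1 1 - A 0 1 * A 1 0.
Proof.
rewrite (expand_det_row _ ord0) !big_ord_recl big_ord0 /cofactor !det_mx11 !mxE.
rewrite /= expr0 expr1 mul1r mulN1r addr0 mulrN.
by congr (A _ _ * A _ _ - A _ _ * A _ _); apply: val_inj.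
Qed.

Lemma mxtrace2 (S : comRingType) (A : 'M[S]_2) : \tr A = A 0 0 + A 1 1.
Proof.
rewrite /mxtrace !big_ord_recl big_ord0 addr0.
by congr (A _ _ + A _ _); apply: val_inj.
Qed.

(** The quadratic polynomial is the characteristic one. *)
Lemma expansive_quadratic (R : realType) (A : 'M[R]_2) (z : R[i]) :
  expansive A -> z ^+ 2 - (\tr A)%:C%C * z + (\det A)%:C%C = 0 -> 1 < `|z|.
Proof.
move=> eA Ez; apply: eA; rewrite /eigenvalue /eigenspace kermx_eq0 row_free_unit.
rewrite unitmxE unitfE negbK; apply/eqP; rewrite -[RHS]Ez.
rewrite !det2 mxtrace2 !mxE /= !rmorphD rmorphN !rmorphM /=.
by rewrite !mulr1n !mulr0n; ring.
Qed.

Lemma tildeM_similar (Q M : 'M[int]_2) : Q \in unitmx ->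
  \det (tildeM Q M) = \det M /\ \tr (tildeM Q M) = \tr M.
Proof.
move=> uQ; rewrite /tildeM; split.
  by rewrite !det_mulmx det_inv mulrAC mulrV ?mul1r// -unitmxE.
by rewrite mxtrace_mulC mulKmx.
Qed.

Lemma tildeM_quadratic (R : realType) (Q M : 'M[int]_2) (ta tb tc td : int) :
  expansive (int_to_realmx R M) -> \det Q = 1 ->
  tildeM Q M = mx2 ta tb tc td -> forall z : R[i],
  z ^+ 2 - (ta%:~R + td%:~R : R)%:C%C * z +
    (ta%:~R * td%:~R - tb%:~R * tc%:~R : R)%:C%C = 0 -> 1 < `|z|.
Proof.
move=> eM dQ E z; have uQ : Q \in unitmx by rewrite unitmxE dQ.
have [hd ht] := tildeM_similar M uQ; rewrite E in hd ht.
have trE : \tr (int_to_realmx R M) = ta%:~R + td%:~R.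
  by rewrite trace_map_mx /= -ht mxtrace2 !mxE /= intrD.
have detE : \det (int_to_realmx R M) = ta%:~R * td%:~R - tb%:~R * tc%:~R.
  by rewrite det_map_mx /= -hd det2 !mxE /= intrB !intrM.
by rewrite -trE -detE; exact: expansive_quadratic.
Qed.

(** * The mask system of the transformed measure *)

Section PlanarMeasure.
Variables (R : realType) (ta tb tc td al om be : int) (eta : nat).
Variable mu : probability (Rn R 2) R.

Notation scale := (2 ^+ eta : R).
Let A : 'M[R]_2 := int_to_realmx R (mx2 ta tb tc td).
Let D : {fset 'cV[R]_2} := int_to_realset R
  [fset vec2 0 0; vec2 al 0; vec2 om (2 ^+ eta * be);
        vec2 (- al - om) (- (2 ^+ eta * be))]%fset.

Hypothesis expanding : forall z : R[i],
  z ^+ 2 - (ta%:~R + td%:~R : R)%:C%C * z +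
    (ta%:~R * td%:~R - tb%:~R * tc%:~R : R)%:C%C = 0 -> 1 < `|z|.
Hypotheses (al_odd : ~~ (2 %| al)%Z) (be_odd : ~~ (2 %| be)%Z).
Hypothesis mu_affine : self_affine_measure A D mu.

Definition col2 (x y : R) : 'cV[R]_2 := \col_i (if i == 0 then x else y).

(** The rescaling by [2 ^+ eta] that makes the mask depend on the odd part [be]
    of the second digit coordinate only. *)
Definition frequency (z : R * R) := col2 z.1 (z.2 / scale).
Definition unfrequency (l : 'cV[R]_2) : R * R := (l 0 0, scale * l 1 0).

Let scale0 : scale != 0. Proof. by rewrite expf_neq0 ?pnatr_eq0. Qed.

Lemma ord2P (i : 'I_2) : i = 0 \/ i = 1.
Proof. by case: i => [[|[|]]]// hi; [left | right]; apply: val_inj. Qed.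

Lemma eq_col2 (u v : 'cV[R]_2) : u 0 0 = v 0 0 -> u 1 0 = v 1 0 -> u = v.
Proof.
by move=> h0 h1; apply/matrixP => i j; rewrite (ord1 j); case: (ord2P i) => ->.
Qed.

Lemma sum2 (f : 'I_2 -> R) : \sum_i f i = f 0 + f 1.
Proof.
by rewrite !big_ord_recl big_ord0 addr0; congr (f _ + f _); apply: val_inj.
Qed.

Lemma frequencyK : cancel frequency unfrequency.
Proof.
by move=> z; apply: eq_pair; rewrite /= !mxE //= mulrC divfK.
Qed.

Lemma unfrequencyK : cancel unfrequency frequency.
Proof.
by move=> l; apply: eq_col2; rewrite !mxE //= mulrC mulKf.
Qed.

Lemma frequencyD x y : frequency (x + y) = frequency x + frequency y.
Proof. by apply: eq_col2; rewrite !mxE //= mulrDl. Qed.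

Lemma frequencyN x : frequency (- x) = - frequency x.
Proof. by apply: eq_col2; rewrite !mxE //= mulNr. Qed.

Lemma unfrequencyB x y : unfrequency (x - y) = unfrequency x - unfrequency y.
Proof.
by apply: (can_inj frequencyK); rewrite frequencyD frequencyN !unfrequencyK.
Qed.

Definition plane_power z := power mu (frequency z).

Notation a := (ta%:~R : R).
Notation b := (scale * tb%:~R).
Notation c := (tc%:~R / scale).
Notation d := (td%:~R : R).

Lemma frequency_plane_map z :
  frequency (plane_map a b c d z) = A^T *m frequency z.
Proof.
by apply: eq_col2; rewrite !mxE sum2 !mxE /=; field.
Qed.

Let digit_seq : seq 'cV[R]_2 :=
  [:: col2 0 0; col2 al%:~R 0; col2 om%:~R (scale * be%:~R);
      col2 (- al%:~R - om%:~R) (- (scale * be%:~R))].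

Lemma perm_digits : perm_eq D digit_seq.
Proof.
have al0 : al%:~R != 0 :> R by exact: odd_intr_neq0.
have be0 : scale * be%:~R != 0 :> R.
  by rewrite mulf_neq0// odd_intr_neq0.
have self_opp : scale * be%:~R != - (scale * be%:~R).
  by rewrite -addr_eq0 -mulr2n mulrn_eq0 negb_or.
have col2_eq (x y x' y' : R) : (col2 x y == col2 x' y') = (x == x') && (y == y').
  apply/eqP/andP => [/matrixP E|[/eqP -> /eqP ->]//].
  by have := E 0 0; have := E 1 0; rewrite !mxE /= => -> ->.
have vecE (x y : int) : int_to_realmx R (vec2 x y) = col2 x%:~R y%:~R.
  by apply: eq_col2; rewrite !mxE.
apply: uniq_perm; first exact: fset_uniq.
  rewrite /= !inE !col2_eq !eqxx !(eq_sym 0) oppr_eq0 (negbTE al0) (negbTE be0).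
  by rewrite (negbTE self_opp) !andbF.
move=> l; rewrite /D /int_to_realset !imfsetU !imfset_fset1 /= !inE !vecE.
by rewrite !(intrD, intrM, intrN) !rmorphXn /= -!orbA.
Qed.

Lemma card_digits : #|` D| = 4%N.
Proof. by rewrite (perm_size perm_digits). Qed.

Lemma sqmod_mask z : sqmod (mask D (frequency z)) =
  cube_mask (al%:~R * z.1) (om%:~R * z.1 + be%:~R * z.2).
Proof.
rewrite cube_mask_sqmod /mask card_digits; congr (sqmod (_ * _)).
have -> : \sum_(k < 4) expchar (frequency z) (nth 0 (enum_fset D) k) =
    \sum_(x <- D) expchar (frequency z) x.
  by rewrite [RHS](big_nth 0) card_digits big_mkord.
rewrite (perm_big _ perm_digits) /= !big_cons big_nil addr0 !addrA.
have E x y t : x * z.1 + y / scale * z.2 = t ->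
    expchar (frequency z) (col2 x y) = Complex (cos (2 * pi * t)) (sin (2 * pi * t)).
  move=> <-; rewrite /expchar; suff -> : dotv (frequency z) (col2 x y) =
    x * z.1 + y / scale * z.2 by [].
  by rewrite /dotv sum2 !mxE /=; field.
rewrite (E 0 0 0); last by field.
rewrite (E _ _ (al%:~R * z.1)); last by field.
rewrite (E _ _ (om%:~R * z.1 + be%:~R * z.2)); last by field.
rewrite (E _ _ (- (al%:~R * z.1) - (om%:~R * z.1 + be%:~R * z.2))); last by field.
by rewrite mulr0 cos0 sin0.
Qed.

Let detE : \det A = a * d - tb%:~R * tc%:~R.
Proof. by rewrite det2 !mxE. Qed.

Let det0 : a * d - tb%:~R * tc%:~R != 0 :> R.
Proof.
apply/eqP => E; have := @expanding 0.
by rewrite E expr0n mulr0 subrr /= add0r => /(_ erefl); rewrite normr0 ltr10.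
Qed.

Let A_unit : A \in unitmx.
Proof. by rewrite unitmxE detE unitfE. Qed.

(** The norm expanded by the matrix is contracted by the maps of the system.  It
    is continuous because it is subadditive and bounded by a multiple of the
    standard one. *)
Lemma support_in_box : exists K : R, mu (~` box K) = 0%E.
Proof.
have [N [rho [C [rho01 C0 ND NC Nrho]]]] := expanding_norm expanding.
pose co (x : 'cV[R]_2) : R * R := (x 0 0, x 1 0).
have coD x y : co (x + y) = co x + co y by apply: eq_pair; rewrite /= mxE.
have coA x : (a * (co x).1 + tb%:~R * (co x).2, tc%:~R * (co x).1 + d * (co x).2)
    = co (A *m x) by apply: eq_pair; rewrite /= mxE sum2 !mxE.
have Nge0 u : 0 <= N u by apply: le_trans (NC u).1.
have NB u v : N u - N v <= C * (`|u.1 - v.1| + `|u.2 - v.2|).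
  have := ND (u - v) v; rewrite subrK => h.
  have [_ [_ h']] := NC (u - v); rewrite /= in h'.
  by rewrite lerBlDr; apply: le_trans h _; rewrite lerD2r.
have mN : measurable_fun setT (N \o co : Rn R 2 -> R).
  apply: continuous_measurable_Rn => x.
  have FF : Filter (nbhs x) by exact: nbhs_filter.
  apply/(@cvgrPdist_lt _ _ _ (nbhs x) FF) => eps eps0.
  pose e1 := eps / (2 * C + 1).
  have C1 : 0 < 2 * C + 1 by lra.
  have e10 : 0 < e1 by rewrite divr_gt0.
  have near_i i : nbhs x [set y : 'cV[R]_2 | `|x i 0 - y i 0| < e1].
    have := @coord_continuous R 2 1 i 0 x.
    by move=> /cvgrPdist_lt /(_ _ e10).
  have := filter_forall FF near_i; apply: filterS => y yx.
  have y0 := yx 0; have y1 := yx 1.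
  have epsE : eps = e1 * (2 * C + 1) by rewrite /e1 divfK// gt_eqF.
  have B1 := NB (co x) (co y); have B2 := NB (co y) (co x).
  rewrite /= in B1 B2; rewrite (distrC (y 0 0)) (distrC (y 1 0)) in B2.
  have Cb : C * (`|x 0 0 - y 0 0| + `|x 1 0 - y 1 0|) <= C * (e1 + e1).
    by rewrite ler_wpM2l// lerD// ltW.
  by rewrite /= ltr_norml epsE; apply/andP; split; nra.
have D_gt0 : (0 < #|` D|)%N by rewrite card_digits.
have Ninv x : N (co (invmx A *m x)) <= rho * N (co x).
  by have := Nrho (co (invmx A *m x)); rewrite coA mulKVmx.
have NcoD x y : N (co (x + y)) <= N (co x) + N (co y) by rewrite coD.
have [K muK] := bounded_support mu_affine D_gt0 rho01 mN NcoD
  (fun x => Nge0 (co x)) Ninv.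
exists K; apply/eqP; rewrite eq_le measure_ge0 andbT -muK.
apply: le_measure.
- by rewrite inE; apply: measurableC; exact: measurable_box.
- rewrite inE -[X in measurable X]setTI.
  have := @measurable_fun_ltr _ (Rn R 2) R setT (fun=> K) (N \o co).
  by move=> /(_ _ mN measurableT [set true]); exact.
move=> x; rewrite /box /= => nK; rewrite ltNge; apply/negP => NK; apply: nK => i.
apply: le_trans NK; have [h1 [h2 _]] := NC (co x).
by case: (ord2P i) => ->.
Qed.

Lemma self_affine_compact : compactly_supported mu.
Proof. by have [K] := support_in_box; exact: compactly_supported_box. Qed.

Lemma plane_mask_system : mask_system al om be a b c d plane_power.
Proof.
have [K muK] := support_in_box.
have bc : b * c = tb%:~R * tc%:~R by field.
split=> //.
- by rewrite bc.
- move=> z; rewrite /plane_power frequency_plane_map.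
  by rewrite (power_self_affine A_unit mu_affine) ?sqmod_mask// card_digits.
- rewrite /plane_power (_ : frequency 0 = 0) ?power0//.
  by apply: eq_col2; rewrite !mxE //= mul0r.
- by move=> z; exact: power_ge0.
- by move=> z; rewrite /plane_power frequencyN powerN.
- have [C C0 hC] := power_lipschitz muK.
  exists C => // x h; rewrite /plane_power frequencyD; apply: le_trans (hC _ _) _.
  rewrite ler_wpM2l// sum2 !mxE /= lerD2l normrM.
  rewrite (@ger0_norm _ scale^-1) ?invr_ge0 ?exprn_ge0//.
  by rewrite ler_piMr// invf_le1 ?exprn_gt0// exprn_ege1// ler1n.
- move=> F k uF oF.
  have inj : injective frequency := can_inj frequencyK.
  have := @power_bessel R 2 mu [seq frequency l | l <- F] (frequency k).
  rewrite (map_inj_uniq inj) => /(_ uF); rewrite big_map => h.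
  apply: le_trans (h _); last first.
    move=> _ _ /= /mapP[l lF ->] /mapP[l' l'F ->] ne.
    rewrite -frequencyN -frequencyD; apply: oF => //.
    by apply: contra ne => /eqP ->.
  by apply: ler_sum => l _; rewrite /plane_power frequencyD frequencyN.
- apply: expanding_norm => z; rewrite (mulrC c) bc; exact: expanding.
Qed.

(** The rescaling of frequencies is an additive bijection. *)
Lemma spectral_plane_power :
  spectral_measure mu <-> exists L, parseval_set plane_power L.
Proof.
apply: (iff_trans (spectral_measureP self_affine_compact)).
split=> -[L pL].
  exists [set z | L (frequency z)].
  by apply: parseval_set_transfer frequencyK unfrequencyK _ pL => x y;
    rewrite frequencyD frequencyN.
exists [set l | L (unfrequency l)].
have -> : power mu = plane_power \o unfrequency.
  by apply/funext => l; rewrite /plane_power /= unfrequencyK.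
exact: parseval_set_transfer unfrequencyK frequencyK unfrequencyB pL.
Qed.

(** The coefficient [b = 2 ^+ eta * tb] is an even integer since [eta] is
    positive, and [c / 2 = tc / 2 ^+ eta.+1]. *)
Lemma spectral_iff : (0 < eta)%N -> spectral_measure mu <->
  [/\ (2 %| ta)%Z, (2 %| td)%Z & ((2 : int) ^+ eta.+1 %| tc)%Z].
Proof.
move=> eta0; apply: (iff_trans spectral_plane_power).
have halfint (m : int) : (2 %| m)%Z -> (m%:~R / 2 : R) \is a Num.int.
  by move=> /dvdzP[k ->]; rewrite intrM mulfK ?pnatr_eq0// intr_int.
split=> [[L pL]|[ta2 td2 /dvdzP[k tcE]]].
  have cE : 2 ^+ eta.-1.+1 * c = tc%:~R by rewrite prednK// mulrC divfK.
  have bE : b = 2 ^+ eta.-1.+1 * tb%:~R by rewrite prednK.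
  have [ta2 td2 /intrP[k c2]] :=
    mask_system_necessary plane_mask_system erefl bE cE erefl pL.
  split=> //; apply/dvdzP; exists k; apply: (@intr_inj R).
  by rewrite intrM rmorphXn /= -c2 exprSr; field.
apply: (mask_system_parseval plane_mask_system); first exact: halfint.
- have -> : b / 2 = 2 ^+ eta.-1 * tb%:~R by rewrite -{1}(prednK eta0) exprS; field.
  by rewrite rpredM// ?intr_int// rpredX// rpred_nat.
- have -> : c / 2 = k%:~R; last exact: intr_int.
  by rewrite tcE intrM rmorphXn /= exprS; field.
- exact: halfint.
Qed.

End PlanarMeasure.

(** * Spectrality of the transformed measure *)

Theorem theorem1p6 (R : realType) (M : 'M[int]_2) (a1 a2 b1 b2 : int)
    (eta : nat) (gamma alpha t1 t2 p q : int)
    (Mexp : expansive (int_to_realmx R M))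
    (det0 : a1 * b2 - a2 * b1 != 0)
    (gcd1 : gcdz (gcdz a1 a2) (gcdz b1 b2) = 1)
    (detE : a1 * b2 - a2 * b1 = 2 ^+ eta * gamma)
    (gamma_odd : ~~ (2 %| gamma)%Z)
    (alphaE : alpha = gcdz a1 a2)
    (alpha_odd : ~~ (2 %| alpha)%Z)
    (a1E : a1 = alpha * t1) (a2E : a2 = alpha * t2)
    (t_coprime : coprimez t1 t2)
    (pqE : p * t1 + q * t2 = 1)
    (Mt : 'M[int]_2) (MtE : Mt = tildeM (mxQ p q t1 t2) M)
    (ta tb tc td : int) (MtEntries : Mt = mx2 ta tb tc td)
    (Dt : {fset 'cV[int]_2})
    (DtE : Dt = tildeD (mxQ p q t1 t2) (digits a1 a2 b1 b2))
    (mu : probability (Rn R 2) R)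
    (mu_self_affine : self_affine_measure (int_to_realmx R Mt) (int_to_realset R Dt) mu)
    (eta_gt0 : (0 < eta)%N) :
  spectral_measure mu <->
  [/\ (2 %| ta)%Z, (2 %| td)%Z & (((2 : int) ^+ eta.+1)%R %| tc)%Z].
Proof.
have alpha0 : alpha != 0 by apply: contra alpha_odd => /eqP ->.
(* [alpha] divides the determinant and is odd. *)
have /dvdzP[beta gammaE] : (alpha %| gamma)%Z.
  rewrite -(@Gauss_dvdzr alpha (2 ^+ eta)).
    rewrite -detE a1E a2E -!mulrA -mulrBr; exact: dvdz_mulr.
  rewrite coprimezE abszX coprimeXr// coprimen2.
  by move: alpha_odd; rewrite dvdzE /= dvdn2 negbK.
have beta_odd : ~~ (2 %| beta)%Z.
  by apply: contra gamma_odd => beta2; rewrite gammaE dvdz_mulr.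
move: mu_self_affine.
rewrite DtE (tildeD_digits alpha0 a1E a2E pqE detE erefl gammaE) MtEntries => mu_aff.
apply: (spectral_iff _ alpha_odd beta_odd mu_aff eta_gt0).
exact: (tildeM_quadratic Mexp (det_mxQ pqE) (etrans (esym MtE) MtEntries)).
Qed.
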